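(* Let $\mathcal{K}$ be the functor from the downwards subset category $\mathrm{(ds)}$ to $\mathrm{Rep}^{\mathrm{pol}}(\mathbf{GA})$ given by $\mathcal{K}_L=\mathbf{V}^{\otimes L}$. Then the contravariant functors $$\Phi(M)=\mathrm{Hom}_{\mathrm{(ds)}}(M,\mathcal{K}),\qquad\Psi(N)=\mathrm{Hom}_{\mathbf{GA}(\infty)}(N,\mathcal{K})$$ are mutually quasi-inverse contravariant equivalences of tensor categories between $\mathrm{Mod}_{\mathrm{(ds)}}^{\mathrm{f}}$ and $\mathrm{Rep}^{\mathrm{pol}}(\mathbf{GA})$.
   Context: Everything is over $\mathbf{C}$. $\mathbf{V}=\mathbf{C}^\infty$ has basis $e_1,e_2,\dots$; $\mathbf{GL}(\infty)=\bigcup_d\mathbf{GL}(d)$. Let $\mathbf{t}=e_1^*\colon\mathbf{V}\to\mathbf{C}$. The general affine group $\mathbf{GA}(\infty)$ is the subgroup of $\mathbf{GL}(\infty)$ stabilizing $\mathbf{t}$. A representation of $\mathbf{GA}(\infty)$ is polynomial if it is a subquotient of a finite direct sum of representations $\mathbf{V}^{\otimes n}$; $\mathrm{Rep}^{\mathrm{pol}}(\mathbf{GA})$ is the category of these, with the usual tensor product. $\mathrm{(ds)}$: objects are finite sets; a morphism $L\to L'$ is a pair $(U,f)$ with $U\subset L$ a subset and $f\colon L\setminus U\to L'$ a bijection; the composition of $(U,f)\colon L\to L'$ with $(W,g)\colon L'\to L''$ is $(U\cup f^{-1}(W),g f)$ (with $f$ restricted). $\mathrm{Mod}_{\mathrm{(ds)}}$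 is the category of functors $\mathrm{(ds)}\to\mathrm{Vec}$, $\mathrm{Mod}_{\mathrm{(ds)}}^{\mathrm{f}}$ its full subcategory of finite length objects. Its tensor product is convolution along disjoint union: $(M\otimes N)_z=\mathrm{colim}\,M_x\otimes N_y$ over triples $(x,y,\alpha\colon x\amalg y\to z)$. A morphism $(U,f)$ acts $\mathcal{K}_L=\mathbf{V}^{\otimes U}\otimes\mathbf{V}^{\otimes(L\setminus U)}\to\mathcal{K}_{L'}$ by applying $\mathbf{t}$ to the factors indexed by $U$ and relabelling the others by $f$. $\mathrm{Hom}_{\mathrm{(ds)}}(M,\mathcal{K})$ is the space of natural transformations with $\mathbf{GA}(\infty)$ acting through $\mathcal{K}$; $\mathrm{Hom}_{\mathbf{GA}(\infty)}(N,\mathcal{K})$ is the functor $L\mapsto\mathrm{Hom}_{\mathbf{GA}(\infty)}(N,\mathcal{K}_L)$. An equivalence of tensor categories is a $\mathbf{C}$-linear equivalence that is symmetric monoidal. *)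

(* Defs.v *)
From HB Require Import structures.
From mathcomp Require Import all_boot all_algebra.
From mathcomp Require Import generic_quotient boolp reals complex.

Set Implicit Arguments.
Unset Strict Implicit.
Unset Printing Implicit Defensive.

Import GRing.Theory.
Local Open Scope ring_scope.
Local Open Scope quotient_scope.

(* [adm] singles out the admissible maps from the generators [X] to vector
   spaces; [univ adm] is the vector space receiving the universal admissible
   map.  It is the space of formal linear combinations of generators, two of
   them being identified when no admissible map separates them.  Tensor
   products ([adm] = multilinear) and colimits of tensor products ([adm] =
   bilinear cocone) are instances. *)
Section Univ.
Variables (F : fieldType) (X : Type).
Variable adm : forall W : lmodType F, (X -> W) -> Prop.

Definition formal := seq (F * {classic X}).

Definition evf (W : lmodType F) (phi : X -> W) (u : formal) : W :=
  \sum_(p <- u) p.1 *: phi p.2.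

Definition ueq (u v : formal) : bool :=
  `[< forall (W : lmodType F) (phi : X -> W), adm phi ->
        evf phi u = evf phi v >].

Lemma ueq_refl : reflexive ueq.
Proof. by move=> u; apply/asboolP. Qed.

Lemma ueq_sym : symmetric ueq.
Proof.
by move=> u v; apply/asboolP/asboolP => h W phi hp; rewrite (h W phi hp).
Qed.

Lemma ueq_trans : transitive ueq.
Proof.
move=> v u w /asboolP huv /asboolP hvw; apply/asboolP => W phi hp.
by rewrite (huv _ _ hp) hvw.
Qed.

Canonical ueq_equiv := EquivRel ueq ueq_refl ueq_sym ueq_trans.

Definition univ := {eq_quot ueq_equiv}.
HB.instance Definition _ := Choice.on univ.
HB.instance Definition _ := EqQuotient.on univ.

Definition evq (W : lmodType F) (phi : X -> W) (x : univ) : W :=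
  evf phi (repr x).

Lemma evq_pi (W : lmodType F) (phi : X -> W) (hp : adm phi) u :
  evq phi (\pi_univ u) = evf phi u.
Proof.
rewrite /evq.
have /eqmodP/asboolP/(_ W phi hp) // : \pi_univ (repr (\pi_univ u)) = \pi u.
by rewrite reprK.
Qed.

Lemma univ_sep (x y : univ) :
  (forall (W : lmodType F) (phi : X -> W), adm phi -> evq phi x = evq phi y) ->
  x = y.
Proof.
move=> h; rewrite -[x]reprK -[y]reprK; apply/eqmodP/asboolP => W phi hp.
exact: h.
Qed.

Definition uadd (x y : univ) : univ := \pi_univ (repr x ++ repr y).
Definition uscale (a : F) (x : univ) : univ :=
  \pi_univ [seq (a * p.1, p.2) | p <- repr x].
Definition uzero : univ := \pi_univ [::].
Definition uopp (x : univ) : univ := uscale (-1) x.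

Lemma evq_add (W : lmodType F) (phi : X -> W) (hp : adm phi) x y :
  evq phi (uadd x y) = evq phi x + evq phi y.
Proof. by rewrite evq_pi // /evf big_cat. Qed.

Lemma evq_scale (W : lmodType F) (phi : X -> W) (hp : adm phi) a x :
  evq phi (uscale a x) = a *: evq phi x.
Proof.
rewrite evq_pi // /evq /evf big_map scaler_sumr.
by apply: eq_bigr => p _; rewrite scalerA.
Qed.

Lemma evq_zero (W : lmodType F) (phi : X -> W) (hp : adm phi) :
  evq phi uzero = 0.
Proof. by rewrite evq_pi // /evf big_nil. Qed.

Lemma uaddA : associative uadd.
Proof. by move=> x y z; apply: univ_sep => W phi hp; rewrite !evq_add // addrA. Qed.
Lemma uaddC : commutative uadd.
Proof. by move=> x y; apply: univ_sep => W phi hp; rewrite !evq_add // addrC. Qed.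
Lemma uadd0 : left_id uzero uadd.
Proof.
by move=> x; apply: univ_sep => W phi hp; rewrite evq_add // evq_zero // add0r.
Qed.
Lemma uaddN : left_inverse uzero uopp uadd.
Proof.
move=> x; apply: univ_sep => W phi hp.
by rewrite evq_add // evq_scale // evq_zero // scaleN1r addNr.
Qed.
HB.instance Definition _ := GRing.isZmodule.Build univ uaddA uaddC uadd0 uaddN.

Lemma uscaleA a b (x : univ) : uscale a (uscale b x) = uscale (a * b) x.
Proof. by apply: univ_sep => W phi hp; rewrite !evq_scale // scalerA. Qed.
Lemma uscale1 : left_id 1 uscale.
Proof. by move=> x; apply: univ_sep => W phi hp; rewrite evq_scale // scale1r. Qed.
Lemma uscaleDr : right_distributive uscale +%R.
Proof.
move=> a x y; apply: univ_sep => W phi hp.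
by rewrite evq_scale // !evq_add // !evq_scale // scalerDr.
Qed.
Lemma uscaleDl (x : univ) : {morph uscale^~ x : a b / a + b}.
Proof.
move=> a b; apply: univ_sep => W phi hp.
by rewrite evq_add // !evq_scale // scalerDl.
Qed.
HB.instance Definition _ :=
  GRing.Zmodule_isLmodule.Build F univ uscaleA uscale1 uscaleDr uscaleDl.

Definition gen (x : X) : univ := \pi_univ [:: (1, x)].

Lemma evq_gen (W : lmodType F) (phi : X -> W) (hp : adm phi) x :
  evq phi (gen x) = phi x.
Proof. by rewrite evq_pi // /evf big_seq1 scale1r. Qed.

Lemma evq_linear (W : lmodType F) (phi : X -> W) (hp : adm phi) :
  linear (evq phi).
Proof.
by move=> a x y; rewrite [LHS](evq_add hp) [evq _ (_ *: _)](evq_scale hp).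
Qed.

Lemma univ_sum (x : univ) : x = \sum_(p <- repr x) p.1 *: gen p.2.
Proof.
apply: univ_sep => W phi hp.
pose l : {linear univ -> W} :=
  HB.pack (evq phi) (GRing.isLinear.Build F univ W *:%R _ (evq_linear hp)).
rewrite -[RHS]/(l _) linear_sum {1}/evq /evf; apply: eq_bigr => p _.
by rewrite linearZ /= evq_gen.
Qed.

Lemma univ_ext (W : lmodType F) (f g : univ -> W) :
  linear f -> linear g -> (forall x, f (gen x) = g (gen x)) -> f =1 g.
Proof.
move=> hf hg h x.
pose lf : {linear univ -> W} :=
  HB.pack f (GRing.isLinear.Build F univ W *:%R _ hf).
pose lg : {linear univ -> W} :=
  HB.pack g (GRing.isLinear.Build F univ W *:%R _ hg).
rewrite -[LHS]/(lf x) -[RHS]/(lg x) (univ_sum x) !linear_sum.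
by apply: eq_bigr => p _; rewrite !linearZ /= h.
Qed.

End Univ.

Section Lift.
Variables (F : fieldType) (X : Type).
Variable adm : forall W : lmodType F, (X -> W) -> Prop.
Variables (W : lmodType F) (phi : X -> W) (hphi : adm phi).

Definition lift of adm phi : univ adm -> W := evq phi.
HB.instance Definition _ :=
  GRing.isLinear.Build F (univ adm) W *:%R (lift hphi) (evq_linear hphi).

Lemma lift_gen x : lift hphi (gen adm x) = phi x.
Proof. exact: evq_gen. Qed.

End Lift.

(* Finite sets are carried by types in [Set], so that they form a small
   collection over which natural transformations and colimits can range. *)
Record FinSet := MkFinSet {
  fs_car :> Set;
  fs_fin : exists (n : nat) (e : 'I_n -> fs_car), forall x, exists i, e i = x }.

Lemma fs_enum (L : FinSet) :
  {n : nat & {e : 'I_n -> L & {r : L -> 'I_n | cancel r e}}}.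
Proof.
have [n /cid [e he]] := cid (fs_fin L).
exists n, e, (fun x => projT1 (cid (he x))) => x.
exact: (projT2 (cid (he x))).
Qed.
HB.instance Definition _ (L : FinSet) :=
  Finite.copy (fs_car L) (can_type (projT2 (projT2 (projT2 (fs_enum L))))).

Lemma fin_FinSet (T : finType) (S : Set) (f : T -> S) :
  (forall x, exists i, f i = x) ->
  exists (n : nat) (e : 'I_n -> S), forall x, exists i, e i = x.
Proof.
move=> h; exists #|T|, (fun i => f (enum_val i)) => x.
by have [i <-] := h x; exists (enum_rank i); rewrite enum_rankK.
Qed.

Lemma fs_sum_fin (L L' : FinSet) :
  exists (n : nat) (e : 'I_n -> (L + L')%type), forall x, exists i, e i = x.
Proof. by apply: (@fin_FinSet (L + L')%type (L + L')%type id) => x; exists x. Qed.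
Definition fs_sum (L L' : FinSet) : FinSet := MkFinSet (fs_sum_fin L L').

Lemma fs_empty_fin :
  exists (n : nat) (e : 'I_n -> Empty_set), forall x, exists i, e i = x.
Proof. by exists 0%N, (fun i : 'I_0 => False_rect _ (notF (valP i))) => -[]. Qed.
Definition fs_empty : FinSet := MkFinSet fs_empty_fin.

Record dsmor (L L' : FinSet) := DsMor {
  ds_U : {set L};
  ds_f : {x : L | x \notin ds_U} -> L';
  ds_bij : bijective ds_f }.
Arguments ds_f {L L'} d x.

Lemma ds_id_bij (L : FinSet) :
  bijective (fun x : {x : L | x \notin set0} => val x).
Proof.
have h (x : L) : x \notin set0 by rewrite inE.
by exists (fun x : L => exist _ x (h x)) => // x; apply: val_inj.
Qed.
Definition ds_id (L : FinSet) : dsmor L L := DsMor (@ds_id_bij L).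

Section DsComp.
Variables (L L' L'' : FinSet) (q : dsmor L' L'') (p : dsmor L L').
Definition ds_comp_U : {set L} :=
  ds_U p :|: [set val y | y in [set y | ds_f p y \in ds_U q]].

Lemma ds_compU1 (x : {x : L | x \notin ds_comp_U}) : val x \notin ds_U p.
Proof. by case: x => x /=; rewrite inE negb_or => /andP[]. Qed.

Lemma ds_compU2 (x : {x : L | x \notin ds_comp_U}) :
  ds_f p (exist _ (val x) (ds_compU1 x)) \notin ds_U q.
Proof.
case: x => x hx; apply/negP => /= h; move/negP: (hx); apply.
rewrite !inE; apply/orP; right; apply/imsetP.
by exists (exist _ x (ds_compU1 (exist _ x hx))); rewrite ?inE.
Qed.

Definition ds_comp_f (x : {x : L | x \notin ds_comp_U}) : L'' :=
  ds_f q (exist _ (ds_f p (exist _ (val x) (ds_compU1 x))) (ds_compU2 x)).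

Lemma ds_comp_bij : bijective ds_comp_f.
Proof.
have [q' qK q'K] := ds_bij q; have [p' pK p'K] := ds_bij p.
have hinj : injective ds_comp_f.
  move=> x y /(can_inj qK)/(congr1 val) /= /(can_inj pK)/(congr1 val) /= h.
  exact: val_inj.
have hsurj z : exists x, ds_comp_f x = z.
  have hx : val (p' (val (q' z))) \notin ds_comp_U.
    rewrite !inE negb_or (valP (p' _)) /=; apply/imsetP => -[y].
    rewrite inE => hy /val_inj e; move: hy; rewrite -e p'K.
    by apply/negP; exact: (valP (q' z)).
  exists (exist (fun x => is_true (x \notin ds_comp_U)) _ hx); rewrite -[RHS]q'K /ds_comp_f; congr ds_f.
  apply: val_inj => /=; rewrite -[RHS]p'K; congr ds_f; exact: val_inj.
exists (fun z => projT1 (cid (hsurj z))) => x.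
  by apply: hinj; exact: projT2 (cid (hsurj (ds_comp_f x))).
exact: projT2 (cid (hsurj x)).
Qed.

Definition ds_comp : dsmor L L'' := DsMor ds_comp_bij.
End DsComp.

(* Extensional view of (U, f): the partial map defined off U. *)
Definition ds_pm (L L' : FinSet) (p : dsmor L L') (x : L) : option L' :=
  omap (ds_f p) (insub x).

Lemma ds_pmT L L' (p : dsmor L L') x (h : x \notin ds_U p) :
  ds_pm p x = Some (ds_f p (exist _ x h)).
Proof. by rewrite /ds_pm insubT. Qed.

Lemma ds_pmF L L' (p : dsmor L L') x : x \in ds_U p -> ds_pm p x = None.
Proof. by move=> h; rewrite /ds_pm insubF //= h. Qed.

Lemma ds_UE L L' (p : dsmor L L') x : (x \in ds_U p) = ~~ ds_pm p x.
Proof.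
by case: (boolP (x \in ds_U p)) => h; [rewrite ds_pmF | rewrite (ds_pmT h)].
Qed.

Lemma ds_ext L L' (p q : dsmor L L') : ds_pm p =1 ds_pm q -> p = q.
Proof.
move=> h; have hU : ds_U p = ds_U q by apply/setP => x; rewrite !ds_UE h.
case: p q h hU => U f bf [U' f' bf'] /= h hU; move: h; case: U' / hU f' bf'.
move=> f' bf' h; suff e : f = f'.
  by case: f' / e bf' h => bf' h; congr DsMor; apply: Prop_irrelevance.
apply/funext => -[x hx]; move: (h x).
rewrite (@ds_pmT _ _ (DsMor bf) x hx) (@ds_pmT _ _ (DsMor bf') x hx) /=.
by case.
Qed.

Lemma ds_pm_inj L L' (p : dsmor L L') x y z :
  ds_pm p x = Some z -> ds_pm p y = Some z -> x = y.
Proof.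
case: (boolP (x \in ds_U p)) => hx; first by rewrite (ds_pmF hx).
case: (boolP (y \in ds_U p)) => hy; first by rewrite (ds_pmF hy).
rewrite (ds_pmT hx) (ds_pmT hy) => -[<-] [] /(bij_inj (ds_bij p)).
by move/(congr1 val).
Qed.

Lemma ds_pm_surj L L' (p : dsmor L L') z : exists x, ds_pm p x = Some z.
Proof.
have [g _ gK] := ds_bij p; exists (val (g z)).
rewrite (ds_pmT (valP (g z))); congr Some; rewrite -[RHS]gK; congr ds_f.
exact: val_inj.
Qed.

Lemma ds_pm_id L x : ds_pm (ds_id L) x = Some x.
Proof. by rewrite (@ds_pmT _ _ (ds_id L) x) ?inE. Qed.

Lemma ds_pm_comp L L' L'' (q : dsmor L' L'') (p : dsmor L L') x :
  ds_pm (ds_comp q p) x = obind (ds_pm q) (ds_pm p x).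
Proof.
case: (boolP (x \in ds_U p)) => hx.
  by rewrite (ds_pmF hx) ds_pmF //= inE hx.
rewrite (ds_pmT hx) /=; case: (boolP (ds_f p (exist _ x hx) \in ds_U q)) => hy.
  rewrite (ds_pmF hy) ds_pmF // !inE; apply/orP; right; apply/imsetP.
  by exists (exist _ x hx); rewrite ?inE.
have hxy : x \notin ds_comp_U q p.
  rewrite !inE negb_or hx /=; apply/imsetP => -[y]; rewrite inE => hy' e.
  move/negP: hy; apply; rewrite -(_ : y = exist _ x hx) //.
  exact: val_inj.
rewrite (ds_pmT hy) (@ds_pmT _ _ (ds_comp q p) x hxy); congr Some.
rewrite /= /ds_comp_f; congr ds_f; apply: val_inj => /=; congr ds_f.
exact: val_inj.
Qed.

Section DsOfPm.
Variables (L L' : FinSet) (p : L -> option L').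
Hypothesis p_inj : forall x y z, p x = Some z -> p y = Some z -> x = y.
Hypothesis p_surj : forall z, exists x, p x = Some z.

Definition pmU : {set L} := [set x | p x == None].

Lemma pm_total (x : {x : L | x \notin pmU}) : {y | p (val x) = Some y}.
Proof. by case: x => x /=; rewrite inE; case: (p x) => // y _; exists y. Qed.

Lemma ds_of_pm_bij :
  bijective (fun x : {x : L | x \notin pmU} => projT1 (pm_total x)).
Proof.
have h z : {x : {x : L | x \notin pmU} | p (val x) = Some z}.
  have [x hx] := cid (p_surj z).
  have hU : x \notin pmU by rewrite inE hx.
  by exists (exist _ x hU).
exists (fun z => projT1 (h z)) => [x|z].
  apply: val_inj; apply: (@p_inj _ _ (projT1 (pm_total x))).
    exact: projT2 (h _).
  exact: projT2 (pm_total x).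
have e1 := projT2 (pm_total (projT1 (h z))); have e2 := projT2 (h z).
exact: Some_inj (etrans (esym e1) e2).
Qed.

Definition ds_of_pm : dsmor L L' := DsMor ds_of_pm_bij.

Lemma ds_of_pmE x : ds_pm ds_of_pm x = p x.
Proof.
case: (boolP (x \in pmU)) => h.
  by rewrite ds_pmF //; move: h; rewrite inE => /eqP ->.
rewrite (@ds_pmT _ _ ds_of_pm x h) /=.
by rewrite -(projT2 (pm_total (exist _ x h))).
Qed.
End DsOfPm.

Section DsOfBij.
Variables (L L' : FinSet) (h : L -> L') (hb : bijective h).
Lemma ds_of_bij_inj x y z : Some (h x) = Some z -> Some (h y) = Some z -> x = y.
Proof. by move=> [<-] [/(bij_inj hb)]. Qed.
Lemma ds_of_bij_surj z : exists x, Some (h x) = Some z.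
Proof. by have [g _ gK] := hb; exists (g z); rewrite gK. Qed.
Definition ds_of_bij : dsmor L L' := ds_of_pm ds_of_bij_inj ds_of_bij_surj.
Lemma ds_of_bijE x : ds_pm ds_of_bij x = Some (h x).
Proof. exact: ds_of_pmE. Qed.
End DsOfBij.

Section DsSum.
Variables (L1 L1' L2 L2' : FinSet) (p1 : dsmor L1 L1') (p2 : dsmor L2 L2').
Definition pm_sum (x : fs_sum L1 L2) : option (fs_sum L1' L2') :=
  match x with
  | inl a => omap inl (ds_pm p1 a)
  | inr b => omap inr (ds_pm p2 b)
  end.
Lemma pm_sum_inj x y z : pm_sum x = Some z -> pm_sum y = Some z -> x = y.
Proof.
case: x y z => [a|b] [a'|b'] [c|d] /=;
  do ?[case e1: (ds_pm _ _) => //=]; do ?[case e2: (ds_pm _ _) => //=].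
- by move=> [e] [e']; rewrite e in e1; rewrite e' in e2; rewrite (ds_pm_inj e1 e2).
- by move=> [e] [e']; rewrite e in e1; rewrite e' in e2; rewrite (ds_pm_inj e1 e2).
Qed.
Lemma pm_sum_surj z : exists x, pm_sum x = Some z.
Proof.
case: z => [c|d].
  by have [x hx] := ds_pm_surj p1 c; exists (inl x); rewrite /= hx.
by have [x hx] := ds_pm_surj p2 d; exists (inr x); rewrite /= hx.
Qed.
Definition ds_sum : dsmor (fs_sum L1 L2) (fs_sum L1' L2') :=
  ds_of_pm pm_sum_inj pm_sum_surj.
Lemma ds_sumE x : ds_pm ds_sum x = pm_sum x.
Proof. exact: ds_of_pmE. Qed.
End DsSum.

Definition sumA_f (A B C : FinSet) (x : fs_sum (fs_sum A B) C) :
    fs_sum A (fs_sum B C) :=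
  match x with
  | inl (inl a) => inl a
  | inl (inr b) => inr (inl b)
  | inr c => inr (inr c)
  end.
Definition sumA_g (A B C : FinSet) (x : fs_sum A (fs_sum B C)) :
    fs_sum (fs_sum A B) C :=
  match x with
  | inl a => inl (inl a)
  | inr (inl b) => inl (inr b)
  | inr (inr c) => inr c
  end.
Lemma sumA_fb (A B C : FinSet) : bijective (@sumA_f A B C).
Proof. by exists (@sumA_g A B C); [case=> [[]|] | case=> [|[]]]. Qed.
Lemma sumA_gb (A B C : FinSet) : bijective (@sumA_g A B C).
Proof. by exists (@sumA_f A B C); [case=> [|[]] | case=> [[]|]]. Qed.
Definition sumC_f (A B : FinSet) (x : fs_sum A B) : fs_sum B A :=
  match x with inl a => inr a | inr b => inl b end.
Lemma sumC_fb (A B : FinSet) : bijective (@sumC_f A B).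
Proof. by exists (@sumC_f B A); case. Qed.
Definition sum0l_f (A : FinSet) (x : fs_sum fs_empty A) : A :=
  match x with inl e => match e with end | inr a => a end.
Lemma sum0l_fb (A : FinSet) : bijective (@sum0l_f A).
Proof. by exists inr => // -[[]|]. Qed.
Lemma sum0l_gb (A : FinSet) : bijective (inr : A -> fs_sum fs_empty A).
Proof. by exists (@sum0l_f A) => // -[[]|]. Qed.
Definition sum0r_f (A : FinSet) (x : fs_sum A fs_empty) : A :=
  match x with inl a => a | inr e => match e with end end.
Lemma sum0r_fb (A : FinSet) : bijective (@sum0r_f A).
Proof. by exists inl => // -[|[]]. Qed.
Lemma sum0r_gb (A : FinSet) : bijective (inl : A -> fs_sum A fs_empty).
Proof. by exists (@sum0r_f A) => // -[|[]]. Qed.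

Definition ds_assoc A B C := ds_of_bij (@sumA_fb A B C).
Definition ds_assocV A B C := ds_of_bij (@sumA_gb A B C).
Definition ds_swap A B := ds_of_bij (@sumC_fb A B).
Definition ds_lu A := ds_of_bij (@sum0l_fb A).
Definition ds_luV A := ds_of_bij (@sum0l_gb A).
Definition ds_ru A := ds_of_bij (@sum0r_fb A).
Definition ds_ruV A := ds_of_bij (@sum0r_gb A).

Lemma ds_compA A B C D (r : dsmor C D) (q : dsmor B C) (p : dsmor A B) :
  ds_comp r (ds_comp q p) = ds_comp (ds_comp r q) p.
Proof.
apply: ds_ext => x; rewrite !ds_pm_comp; case: (ds_pm p x) => //= y.
by rewrite ds_pm_comp.
Qed.
Lemma ds_comp1 A B (p : dsmor A B) : ds_comp p (ds_id A) = p.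
Proof. by apply: ds_ext => x; rewrite ds_pm_comp ds_pm_id. Qed.
Lemma ds_1comp A B (p : dsmor A B) : ds_comp (ds_id B) p = p.
Proof.
apply: ds_ext => x; rewrite ds_pm_comp; case: (ds_pm p x) => //= y.
exact: ds_pm_id.
Qed.
Lemma ds_sum1 A B : ds_sum (ds_id A) (ds_id B) = ds_id (fs_sum A B).
Proof.
by apply: ds_ext => -[x|x]; rewrite ds_sumE !ds_pm_id /= ds_pm_id.
Qed.
Lemma ds_sum_comp A B C A' B' C' (q : dsmor B C) (p : dsmor A B)
    (q' : dsmor B' C') (p' : dsmor A' B') :
  ds_sum (ds_comp q p) (ds_comp q' p') = ds_comp (ds_sum q q') (ds_sum p p').
Proof.
apply: ds_ext => -[x|x]; rewrite ds_pm_comp !ds_sumE /= ds_pm_comp.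
  by case: (ds_pm p x) => //= y; rewrite ds_sumE.
by case: (ds_pm p' x) => //= y; rewrite ds_sumE.
Qed.
Ltac dscase :=
  rewrite ?ds_pm_comp ?ds_sumE ?ds_of_bijE ?ds_pm_id //=.
Lemma ds_assoc_nat A B C A' B' C' (p : dsmor A A') (q : dsmor B B')
    (r : dsmor C C') :
  ds_comp (ds_assoc A' B' C') (ds_sum (ds_sum p q) r) =
  ds_comp (ds_sum p (ds_sum q r)) (ds_assoc A B C).
Proof.
apply: ds_ext => -[[x|x]|x]; do 4! dscase.
- by case: (ds_pm p x) => //= y; dscase.
- by case: (ds_pm q x) => //= y; dscase.
- by case: (ds_pm r x) => //= y; dscase.
Qed.
Lemma ds_assocV_nat A B C A' B' C' (p : dsmor A A') (q : dsmor B B')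
    (r : dsmor C C') :
  ds_comp (ds_assocV A' B' C') (ds_sum p (ds_sum q r)) =
  ds_comp (ds_sum (ds_sum p q) r) (ds_assocV A B C).
Proof.
apply: ds_ext => -[x|[x|x]]; do 4! dscase.
- by case: (ds_pm p x) => //= y; dscase.
- by case: (ds_pm q x) => //= y; dscase.
- by case: (ds_pm r x) => //= y; dscase.
Qed.
Lemma ds_assocK A B C :
  ds_comp (ds_assocV A B C) (ds_assoc A B C) = ds_id _.
Proof. by apply: ds_ext => -[[x|x]|x]; do 3! dscase. Qed.
Lemma ds_assocVK A B C :
  ds_comp (ds_assoc A B C) (ds_assocV A B C) = ds_id _.
Proof. by apply: ds_ext => -[x|[x|x]]; do 3! dscase. Qed.
Lemma ds_swap_nat A B A' B' (p : dsmor A A') (q : dsmor B B') :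
  ds_comp (ds_swap A' B') (ds_sum p q) = ds_comp (ds_sum q p) (ds_swap A B).
Proof.
apply: ds_ext => -[x|x]; do 4! dscase.
- by case: (ds_pm p x) => //= y; dscase.
- by case: (ds_pm q x) => //= y; dscase.
Qed.
Lemma ds_swapK A B : ds_comp (ds_swap B A) (ds_swap A B) = ds_id _.
Proof. by apply: ds_ext => -[x|x]; do 3! dscase. Qed.
Lemma ds_luK A : ds_comp (ds_luV A) (ds_lu A) = ds_id _.
Proof. by apply: ds_ext => -[[]|x]; do 3! dscase. Qed.
Lemma ds_luVK A : ds_comp (ds_lu A) (ds_luV A) = ds_id _.
Proof. by apply: ds_ext => x; do 3! dscase. Qed.
Lemma ds_ruK A : ds_comp (ds_ruV A) (ds_ru A) = ds_id _.
Proof. by apply: ds_ext => -[x|[]]; do 3! dscase. Qed.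
Lemma ds_ruVK A : ds_comp (ds_ru A) (ds_ruV A) = ds_id _.
Proof. by apply: ds_ext => x; do 3! dscase. Qed.
Lemma ds_lu_nat A B (p : dsmor A B) :
  ds_comp (ds_lu B) (ds_sum (ds_id _) p) = ds_comp p (ds_lu A).
Proof.
apply: ds_ext => -[[]|x]; do 4! dscase.
by case: (ds_pm p x) => //= y; dscase.
Qed.
Lemma ds_ru_nat A B (p : dsmor A B) :
  ds_comp (ds_ru B) (ds_sum p (ds_id _)) = ds_comp p (ds_ru A).
Proof.
apply: ds_ext => -[x|[]]; do 4! dscase.
by case: (ds_pm p x) => //= y; dscase.
Qed.
Lemma ds_pent A B C D :
  ds_comp (ds_assocV (fs_sum A B) C D) (ds_assocV A B (fs_sum C D)) =
  ds_comp (ds_comp (ds_sum (ds_assocV A B C) (ds_id D))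
    (ds_assocV A (fs_sum B C) D)) (ds_sum (ds_id A) (ds_assocV B C D)).
Proof. by apply: ds_ext => -[x|[x|[x|x]]]; do 5! dscase. Qed.
Lemma ds_hex A B C :
  ds_comp (ds_comp (ds_assocV A B C) (ds_swap (fs_sum B C) A))
    (ds_assocV B C A) =
  ds_comp (ds_comp (ds_sum (ds_swap B A) (ds_id C)) (ds_assocV B A C))
    (ds_sum (ds_id B) (ds_swap C A)).
Proof. by apply: ds_ext => -[x|[x|x]]; do 5! dscase. Qed.
Lemma ds_swap_lu A : ds_comp (ds_swap fs_empty A) (ds_luV A) = ds_ruV A.
Proof. by apply: ds_ext => x; do 3! dscase. Qed.
Lemma ds_tri A B :
  ds_comp (ds_assocV A fs_empty B) (ds_sum (ds_id A) (ds_luV B)) =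
  ds_sum (ds_ruV A) (ds_id B).
Proof. by apply: ds_ext => -[x|x]; do 5! dscase. Qed.
Lemma ds_luV_nat A B (p : dsmor A B) :
  ds_comp (ds_luV B) p = ds_comp (ds_sum (ds_id _) p) (ds_luV A).
Proof.
apply: ds_ext => x; do 4! dscase.
by case: (ds_pm p x) => //= y; dscase.
Qed.

Record lincat (F : fieldType) := LinCat {
  ob :> Type;
  hom : ob -> ob -> lmodType F;
  idm : forall A, hom A A;
  cmp : forall A B C, hom B C -> hom A B -> hom A C;
  cmp_linl : forall A B C (f : hom A B),
    linear (fun g : hom B C => cmp g f : hom A C);
  cmp_linr : forall A B C (g : hom B C),
    linear (fun f : hom A B => cmp g f : hom A C);
  cmpA : forall A B C D (h : hom C D) (g : hom B C) (f : hom A B),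
    cmp h (cmp g f) = cmp (cmp h g) f;
  cmp1m : forall A B (f : hom A B), cmp (idm B) f = f;
  cmpm1 : forall A B (f : hom A B), cmp f (idm A) = f }.
Arguments hom {F l} _ _.
Arguments idm {F l} A.
Arguments cmp {F l A B C} _ _.

Declare Scope lincat_scope.
Delimit Scope lincat_scope with lincat.
Local Open Scope lincat_scope.
Notation "g '\oc' f" := (cmp g f) (at level 50, left associativity) : lincat_scope.

Record iso (F : fieldType) (C : lincat F) (A B : C) := Iso {
  fwd : hom A B;
  bwd : hom B A;
  fwdK : bwd \oc fwd = idm A;
  bwdK : fwd \oc bwd = idm B }.

Record tencat (F : fieldType) := TenCat {
  tcat :> lincat F;
  tens : tcat -> tcat -> tcat;
  tmor : forall A A' B B' : tcat,
    hom A A' -> hom B B' -> hom (tens A B) (tens A' B');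
  tmor_linl : forall (A A' B B' : tcat) (g : hom B B'),
    linear (fun f : hom A A' => tmor f g);
  tmor_linr : forall (A A' B B' : tcat) (f : hom A A'),
    linear (fun g : hom B B' => tmor f g);
  tmor1 : forall A B, tmor (idm A) (idm B) = idm (tens A B);
  tmorM : forall (A A' A'' B B' B'' : tcat) (f' : hom A' A'') (f : hom A A')
      (g' : hom B' B'') (g : hom B B'),
    tmor (f' \oc f) (g' \oc g) = tmor f' g' \oc tmor f g;
  tunit : tcat;
  assoc : forall A B C, iso (tens (tens A B) C) (tens A (tens B C));
  lunit : forall A, iso (tens tunit A) A;
  runit : forall A, iso (tens A tunit) A;
  braid : forall A B, hom (tens A B) (tens B A);
  assoc_nat : forall (A A' B B' C C' : tcat)
      (f : hom A A') (g : hom B B') (h : hom C C'),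
    fwd (assoc A' B' C') \oc tmor (tmor f g) h =
    tmor f (tmor g h) \oc fwd (assoc A B C);
  lunit_nat : forall (A A' : tcat) (f : hom A A'),
    fwd (lunit A') \oc tmor (idm tunit) f = f \oc fwd (lunit A);
  runit_nat : forall (A A' : tcat) (f : hom A A'),
    fwd (runit A') \oc tmor f (idm tunit) = f \oc fwd (runit A);
  braid_nat : forall (A A' B B' : tcat) (f : hom A A') (g : hom B B'),
    braid A' B' \oc tmor f g = tmor g f \oc braid A B;
  braidK : forall A B, braid B A \oc braid A B = idm (tens A B);
  triangle : forall A B,
    tmor (idm A) (fwd (lunit B)) \oc fwd (assoc A tunit B) =
    tmor (fwd (runit A)) (idm B);
  pentagon : forall A B C D,
    fwd (assoc A B (tens C D)) \oc fwd (assoc (tens A B) C D) =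
    tmor (idm A) (fwd (assoc B C D)) \oc fwd (assoc A (tens B C) D)
      \oc tmor (fwd (assoc A B C)) (idm D);
  hexagon : forall A B C,
    fwd (assoc B C A) \oc braid A (tens B C) \oc fwd (assoc A B C) =
    tmor (idm B) (braid A C) \oc fwd (assoc B A C)
      \oc tmor (braid A B) (idm C) }.
Arguments tens {F t} _ _.
Arguments tmor {F t A A' B B'} _ _.
Arguments tunit {F t}.
Arguments assoc {F t} A B C.
Arguments lunit {F t} A.
Arguments runit {F t} A.
Arguments braid {F t} A B.

Section Full.
Variable F : fieldType.

Section FullLin.
Variables (C : lincat F) (P : C -> Prop).
Definition full_lincat : lincat F :=
  @LinCat F {A : C | P A} (fun A B => hom (sval A) (sval B))
    (fun A => idm (sval A))
    (fun A B D g f => g \oc f)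
    (fun A B D f => @cmp_linl _ C _ _ _ f)
    (fun A B D g => @cmp_linr _ C _ _ _ g)
    (fun A B D E h g f => cmpA h g f)
    (fun A B f => cmp1m f) (fun A B f => cmpm1 f).

Definition full_iso (A B : full_lincat) (i : iso (sval A) (sval B)) : iso A B :=
  @Iso F full_lincat A B (fwd i) (bwd i) (fwdK i) (bwdK i).
End FullLin.

Definition tensor_closed (C : tencat F) (P : C -> Prop) : Prop :=
  P tunit /\ forall A B, P A -> P B -> P (tens A B).

Section FullTen.
Variables (C : tencat F) (P : C -> Prop) (hP : tensor_closed P).
Let FC : lincat F := full_lincat P.
Let ft (A B : FC) : FC :=
  exist _ (tens (sval A) (sval B)) (hP.2 (sval A) (sval B) (svalP A) (svalP B)).
Let f1 : FC := exist _ tunit hP.1.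
Definition full_tencat : tencat F :=
  @TenCat F FC ft
    (fun A A' B B' f g => tmor f g)
    (fun A A' B B' g => @tmor_linl F C _ _ _ _ g)
    (fun A A' B B' f => @tmor_linr F C _ _ _ _ f)
    (fun A B => tmor1 (sval A) (sval B))
    (fun A A' A'' B B' B'' f' f g' g => tmorM f' f g' g)
    f1
    (fun A B D => @full_iso C P (ft (ft A B) D) (ft A (ft B D))
                    (assoc (sval A) (sval B) (sval D)))
    (fun A => @full_iso C P (ft f1 A) A (lunit (sval A)))
    (fun A => @full_iso C P (ft A f1) A (runit (sval A)))
    (fun A B => braid (sval A) (sval B))
    (fun A A' B B' D D' f g h => assoc_nat f g h)
    (fun A A' f => lunit_nat f)
    (fun A A' f => runit_nat f)
    (fun A A' B B' f g => braid_nat f g)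
    (fun A B => braidK (sval A) (sval B))
    (fun A B => triangle (sval A) (sval B))
    (fun A B D E => pentagon (sval A) (sval B) (sval D) (sval E))
    (fun A B D => hexagon (sval A) (sval B) (sval D)).
End FullTen.
End Full.

Record cfunctor (F : fieldType) (C D : lincat F) := CFunctor {
  cob :> C -> D;
  cmor : forall A B : C, hom A B -> hom (cob B) (cob A);
  cmor_lin : forall A B : C, linear (@cmor A B);
  cmor1 : forall A : C, cmor (idm A) = idm (cob A);
  cmorM : forall (A B E : C) (g : hom B E) (f : hom A B),
    cmor (g \oc f) = cmor f \oc cmor g }.
Arguments cmor {F C D} _ {A B} _.

Definition cfunctor_full (F : fieldType) (C D : lincat F)
    (P : C -> Prop) (Q : D -> Prop) (G : cfunctor C D)
    (h : forall A, P A -> Q (G A)) :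
    cfunctor (full_lincat P) (full_lincat Q) :=
  @CFunctor F (full_lincat P) (full_lincat Q)
    (fun A => exist Q (G (sval A)) (h (sval A) (svalP A)))
    (fun A B f => cmor G f)
    (fun A B => @cmor_lin _ _ _ G (sval A) (sval B))
    (fun A => cmor1 G (sval A))
    (fun A B E g f => cmorM G g f).

Definition id_iso_comp (F : fieldType) (C D : lincat F)
    (G : cfunctor D C) (H : cfunctor C D) : Prop :=
  exists eta : forall A : C, iso A (G (H A)),
    forall (A B : C) (f : hom A B),
      cmor G (cmor H f) \oc fwd (eta A) = fwd (eta B) \oc f.

Definition quasi_inverse (F : fieldType) (C D : lincat F)
    (H : cfunctor C D) (G : cfunctor D C) : Prop :=
  id_iso_comp G H /\ id_iso_comp H G.

(* A (strong) symmetric monoidal structure on a contravariant functor; as the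
   functor reverses arrows, it is applied to inverses of the structural
   isomorphisms of the source. *)
Record sym_monoidal (F : fieldType) (C D : tencat F) (G : cfunctor C D) :=
  SymMonoidal {
  mon_tens : forall A B : C, iso (tens (G A) (G B)) (G (tens A B));
  mon_unit : iso tunit (G tunit);
  mon_nat : forall (A A' B B' : C) (f : hom A A') (g : hom B B'),
    fwd (mon_tens A B) \oc tmor (cmor G f) (cmor G g) =
    cmor G (tmor f g) \oc fwd (mon_tens A' B');
  mon_assoc : forall A B E : C,
    cmor G (bwd (assoc A B E)) \oc fwd (mon_tens (tens A B) E)
      \oc tmor (fwd (mon_tens A B)) (idm (G E)) =
    fwd (mon_tens A (tens B E)) \oc tmor (idm (G A)) (fwd (mon_tens B E))
      \oc fwd (assoc (G A) (G B) (G E));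
  mon_lunit : forall A : C,
    cmor G (bwd (lunit A)) \oc fwd (mon_tens tunit A)
      \oc tmor (fwd mon_unit) (idm (G A)) = fwd (lunit (G A));
  mon_runit : forall A : C,
    cmor G (bwd (runit A)) \oc fwd (mon_tens A tunit)
      \oc tmor (idm (G A)) (fwd mon_unit) = fwd (runit (G A));
  mon_braid : forall A B : C,
    cmor G (braid B A) \oc fwd (mon_tens A B) =
    fwd (mon_tens B A) \oc braid (G A) (G B) }.

Section LinFacts.
Variables (F : fieldType) (U V W : lmodType F).
Definition to_lin (f : U -> V) (h : linear f) : {linear U -> V} :=
  HB.pack f (GRing.isLinear.Build F U V *:%R f h).
Lemma lin_id : linear (fun u : U => u). Proof. by []. Qed.
Lemma lin_comp (g : V -> W) (f : U -> V) :
  linear g -> linear f -> linear (fun u => g (f u)).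
Proof. by move=> hg hf a u v; rewrite hf hg. Qed.
Lemma lin_comb (a : F) (f g : U -> V) :
  linear f -> linear g -> linear (fun u => a *: f u + g u).
Proof.
move=> hf hg b u v; rewrite hf hg !scalerDr !scalerA addrACA.
by rewrite [a * b]mulrC.
Qed.
Lemma lin_D (f : U -> V) (u v : U) : linear f -> f (u + v) = f u + f v.
Proof. by move=> h; rewrite -[LHS]/(to_lin h _) linearD. Qed.
Lemma lin_Z (f : U -> V) a (u : U) : linear f -> f (a *: u) = a *: f u.
Proof. by move=> h; rewrite -[LHS]/(to_lin h _) linearZ. Qed.
End LinFacts.

Section DsMod.
Variable F : fieldType.

Record dsmod := MkDsMod {
  dsv :> FinSet -> lmodType F;
  dsact : forall L L', dsmor L L' -> dsv L -> dsv L';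
  dsact_lin : forall L L' (p : dsmor L L'), linear (dsact p);
  dsact_id : forall L (x : dsv L), dsact (ds_id L) x = x;
  dsact_comp : forall L L' L'' (q : dsmor L' L'') (p : dsmor L L') (x : dsv L),
    dsact (ds_comp q p) x = dsact q (dsact p x) }.
Arguments dsact M {L L'} p x : rename.

HB.instance Definition _ (M : dsmod) L L' (p : dsmor L L') :=
  GRing.isLinear.Build F (M L) (M L') *:%R (dsact M p) (@dsact_lin M L L' p).

Record dshom (M N : dsmod) := MkDsHom {
  dh :> forall L, M L -> N L;
  dh_lin : forall L, linear (@dh L);
  dh_nat : forall L L' (p : dsmor L L') (x : M L),
    @dh L' (dsact M p x) = dsact N p (@dh L x) }.
Arguments dh {M N} f L x : rename.

HB.instance Definition _ (M N : dsmod) (f : dshom M N) L :=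
  GRing.isLinear.Build F (M L) (N L) *:%R (dh f L) (@dh_lin M N f L).

Lemma dshom_ext (M N : dsmod) (f g : dshom M N) :
  (forall L x, f L x = g L x) -> f = g.
Proof.
case: f g => f fl fn [g gl gn] /= h.
have e : f = g by apply: functional_extensionality_dep => L; apply/funext.
by case: g / e gl gn h => gl gn _; congr MkDsHom; apply: Prop_irrelevance.
Qed.

Section HomSpace.
Variables (M N : dsmod).
HB.instance Definition _ := gen_eqMixin (dshom M N).
HB.instance Definition _ := gen_choiceMixin (dshom M N).

Lemma dh0_lin L : linear (fun _ : M L => 0 : N L).
Proof. by move=> a u v; rewrite scaler0 addr0. Qed.
Lemma dh0_nat L L' (p : dsmor L L') (x : M L) : (0 : N L') = dsact N p 0.
Proof. by rewrite linear0. Qed.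
Definition dh0 : dshom M N := MkDsHom dh0_lin dh0_nat.

Lemma dhP_lin a (f g : dshom M N) L : linear (fun x => a *: f L x + g L x).
Proof. apply: lin_comb; exact: dh_lin. Qed.
Lemma dhP_nat a (f g : dshom M N) L L' (p : dsmor L L') (x : M L) :
  a *: f L' (dsact M p x) + g L' (dsact M p x) =
  dsact N p (a *: f L x + g L x).
Proof. by rewrite linearP /= !dh_nat. Qed.
Definition dhP a (f g : dshom M N) : dshom M N :=
  MkDsHom (dhP_lin a f g) (dhP_nat a f g).

Definition dh_add (f g : dshom M N) := dhP 1 f g.
Definition dh_scale a (f : dshom M N) := dhP a f dh0.
Definition dh_opp (f : dshom M N) := dhP (-1) f dh0.

Lemma dh_addA : associative dh_add.
Proof. by move=> f g h; apply: dshom_ext => L x /=; rewrite !scale1r addrA. Qed.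
Lemma dh_addC : commutative dh_add.
Proof. by move=> f g; apply: dshom_ext => L x /=; rewrite !scale1r addrC. Qed.
Lemma dh_add0 : left_id dh0 dh_add.
Proof. by move=> f; apply: dshom_ext => L x /=; rewrite scale1r add0r. Qed.
Lemma dh_addN : left_inverse dh0 dh_opp dh_add.
Proof.
by move=> f; apply: dshom_ext => L x /=; rewrite scale1r addr0 scaleN1r addNr.
Qed.
HB.instance Definition _ :=
  GRing.isZmodule.Build (dshom M N) dh_addA dh_addC dh_add0 dh_addN.

Lemma dh_addE (f g : dshom M N) L x : (f + g) L x = f L x + g L x.
Proof. by rewrite -[LHS]/(1 *: f L x + g L x) scale1r. Qed.

Lemma dh_scaleA a b f : dh_scale a (dh_scale b f) = dh_scale (a * b) f.
Proof. by apply: dshom_ext => L x /=; rewrite !addr0 scalerA. Qed.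
Lemma dh_scale1 : left_id 1 dh_scale.
Proof. by move=> f; apply: dshom_ext => L x /=; rewrite addr0 scale1r. Qed.
Lemma dh_scaleDr : right_distributive dh_scale +%R.
Proof.
move=> a f g; apply: dshom_ext => L x.
by rewrite dh_addE /= !addr0 scale1r scalerDr.
Qed.
Lemma dh_scaleDl f : {morph dh_scale^~ f : a b / a + b}.
Proof.
by move=> a b; apply: dshom_ext => L x; rewrite dh_addE /= !addr0 scalerDl.
Qed.
HB.instance Definition _ := GRing.Zmodule_isLmodule.Build F (dshom M N)
  dh_scaleA dh_scale1 dh_scaleDr dh_scaleDl.

Lemma dh_scaleE a (f : dshom M N) L x : (a *: f) L x = a *: f L x.
Proof. by rewrite -[LHS]/(a *: f L x + 0) addr0. Qed.
Lemma dh_PE a (f g : dshom M N) L x :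
  (a *: f + g) L x = a *: f L x + g L x.
Proof. by rewrite dh_addE dh_scaleE. Qed.
End HomSpace.

Lemma dhid_lin (M : dsmod) L : linear (fun x : M L => x).
Proof. by []. Qed.
Definition dhid (M : dsmod) : dshom M M :=
  MkDsHom (@dhid_lin M) (fun L L' p x => erefl).

Section HomComp.
Variables (M N P : dsmod) (g : dshom N P) (f : dshom M N).
Lemma dhcomp_lin L : linear (fun x => g L (f L x)).
Proof. apply: lin_comp; exact: dh_lin. Qed.
Lemma dhcomp_nat L L' (p : dsmor L L') (x : M L) :
  g L' (f L' (dsact M p x)) = dsact P p (g L (f L x)).
Proof. by rewrite !dh_nat. Qed.
Definition dhcomp : dshom M P := MkDsHom dhcomp_lin dhcomp_nat.
End HomComp.

Lemma dhcomp_linl (M N P : dsmod) (f : dshom M N) :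
  linear (fun g : dshom N P => dhcomp g f).
Proof.
move=> a g h; apply: dshom_ext => L x.
rewrite dh_PE; exact: (dh_PE a g h (f L x)).
Qed.
Lemma dhcomp_linr (M N P : dsmod) (g : dshom N P) :
  linear (fun f : dshom M N => dhcomp g f).
Proof.
move=> a f h; apply: dshom_ext => L x; rewrite dh_PE.
rewrite -[LHS]/(g L ((a *: f + h) L x)) dh_PE; exact: dh_lin.
Qed.

Lemma dhcompA (M N P Q : dsmod) (h : dshom P Q) (g : dshom N P)
    (f : dshom M N) : dhcomp h (dhcomp g f) = dhcomp (dhcomp h g) f.
Proof. exact: dshom_ext. Qed.
Lemma dhcomp1m (M N : dsmod) (f : dshom M N) : dhcomp (dhid N) f = f.
Proof. exact: dshom_ext. Qed.
Lemma dhcompm1 (M N : dsmod) (f : dshom M N) : dhcomp f (dhid M) = f.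
Proof. exact: dshom_ext. Qed.

Definition Mod_ds : lincat F :=
  @LinCat F dsmod (fun M N => dshom M N) dhid dhcomp
    dhcomp_linl dhcomp_linr dhcompA dhcomp1m dhcompm1.

Record dssub (M : dsmod) := MkDsSub {
  ss :> forall L, M L -> Prop;
  ss0 : forall L, @ss L 0;
  ssP : forall L a (x y : M L), @ss L x -> @ss L y -> @ss L (a *: x + y);
  ss_act : forall L L' (p : dsmor L L') (x : M L),
    @ss L x -> @ss L' (dsact M p x) }.
Arguments ss {M} S L x : rename.

Definition dssub_le (M : dsmod) (S T : dssub M) : Prop :=
  forall L x, S L x -> T L x.

(* The quotient T / S is simple: its subobjects are the Z / S with S <= Z <= T. *)
Definition simple_step (M : dsmod) (S T : dssub M) : Prop :=
  [/\ dssub_le S T, ~ dssub_le T S &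
    forall Z : dssub M, dssub_le S Z -> dssub_le Z T ->
      dssub_le Z S \/ dssub_le T Z].

Definition finite_length (M : dsmod) : Prop :=
  exists (n : nat) (S : nat -> dssub M),
    [/\ forall L x, S 0%N L x -> x = 0,
        forall L x, S n L x &
        forall i, (i < n)%N -> simple_step (S i) (S i.+1)].

Section Conv.
Variables (M N : dsmod).

(* The symbol (m (x) n) in the copy of M_x (x) N_y at alpha : x + y -> z. *)
Record cgen (z : FinSet) := CGen {
  cx : FinSet; cy : FinSet; ca : dsmor (fs_sum cx cy) z; cm : M cx; cn : N cy }.

(* A cocone with vertex W on the diagram (x, y, alpha) |-> M_x (x) N_y. *)
Record cadm z (W : lmodType F) (phi : cgen z -> W) : Prop := CAdm {
  cadm_l : forall x y (al : dsmor (fs_sum x y) z) (n : N y),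
    linear (fun m : M x => phi (CGen al m n));
  cadm_r : forall x y (al : dsmor (fs_sum x y) z) (m : M x),
    linear (fun n : N y => phi (CGen al m n));
  cadm_d : forall x x' y y' (p : dsmor x x') (q : dsmor y y')
      (al : dsmor (fs_sum x' y') z) (m : M x) (n : N y),
    phi (CGen (ds_comp al (ds_sum p q)) m n) =
    phi (CGen al (dsact M p m) (dsact N q n)) }.

Definition conv z : lmodType F := univ (@cadm z).

Definition cpure z x y (al : dsmor (fs_sum x y) z) (m : M x) (n : N y) :
  conv z := gen (@cadm z) (CGen al m n).

Lemma cpure_adm z : cadm (gen (@cadm z)).
Proof.
split=> [x y al n a u v|x y al m a u v|x x' y y' p q al m n];
  apply: univ_sep => W phi hp.
- by rewrite (evq_linear hp) !evq_gen // (cadm_l hp).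
- by rewrite (evq_linear hp) !evq_gen // (cadm_r hp).
- by rewrite !evq_gen // (cadm_d hp).
Qed.

Lemma cpure_linl z x y (al : dsmor (fs_sum x y) z) (n : N y) :
  linear (fun m => cpure al m n).
Proof. exact: (cadm_l (cpure_adm z)). Qed.
Lemma cpure_linr z x y (al : dsmor (fs_sum x y) z) (m : M x) :
  linear (fun n => cpure al m n).
Proof. exact: (cadm_r (cpure_adm z)). Qed.
Lemma cpure_d z x x' y y' (p : dsmor x x') (q : dsmor y y')
    (al : dsmor (fs_sum x' y') z) m n :
  cpure (ds_comp al (ds_sum p q)) m n = cpure al (dsact M p m) (dsact N q n).
Proof. exact: (cadm_d (cpure_adm z)). Qed.

Lemma conv_ext z (W : lmodType F) (f g : conv z -> W) :
  linear f -> linear g ->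
  (forall x y (al : dsmor (fs_sum x y) z) m n,
     f (cpure al m n) = g (cpure al m n)) -> forall u, f u = g u.
Proof.
move=> hf hg h u; apply: (@univ_ext F _ (@cadm z) W f g hf hg).
by case=> x y al m n; exact: h.
Qed.

Lemma cact_adm z z' (be : dsmor z z') :
  cadm (fun g : cgen z => cpure (ds_comp be (ca g)) (cm g) (cn g)).
Proof.
split=> [x y al n|x y al m|x x' y y' p q al m n] /=.
- exact: cpure_linl.
- exact: cpure_linr.
- by rewrite ds_compA cpure_d.
Qed.
Definition cact z z' (be : dsmor z z') : conv z -> conv z' := lift (cact_adm be).
Lemma cact_lin z z' (be : dsmor z z') : linear (cact be).
Proof. exact: linearP. Qed.
Lemma cactE z z' (be : dsmor z z') x y (al : dsmor (fs_sum x y) z) m n :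
  cact be (cpure al m n) = cpure (ds_comp be al) m n.
Proof. exact: lift_gen. Qed.
Lemma cact_id z (u : conv z) : cact (ds_id z) u = u.
Proof.
apply: (conv_ext (f := cact (ds_id z)) (g := id)) => // [|x y al m n].
  exact: cact_lin.
by rewrite cactE ds_1comp.
Qed.
Lemma cact_comp z z' z'' (q : dsmor z' z'') (p : dsmor z z') (u : conv z) :
  cact (ds_comp q p) u = cact q (cact p u).
Proof.
move: u; apply: conv_ext => [||x y al m n]; first exact: cact_lin.
  by apply: lin_comp; apply: cact_lin.
by rewrite !cactE ds_compA.
Qed.

Definition cmod : dsmod := MkDsMod cact_lin cact_id cact_comp.

Lemma cpure_act z x y (al : dsmor (fs_sum x y) z) m n z' (be : dsmor z z') :
  dsact cmod be (cpure al m n) = cpure (ds_comp be al) m n.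
Proof. exact: cactE. Qed.
Lemma cpure_norm z x y (al : dsmor (fs_sum x y) z) m n :
  cpure al m n = dsact cmod al (cpure (ds_id _) m n).
Proof. by rewrite cpure_act ds_comp1. Qed.
End Conv.

Arguments cpure {M N z x y} al m n.

Section ConvMor.
Variables (M M' N N' : dsmod) (f : dshom M M') (g : dshom N N').
Lemma cmor_adm z :
  cadm (fun h : cgen M N z => cpure (ca h) (f _ (cm h)) (g _ (cn h))).
Proof.
split=> [x y al n|x y al m|x x' y y' p q al m n] /=.
- exact: (lin_comp (cpure_linl al (g y n)) (@dh_lin _ _ f x)).
- exact: (lin_comp (cpure_linr al (f x m)) (@dh_lin _ _ g y)).
- by rewrite cpure_d !dh_nat.
Qed.
Definition cmor_fun z : cmod M N z -> cmod M' N' z := lift (cmor_adm z).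
Lemma cmor_fun_lin z : linear (@cmor_fun z).
Proof. exact: linearP. Qed.
Lemma cmor_funE z x y (al : dsmor (fs_sum x y) z) m n :
  cmor_fun (cpure al m n) = cpure al (f _ m) (g _ n).
Proof. exact: lift_gen. Qed.
Lemma cmor_nat L L' (p : dsmor L L') (u : cmod M N L) :
  cmor_fun (dsact (cmod M N) p u) = dsact (cmod M' N') p (cmor_fun u).
Proof.
move: u; apply: conv_ext => [||x y al m n].
- exact: lin_comp (cmor_fun_lin (z := L')) (cact_lin p).
- exact: lin_comp (cact_lin p) (cmor_fun_lin (z := L)).
- by rewrite cmor_funE !cpure_act cmor_funE.
Qed.
Definition cmor_hom : dshom (cmod M N) (cmod M' N') :=
  MkDsHom cmor_fun_lin cmor_nat.
Lemma cmor_homE z x y (al : dsmor (fs_sum x y) z) m n :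
  cmor_hom z (cpure al m n) = cpure al (f _ m) (g _ n).
Proof. exact: cmor_funE. Qed.
End ConvMor.

Lemma dshom_cext (M N P : dsmod) (f g : dshom (cmod M N) P) :
  (forall x y m n,
    f _ (cpure (ds_id (fs_sum x y)) m n) = g _ (cpure (ds_id _) m n)) -> f = g.
Proof.
move=> h; apply: dshom_ext => L; apply: conv_ext => [||x y al m n].
- exact: (@dh_lin _ _ f L).
- exact: (@dh_lin _ _ g L).
- by rewrite cpure_norm !dh_nat h.
Qed.

(* The unit of convolution is the linearization of Hom(empty, -): the free
   vector space on that set, hence no condition on maps out of it. *)
Definition uadm z (W : lmodType F) (phi : dsmor fs_empty z -> W) : Prop := True.
Definition uds_v z : lmodType F := univ (@uadm z).
Definition udelta z (p : dsmor fs_empty z) : uds_v z := gen (@uadm z) p.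
Lemma uact_adm z z' (be : dsmor z z') :
  uadm (fun p : dsmor fs_empty z => udelta (ds_comp be p)).
Proof. by []. Qed.
Definition uact z z' (be : dsmor z z') : uds_v z -> uds_v z' :=
  lift (uact_adm be).
Lemma uact_lin z z' (be : dsmor z z') : linear (uact be).
Proof. exact: linearP. Qed.
Lemma uactE z z' (be : dsmor z z') p :
  uact be (udelta p) = udelta (ds_comp be p).
Proof. exact: lift_gen. Qed.
Lemma uact_id z (u : uds_v z) : uact (ds_id z) u = u.
Proof.
move: u; apply: (univ_ext (f := uact (ds_id z)) (g := id)) => // [|p].
  exact: uact_lin.
by rewrite uactE ds_1comp.
Qed.
Lemma uact_comp z z' z'' (q : dsmor z' z'') (p : dsmor z z') (u : uds_v z) :
  uact (ds_comp q p) u = uact q (uact p u).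
Proof.
move: u; apply: univ_ext => [||x]; first exact: uact_lin.
  by apply: lin_comp; apply: uact_lin.
by rewrite !uactE ds_compA.
Qed.
Definition uds : dsmod := MkDsMod uact_lin uact_id uact_comp.

Lemma uds_ext z (W : lmodType F) (f g : uds z -> W) :
  linear f -> linear g -> (forall p, f (udelta p) = g (udelta p)) ->
  forall u, f u = g u.
Proof. exact: univ_ext. Qed.
Lemma udelta_act z z' (be : dsmor z z') p :
  dsact uds be (udelta p) = udelta (ds_comp be p).
Proof. exact: uactE. Qed.
Lemma udelta_norm z (p : dsmor fs_empty z) :
  udelta p = dsact uds p (udelta (ds_id _)).
Proof. by rewrite udelta_act ds_comp1. Qed.

End DsMod.
Arguments dsact {F} M {L L'} p x : rename.
Arguments dh {F M N} f L x : rename.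
Arguments ss {F M} S L x : rename.
Arguments cpure {F M N z x y} al m n.
Arguments udelta {F z} p.

Section DsTen.
Variable F : fieldType.
Implicit Types M N P Q : dsmod F.

Lemma cpure_d1 M N z x x' y y' (p : dsmor x x') (q : dsmor y y')
    (al : dsmor (fs_sum x' y') z) (m : M x) (n : N y) :
  cpure al (dsact M p m) (dsact N q n) =
  dsact (cmod M N) (ds_comp al (ds_sum p q)) (cpure (ds_id _) m n).
Proof. by rewrite -cpure_d cpure_norm. Qed.
Lemma cpure_actl M N z x x' y (p : dsmor x x')
    (al : dsmor (fs_sum x' y) z) (m : M x) (n : N y) :
  cpure al (dsact M p m) n = cpure (ds_comp al (ds_sum p (ds_id y))) m n.
Proof. by rewrite cpure_d dsact_id. Qed.
Lemma cpure_actr M N z x y y' (q : dsmor y y')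
    (al : dsmor (fs_sum x y') z) (m : M x) (n : N y) :
  cpure al m (dsact N q n) = cpure (ds_comp al (ds_sum (ds_id x) q)) m n.
Proof. by rewrite cpure_d dsact_id. Qed.

Lemma conv3l_ext M N P z (W : lmodType F) (f g : cmod (cmod M N) P z -> W) :
  linear f -> linear g ->
  (forall x1 x2 y (al : dsmor (fs_sum (fs_sum x1 x2) y) z) m n p,
     f (cpure (M := cmod M N) al (cpure (ds_id _) m n) p) =
     g (cpure (M := cmod M N) al (cpure (ds_id _) m n) p)) ->
  forall u, f u = g u.
Proof.
move=> hf hg h; apply: conv_ext => // x y al u p; move: u.
apply: conv_ext => [||x1 x2 be m n].
- exact: lin_comp hf (@cpure_linl _ (cmod M N) _ _ _ _ al p).
- exact: lin_comp hg (@cpure_linl _ (cmod M N) _ _ _ _ al p).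
- by rewrite (cpure_norm be m n) (cpure_actl (M := cmod M N)) h.
Qed.
Lemma conv3r_ext M N P z (W : lmodType F) (f g : cmod M (cmod N P) z -> W) :
  linear f -> linear g ->
  (forall x1 x2 y (al : dsmor (fs_sum x1 (fs_sum x2 y)) z) m n p,
     f (cpure (N := cmod N P) al m (cpure (ds_id _) n p)) =
     g (cpure (N := cmod N P) al m (cpure (ds_id _) n p))) ->
  forall u, f u = g u.
Proof.
move=> hf hg h; apply: conv_ext => // x y al m u; move: u.
apply: conv_ext => [||x1 x2 be n p].
- exact: lin_comp hf (@cpure_linr _ _ (cmod N P) _ _ _ al m).
- exact: lin_comp hg (@cpure_linr _ _ (cmod N P) _ _ _ al m).
- by rewrite (cpure_norm be n p) (cpure_actr (N := cmod N P)) h.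
Qed.

Section Assoc.
Variables M N P : dsmod F.

Section In.
Variables (w y z : FinSet) (al : dsmor (fs_sum w y) z).
Definition asc_al x1 x2 (be : dsmor (fs_sum x1 x2) w) :
    dsmor (fs_sum x1 (fs_sum x2 y)) z :=
  ds_comp (ds_comp al (ds_sum be (ds_id y))) (ds_assocV x1 x2 y).
Definition asc_phi (p : P y) (h : cgen M N w) : cmod M (cmod N P) z :=
  cpure (M := M) (N := cmod N P) (asc_al (ca h)) (cm h)
      (cpure (ds_id _) (cn h) p : cmod N P _).
Lemma asc_in_adm (p : P y) : cadm (asc_phi p).
Proof.
split=> [x1 x2 be n|x1 x2 be m|x x' x2 x2' r q be m n].
- exact: (@cpure_linl F M (cmod N P) _ _ _ (asc_al be) (cpure (ds_id _) n p)).
- exact: (lin_comp (@cpure_linr F M (cmod N P) _ _ _ (asc_al be) m)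
     (@cpure_linl F N P _ _ _ (ds_id _) p)).
- rewrite /asc_phi /= cpure_actl cpure_actl ds_1comp.
  rewrite [cpure (ds_sum q _) n p]cpure_norm (cpure_actr (N := cmod N P)).
  congr cpure; rewrite /asc_al -[in LHS](ds_1comp (ds_id y)) ds_sum_comp.
  rewrite -!ds_compA; congr ds_comp; congr ds_comp.
  by rewrite -ds_sum_comp ds_1comp ds_comp1 ds_assocV_nat.
Qed.
Definition asc_in (p : P y) : cmod M N w -> cmod M (cmod N P) z :=
  lift (asc_in_adm p).
Lemma asc_inE p x1 x2 (be : dsmor (fs_sum x1 x2) w) m n :
  asc_in p (cpure be m n) =
  cpure (N := cmod N P) (asc_al be) m (cpure (ds_id _) n p).
Proof. exact: lift_gen. Qed.
Lemma asc_in_lin p : linear (asc_in p).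
Proof. exact: linearP. Qed.
End In.

Lemma asc_adm z :
  cadm (fun h : cgen (cmod M N) P z => asc_in (ca h) (cn h) (cm h)).
Proof.
split=> [w y al p|w y al u|w w' y y' r q al u p] /=.
- exact: asc_in_lin.
- move=> a p p'; move: u; apply: conv_ext => [||x1 x2 be m n].
  + exact: asc_in_lin.
  + by apply: lin_comb; apply: asc_in_lin.
  + rewrite !asc_inE (cpure_linr (M := N)).
    exact: (@cpure_linr _ M (cmod N P)).
- move: u; apply: conv_ext => [||x1 x2 be m n].
  + exact: asc_in_lin.
  + exact: lin_comp (asc_in_lin _ _) (@dsact_lin _ (cmod M N) _ _ r).
  + rewrite cactE !asc_inE cpure_actr.
    rewrite [cpure (ds_comp _ _) n p]cpure_norm (cpure_actr (N := cmod N P)).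
    congr cpure; rewrite /asc_al ds_1comp -!ds_compA ds_assocV_nat.
    congr ds_comp; rewrite !ds_compA -!ds_sum_comp; congr ds_comp.
    by rewrite ds_sum1 !ds_1comp !ds_comp1.
Qed.
Definition asc_fun z : cmod (cmod M N) P z -> cmod M (cmod N P) z :=
  lift (asc_adm z).
Lemma asc_lin z : linear (@asc_fun z).
Proof. exact: linearP. Qed.
Lemma asc_funE z x1 x2 y (al : dsmor (fs_sum (fs_sum x1 x2) y) z) m n p :
  asc_fun (cpure (M := cmod M N) al (cpure (ds_id _) m n) p) =
  cpure (N := cmod N P) (ds_comp al (ds_assocV _ _ _)) m
    (cpure (ds_id _) n p).
Proof.
rewrite [LHS]lift_gen asc_inE; congr cpure.
by rewrite /asc_al ds_sum1 ds_comp1.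
Qed.
Lemma asc_nat L L' (r : dsmor L L') (u : cmod (cmod M N) P L) :
  asc_fun (dsact _ r u) = dsact _ r (asc_fun u).
Proof.
move: u; apply: conv3l_ext => [||x1 x2 y al m n p].
- exact: lin_comp (@asc_lin _) (@dsact_lin _ (cmod (cmod M N) P) _ _ r).
- exact: lin_comp (@dsact_lin _ (cmod M (cmod N P)) _ _ r) (@asc_lin _).
- by rewrite cpure_act !asc_funE cpure_act ds_compA.
Qed.
Definition asc_hom : dshom (cmod (cmod M N) P) (cmod M (cmod N P)) :=
  MkDsHom asc_lin asc_nat.

Section InV.
Variables (w y z : FinSet) (al : dsmor (fs_sum w y) z).
Definition ascV_al x1 x2 (be : dsmor (fs_sum x1 x2) y) :
    dsmor (fs_sum (fs_sum w x1) x2) z :=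
  ds_comp (ds_comp al (ds_sum (ds_id w) be)) (ds_assoc w x1 x2).
Definition ascV_phi (m : M w) (h : cgen N P y) : cmod (cmod M N) P z :=
  cpure (M := cmod M N) (N := P) (ascV_al (ca h))
      (cpure (ds_id _) m (cm h) : cmod M N _) (cn h).
Lemma ascV_in_adm (m : M w) : cadm (ascV_phi m).
Proof.
split=> [x1 x2 be p|x1 x2 be n|x x' x2 x2' r q be n p].
- exact: (lin_comp (@cpure_linl F (cmod M N) P _ _ _ (ascV_al be) p)
     (@cpure_linr F M N _ _ _ (ds_id _) m)).
- exact: (@cpure_linr F (cmod M N) P _ _ _ (ascV_al be) (cpure (ds_id _) m n)).
- rewrite /ascV_phi /= cpure_actr cpure_actr ds_1comp.
  rewrite [cpure (ds_sum _ r) m n]cpure_norm (cpure_actl (M := cmod M N)).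
  congr cpure; rewrite /ascV_al -[in LHS](ds_1comp (ds_id w)) ds_sum_comp.
  rewrite -!ds_compA; congr ds_comp; congr ds_comp.
  by rewrite -ds_sum_comp ds_1comp ds_comp1 ds_assoc_nat.
Qed.
Definition ascV_in (m : M w) : cmod N P y -> cmod (cmod M N) P z :=
  lift (ascV_in_adm m).
Lemma ascV_inE m x1 x2 (be : dsmor (fs_sum x1 x2) y) n p :
  ascV_in m (cpure be n p) =
  cpure (M := cmod M N) (ascV_al be) (cpure (ds_id _) m n) p.
Proof. exact: lift_gen. Qed.
Lemma ascV_in_lin p : linear (ascV_in p).
Proof. exact: linearP. Qed.
End InV.

Lemma ascV_adm z :
  cadm (fun h : cgen M (cmod N P) z => ascV_in (ca h) (cm h) (cn h)).
Proof.
split=> [w y al u|w y al m|w w' y y' r q al m u] /=.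
- move=> a m m'; move: u; apply: conv_ext => [||x1 x2 be n p].
  + exact: ascV_in_lin.
  + by apply: lin_comb; apply: ascV_in_lin.
  + rewrite !ascV_inE (cpure_linl (N := N)).
    exact: (@cpure_linl _ (cmod M N) P).
- exact: ascV_in_lin.
- move: u; apply: conv_ext => [||x1 x2 be n p].
  + exact: ascV_in_lin.
  + exact: lin_comp (ascV_in_lin _ _) (@dsact_lin _ (cmod N P) _ _ q).
  + rewrite cactE !ascV_inE cpure_actl.
    rewrite [cpure (ds_comp _ _) m n]cpure_norm (cpure_actl (M := cmod M N)).
    congr cpure; rewrite /ascV_al ds_1comp -!ds_compA ds_assoc_nat.
    congr ds_comp; rewrite !ds_compA -!ds_sum_comp; congr ds_comp.
    by rewrite ds_sum1 !ds_1comp !ds_comp1.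
Qed.
Definition ascV_fun z : cmod M (cmod N P) z -> cmod (cmod M N) P z :=
  lift (ascV_adm z).
Lemma ascV_lin z : linear (@ascV_fun z).
Proof. exact: linearP. Qed.
Lemma ascV_funE z x1 x2 y (al : dsmor (fs_sum x1 (fs_sum x2 y)) z) m n p :
  ascV_fun (cpure (N := cmod N P) al m (cpure (ds_id _) n p)) =
  cpure (M := cmod M N) (ds_comp al (ds_assoc _ _ _))
    (cpure (ds_id _) m n) p.
Proof.
rewrite [LHS]lift_gen ascV_inE; congr cpure.
by rewrite /ascV_al ds_sum1 ds_comp1.
Qed.
Lemma ascV_nat L L' (r : dsmor L L') (u : cmod M (cmod N P) L) :
  ascV_fun (dsact _ r u) = dsact _ r (ascV_fun u).
Proof.
move: u; apply: conv3r_ext => [||x1 x2 y al m n p].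
- exact: lin_comp (@ascV_lin _) (@dsact_lin _ (cmod M (cmod N P)) _ _ r).
- exact: lin_comp (@dsact_lin _ (cmod (cmod M N) P) _ _ r) (@ascV_lin _).
- by rewrite cpure_act !ascV_funE cpure_act ds_compA.
Qed.
Definition ascV_hom : dshom (cmod M (cmod N P)) (cmod (cmod M N) P) :=
  MkDsHom ascV_lin ascV_nat.

Lemma asc_homK : dhcomp ascV_hom asc_hom = dhid _.
Proof.
apply: dshom_ext => L; apply: conv3l_ext => [||x1 x2 y al m n p].
- exact: (@dh_lin _ _ _ (dhcomp ascV_hom asc_hom)).
- exact: lin_id.
- by rewrite /= asc_funE ascV_funE -ds_compA ds_assocK ds_comp1.
Qed.
Lemma ascV_homK : dhcomp asc_hom ascV_hom = dhid _.
Proof.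
apply: dshom_ext => L; apply: conv3r_ext => [||x1 x2 y al m n p].
- exact: (@dh_lin _ _ _ (dhcomp asc_hom ascV_hom)).
- exact: lin_id.
- by rewrite /= ascV_funE asc_funE -ds_compA ds_assocVK ds_comp1.
Qed.
Definition asc_iso : @iso F (Mod_ds F) (cmod (cmod M N) P) (cmod M (cmod N P)) :=
  @Iso F (Mod_ds F) _ _ asc_hom ascV_hom asc_homK ascV_homK.
End Assoc.

Section Braid.
Variables M N : dsmod F.
Lemma br_adm z : cadm (fun h : cgen M N z =>
  cpure (ds_comp (ca h) (ds_swap _ _)) (cn h) (cm h)).
Proof.
split=> [x y al n|x y al m|x x' y y' p q al m n] /=.
- exact: cpure_linr.
- exact: cpure_linl.
- by rewrite -cpure_d -!ds_compA ds_swap_nat.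
Qed.
Definition br_fun z : cmod M N z -> cmod N M z := lift (br_adm z).
Lemma br_lin z : linear (@br_fun z).
Proof. exact: linearP. Qed.
Lemma br_funE z x y (al : dsmor (fs_sum x y) z) m n :
  br_fun (cpure al m n) = cpure (ds_comp al (ds_swap _ _)) n m.
Proof. exact: lift_gen. Qed.
Lemma br_nat L L' (r : dsmor L L') (u : cmod M N L) :
  br_fun (dsact _ r u) = dsact _ r (br_fun u).
Proof.
move: u; apply: conv_ext => [||x y al m n].
- exact: lin_comp (@br_lin _) (@dsact_lin _ (cmod M N) _ _ r).
- exact: lin_comp (@dsact_lin _ (cmod N M) _ _ r) (@br_lin _).
- by rewrite cpure_act !br_funE cpure_act ds_compA.
Qed.
Definition br_hom : dshom (cmod M N) (cmod N M) := MkDsHom br_lin br_nat.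
End Braid.

Lemma br_homK M N : dhcomp (br_hom N M) (br_hom M N) = dhid _.
Proof.
apply: dshom_cext => x y m n.
by rewrite /= !br_funE -ds_compA ds_swapK ds_comp1.
Qed.

Section LUnit.
Variable M : dsmod F.
Lemma lu_in_adm x y z (al : dsmor (fs_sum x y) z) (m : M y) :
  uadm (fun be : dsmor fs_empty x =>
    dsact M (ds_comp (ds_comp al (ds_sum be (ds_id y))) (ds_luV y)) m).
Proof. by []. Qed.
Definition lu_in x y z (al : dsmor (fs_sum x y) z) (m : M y) : uds F x -> M z :=
  lift (lu_in_adm al m).
Lemma lu_in_lin x y z (al : dsmor (fs_sum x y) z) m : linear (lu_in al m).
Proof. exact: linearP. Qed.
Lemma lu_inE x y z (al : dsmor (fs_sum x y) z) m be :
  lu_in al m (udelta be) =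
  dsact M (ds_comp (ds_comp al (ds_sum be (ds_id y))) (ds_luV y)) m.
Proof. exact: lift_gen. Qed.
Lemma lu_adm z : cadm (fun h : cgen (uds F) M z => lu_in (ca h) (cn h) (cm h)).
Proof.
split=> [x y al m|x y al u|x x' y y' r q al u m] /=.
- exact: lu_in_lin.
- move=> a m m'; move: u; apply: uds_ext => [||be].
  + exact: lu_in_lin.
  + by apply: lin_comb; apply: lu_in_lin.
  + by rewrite !lu_inE dsact_lin.
- move: u; apply: uds_ext => [||be].
  + exact: lu_in_lin.
  + exact: lin_comp (lu_in_lin _ _) (@dsact_lin _ (uds F) _ _ r).
  + rewrite uactE !lu_inE -dsact_comp; congr dsact.
    rewrite -!ds_compA ds_luV_nat; congr ds_comp.
    by rewrite !ds_compA -!ds_sum_comp ds_1comp !ds_comp1.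
Qed.
Definition lu_fun z : cmod (uds F) M z -> M z := lift (lu_adm z).
Lemma lu_lin z : linear (@lu_fun z).
Proof. exact: linearP. Qed.
Lemma lu_funE z y (al : dsmor (fs_sum fs_empty y) z) m :
  lu_fun (cpure (M := uds F) al (udelta (ds_id _)) m) =
  dsact M (ds_comp al (ds_luV y)) m.
Proof. by rewrite [LHS]lift_gen lu_inE ds_sum1 ds_comp1. Qed.
Lemma convu_ext z (W : lmodType F) (f g : cmod (uds F) M z -> W) :
  linear f -> linear g ->
  (forall y (al : dsmor (fs_sum fs_empty y) z) m,
     f (cpure (M := uds F) al (udelta (ds_id _)) m) =
     g (cpure (M := uds F) al (udelta (ds_id _)) m)) ->
  forall u, f u = g u.
Proof.
move=> hf hg h; apply: conv_ext => // x y al u m; move: u.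
apply: uds_ext => [||be].
- exact: lin_comp hf (@cpure_linl _ (uds F) M _ _ _ al m).
- exact: lin_comp hg (@cpure_linl _ (uds F) M _ _ _ al m).
- by rewrite udelta_norm (cpure_actl (M := uds F)) h.
Qed.
Lemma lu_nat L L' (r : dsmor L L') (u : cmod (uds F) M L) :
  lu_fun (dsact _ r u) = dsact _ r (lu_fun u).
Proof.
move: u; apply: convu_ext => [||y al m].
- exact: lin_comp (@lu_lin _) (@dsact_lin _ (cmod (uds F) M) _ _ r).
- exact: lin_comp (@dsact_lin _ M _ _ r) (@lu_lin _).
- by rewrite cpure_act !lu_funE -dsact_comp ds_compA.
Qed.
Definition lu_hom : dshom (cmod (uds F) M) M := MkDsHom lu_lin lu_nat.

Definition luV_fun z (m : M z) : cmod (uds F) M z :=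
  cpure (M := uds F) (ds_lu z) (udelta (ds_id _)) m.
Lemma luV_lin z : linear (@luV_fun z).
Proof. exact: cpure_linr. Qed.
Lemma luV_nat L L' (r : dsmor L L') (m : M L) :
  luV_fun (dsact _ r m) = dsact _ r (luV_fun m).
Proof. by rewrite /luV_fun cpure_act cpure_actr ds_lu_nat. Qed.
Definition luV_hom : dshom M (cmod (uds F) M) := MkDsHom luV_lin luV_nat.

Lemma lu_homK : dhcomp luV_hom lu_hom = dhid _.
Proof.
apply: dshom_ext => L; apply: convu_ext => [||y al m].
- exact: (@dh_lin _ _ _ (dhcomp luV_hom lu_hom)).
- exact: lin_id.
- rewrite /= lu_funE luV_nat /luV_fun cpure_act.
  by rewrite -ds_compA ds_luK ds_comp1.
Qed.
Lemma luV_homK : dhcomp lu_hom luV_hom = dhid _.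
Proof.
apply: dshom_ext => L m.
by rewrite /= /luV_fun lu_funE ds_luVK dsact_id.
Qed.
Definition lu_iso : @iso F (Mod_ds F) (cmod (uds F) M) M :=
  @Iso F (Mod_ds F) _ _ lu_hom luV_hom lu_homK luV_homK.

Lemma ru_homK :
  dhcomp (dhcomp (br_hom _ _) luV_hom) (dhcomp lu_hom (br_hom M (uds F))) =
  dhid _.
Proof.
rewrite -dhcompA [X in dhcomp _ X]dhcompA lu_homK dhcomp1m; exact: br_homK.
Qed.
Lemma ruV_homK :
  dhcomp (dhcomp lu_hom (br_hom M (uds F))) (dhcomp (br_hom _ _) luV_hom) =
  dhid _.
Proof.
rewrite -dhcompA [X in dhcomp _ X]dhcompA br_homK dhcomp1m; exact: luV_homK.
Qed.
Definition ru_iso : @iso F (Mod_ds F) (cmod M (uds F)) M :=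
  @Iso F (Mod_ds F) _ _ (dhcomp lu_hom (br_hom M (uds F)))
    (dhcomp (br_hom _ _) luV_hom) ru_homK ruV_homK.
End LUnit.

Lemma dshom_ext3l M N P Q (f g : dshom (cmod (cmod M N) P) Q) :
  (forall x1 x2 y m n p,
     f _ (cpure (M := cmod M N) (ds_id (fs_sum _ y))
       (cpure (ds_id (fs_sum x1 x2)) m n) p) =
     g _ (cpure (M := cmod M N) (ds_id _) (cpure (ds_id _) m n) p)) -> f = g.
Proof.
move=> h; apply: dshom_ext => L; apply: conv3l_ext => [||x1 x2 y al m n p].
- exact: (@dh_lin _ _ _ f).
- exact: (@dh_lin _ _ _ g).
- by rewrite cpure_norm !dh_nat h.
Qed.

Lemma dshom_ext4l M N P Q R (f g : dshom (cmod (cmod (cmod M N) P) Q) R) :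
  (forall x1 x2 y z m n p q,
     f _ (cpure (M := cmod (cmod M N) P) (ds_id (fs_sum _ z))
       (cpure (M := cmod M N) (ds_id (fs_sum _ y))
         (cpure (ds_id (fs_sum x1 x2)) m n) p) q) =
     g _ (cpure (M := cmod (cmod M N) P) (ds_id (fs_sum _ z))
       (cpure (M := cmod M N) (ds_id (fs_sum _ y))
         (cpure (ds_id (fs_sum x1 x2)) m n) p) q)) -> f = g.
Proof.
move=> h; apply: dshom_cext => x z u q; move: u.
apply: conv3l_ext => [||x1 x2 y al m n p].
- exact: lin_comp (@dh_lin _ _ _ f _)
    (@cpure_linl _ (cmod (cmod M N) P) _ _ _ _ _ q).
- exact: lin_comp (@dh_lin _ _ _ g _)
    (@cpure_linl _ (cmod (cmod M N) P) _ _ _ _ _ q).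
- rewrite (cpure_norm (M := cmod M N) al) (cpure_actl (M := cmod (cmod M N) P)).
  by rewrite (cpure_norm (M := cmod (cmod M N) P)) !dh_nat h.
Qed.

Lemma asc_hom_nat M M' N N' P P' (f : dshom M M') (g : dshom N N')
    (h : dshom P P') :
  dhcomp (asc_hom M' N' P') (cmor_hom (cmor_hom f g) h) =
  dhcomp (cmor_hom f (cmor_hom g h)) (asc_hom M N P).
Proof.
apply: dshom_ext3l => x1 x2 y m n p.
rewrite /= cmor_funE /= cmor_funE !asc_funE cmor_funE /=.
by rewrite cmor_funE.
Qed.
Lemma lu_hom_nat M M' (f : dshom M M') :
  dhcomp (lu_hom M') (cmor_hom (dhid (uds F)) f) = dhcomp f (lu_hom M).
Proof.
apply: dshom_ext => L; apply: convu_ext => [||y al m].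
- exact: (@dh_lin _ _ _ (dhcomp (lu_hom M') (cmor_hom (dhid (uds F)) f))).
- exact: (@dh_lin _ _ _ (dhcomp f (lu_hom M))).
- by rewrite /= cmor_funE /= !lu_funE dh_nat.
Qed.
Lemma br_hom_nat M M' N N' (f : dshom M M') (g : dshom N N') :
  dhcomp (br_hom M' N') (cmor_hom f g) = dhcomp (cmor_hom g f) (br_hom M N).
Proof.
by apply: dshom_cext => x y m n; rewrite /= cmor_funE !br_funE cmor_funE.
Qed.
Lemma ru_hom_nat M M' (f : dshom M M') :
  dhcomp (dhcomp (lu_hom M') (br_hom _ _)) (cmor_hom f (dhid (uds F))) =
  dhcomp f (dhcomp (lu_hom M) (br_hom _ _)).
Proof.
by rewrite -dhcompA br_hom_nat !dhcompA lu_hom_nat.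
Qed.
Lemma ds_triangle M N :
  dhcomp (cmor_hom (dhid M) (lu_hom N)) (asc_hom M (uds F) N) =
  cmor_hom (dhcomp (lu_hom M) (br_hom M (uds F))) (dhid N).
Proof.
apply: dshom_ext3l => x1 x2 y m u n; move: u; apply: uds_ext => [||be].
- exact: lin_comp (@dh_lin _ _ _
    (dhcomp (cmor_hom (dhid M) (lu_hom N)) (asc_hom M (uds F) N)) _)
    (lin_comp (@cpure_linl _ (cmod M (uds F)) _ _ _ _ _ n)
      (@cpure_linr _ M (uds F) _ _ _ _ m)).
- exact: lin_comp (@dh_lin _ _ _
    (cmor_hom (dhcomp (lu_hom M) (br_hom M (uds F))) (dhid N)) _)
    (lin_comp (@cpure_linl _ (cmod M (uds F)) _ _ _ _ _ n)
      (@cpure_linr _ M (uds F) _ _ _ _ m)).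
- rewrite udelta_norm (cpure_actr (N := uds F)) (cpure_norm (N := uds F)).
  rewrite (cpure_actl (M := cmod M (uds F))).
  rewrite (cpure_norm (M := cmod M (uds F))) !dh_nat; congr dsact.
  rewrite /= asc_funE !cmor_funE /= br_funE !lu_funE !ds_1comp.
  by rewrite cpure_actl cpure_actr ds_swap_lu ds_tri ds_1comp.
Qed.
Lemma ds_pentagon M N P Q :
  dhcomp (asc_hom M N (cmod P Q)) (asc_hom (cmod M N) P Q) =
  dhcomp (dhcomp (cmor_hom (dhid M) (asc_hom N P Q)) (asc_hom M (cmod N P) Q))
    (cmor_hom (asc_hom M N P) (dhid Q)).
Proof.
apply: dshom_ext4l => x1 x2 y z m n p q.
rewrite /= (asc_funE (M := cmod M N)) (asc_funE (P := cmod P Q)).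
rewrite cmor_funE /= asc_funE.
rewrite (cpure_norm (N := cmod N P) (ds_comp (ds_id _) _)).
rewrite (cpure_actl (M := cmod M (cmod N P))) (asc_funE (N := cmod N P)).
rewrite cmor_funE /= asc_funE.
rewrite (cpure_norm (N := cmod P Q) (ds_comp (ds_id (fs_sum (fs_sum x2 y) z)) _)).
rewrite (cpure_actr (N := cmod N (cmod P Q))).
by congr cpure; rewrite !ds_1comp ds_pent.
Qed.
Lemma ds_hexagon M N P :
  dhcomp (dhcomp (asc_hom N P M) (br_hom M (cmod N P))) (asc_hom M N P) =
  dhcomp (dhcomp (cmor_hom (dhid N) (br_hom M P)) (asc_hom N M P))
    (cmor_hom (br_hom M N) (dhid P)).
Proof.
apply: dshom_ext3l => x1 x2 y m n p.
rewrite /= asc_funE (br_funE (N := cmod N P)) asc_funE.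
rewrite cmor_funE /= br_funE (cpure_norm (ds_comp (ds_id _) _) n m).
rewrite (cpure_actl (M := cmod N M)) asc_funE cmor_funE /= br_funE.
rewrite (cpure_norm (ds_comp (ds_id (fs_sum x1 y)) _) p m).
rewrite (cpure_actr (N := cmod P M)).
by congr cpure; rewrite !ds_1comp ds_hex.
Qed.

Lemma cmor_hom_linl M M' N N' (g : dshom N N') :
  linear (fun f : dshom M M' => cmor_hom f g).
Proof.
move=> a f f'; apply: dshom_cext => x y m n.
by rewrite dh_PE !cmor_homE dh_PE cpure_linl.
Qed.
Lemma cmor_hom_linr M M' N N' (f : dshom M M') :
  linear (fun g : dshom N N' => cmor_hom f g).
Proof.
move=> a g g'; apply: dshom_cext => x y m n.
by rewrite dh_PE !cmor_homE dh_PE cpure_linr.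
Qed.
Lemma cmor_hom1 M N : cmor_hom (dhid M) (dhid N) = dhid (cmod M N).
Proof. by apply: dshom_cext => x y m n; rewrite cmor_homE. Qed.
Lemma cmor_homM M M' M'' N N' N'' (f' : dshom M' M'') (f : dshom M M')
    (g' : dshom N' N'') (g : dshom N N') :
  cmor_hom (dhcomp f' f) (dhcomp g' g) =
  dhcomp (cmor_hom f' g') (cmor_hom f g).
Proof. by apply: dshom_cext => x y m n; rewrite /= !cmor_funE. Qed.

Definition Mod_ds_ten : tencat F :=
  @TenCat F (Mod_ds F) (fun M N => cmod M N)
    (fun M M' N N' f g => cmor_hom f g)
    (fun M M' N N' g => @cmor_hom_linl M M' N N' g)
    (fun M M' N N' f => @cmor_hom_linr M M' N N' f)
    cmor_hom1
    (fun M M' M'' N N' N'' f' f g' g => cmor_homM f' f g' g)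
    (uds F) asc_iso lu_iso ru_iso br_hom
    (fun M M' N N' P P' f g h => asc_hom_nat f g h)
    (fun M M' f => lu_hom_nat f)
    (fun M M' f => ru_hom_nat f)
    (fun M M' N N' f g => br_hom_nat f g)
    br_homK ds_triangle ds_pentagon ds_hexagon.

End DsTen.

Section VTens.
Variable F : fieldType.

Section Def.
Variables U V : lmodType F.
Record tadm (W : lmodType F) (phi : U * V -> W) : Prop := TAdm {
  tadm_l : forall v, linear (fun u => phi (u, v));
  tadm_r : forall u, linear (fun v => phi (u, v)) }.
Definition vtens : lmodType F := univ tadm.
Definition tpure (u : U) (v : V) : vtens := gen tadm (u, v).

Lemma tpure_adm : tadm (gen tadm).
Proof.
split=> [v a x y|u a x y]; apply: univ_sep => W phi hp.
- by rewrite (evq_linear hp) !evq_gen // (tadm_l hp).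
- by rewrite (evq_linear hp) !evq_gen // (tadm_r hp).
Qed.
Lemma tpure_linl v : linear (tpure^~ v).
Proof. exact: (tadm_l tpure_adm v). Qed.
Lemma tpure_linr u : linear (tpure u).
Proof. exact: (tadm_r tpure_adm u). Qed.
Lemma vtens_ext (W : lmodType F) (f g : vtens -> W) :
  linear f -> linear g -> (forall u v, f (tpure u v) = g (tpure u v)) ->
  forall x, f x = g x.
Proof.
move=> hf hg h x; apply: (@univ_ext F _ tadm W f g hf hg).
by case=> u v; exact: h.
Qed.
End Def.
Arguments tpure {U V} u v.

Section TLift.
Variables (U V W : lmodType F) (b : U -> V -> W).
Hypotheses (bl : forall v, linear (b^~ v)) (br : forall u, linear (b u)).
Lemma tlift_adm : tadm (fun x : U * V => b x.1 x.2).
Proof. by split. Qed.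
Definition tlift : vtens U V -> W := lift tlift_adm.
Lemma tlift_lin : linear tlift.
Proof. exact: linearP. Qed.
Lemma tliftE u v : tlift (tpure u v) = b u v.
Proof. exact: lift_gen. Qed.
End TLift.

Lemma vtens3l_ext (U V T W : lmodType F) (f g : vtens (vtens U V) T -> W) :
  linear f -> linear g ->
  (forall u v t, f (tpure (tpure u v) t) = g (tpure (tpure u v) t)) ->
  forall x, f x = g x.
Proof.
move=> hf hg h; apply: vtens_ext => // x t; move: x; apply: vtens_ext => //.
- exact: lin_comp hf (tpure_linl t).
- exact: lin_comp hg (tpure_linl t).
Qed.
Lemma vtens3r_ext (U V T W : lmodType F) (f g : vtens U (vtens V T) -> W) :
  linear f -> linear g ->
  (forall u v t, f (tpure u (tpure v t)) = g (tpure u (tpure v t))) ->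
  forall x, f x = g x.
Proof.
move=> hf hg h; apply: vtens_ext => // u x; move: x; apply: vtens_ext => //.
- exact: lin_comp hf (tpure_linr u).
- exact: lin_comp hg (tpure_linr u).
Qed.
Lemma vtens4l_ext (U V T S W : lmodType F)
    (f g : vtens (vtens (vtens U V) T) S -> W) :
  linear f -> linear g ->
  (forall u v t s, f (tpure (tpure (tpure u v) t) s) =
                   g (tpure (tpure (tpure u v) t) s)) ->
  forall x, f x = g x.
Proof.
move=> hf hg h; apply: vtens_ext => // x s; move: x; apply: vtens3l_ext => //.
- exact: lin_comp hf (tpure_linl s).
- exact: lin_comp hg (tpure_linl s).
Qed.

Section TMap.
Variables (U U' V V' : lmodType F) (f : U -> U') (g : V -> V').
Hypotheses (fl : linear f) (gl : linear g).
Lemma tmap_linl v : linear (fun u => tpure (f u) (g v)).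
Proof. exact: lin_comp (tpure_linl (g v)) fl. Qed.
Lemma tmap_linr u : linear (fun v => tpure (f u) (g v)).
Proof. exact: lin_comp (tpure_linr (f u)) gl. Qed.
Definition tmap : vtens U V -> vtens U' V' :=
  @tlift U V _ (fun u v => tpure (f u) (g v)) tmap_linl tmap_linr.
Lemma tmap_lin : linear tmap. Proof. exact: tlift_lin. Qed.
Lemma tmapE u v : tmap (tpure u v) = tpure (f u) (g v).
Proof. exact: tliftE. Qed.
End TMap.

Section TAssoc.
Variables U V T : lmodType F.
Lemma ta_in_linl (t : T) (v : V) :
  linear (fun u : U => tpure u (tpure v t)).
Proof. exact: tpure_linl. Qed.
Lemma ta_in_linr (t : T) (u : U) :
  linear (fun v : V => tpure u (tpure v t)).
Proof. exact: lin_comp (tpure_linr u) (tpure_linl t). Qed.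
Definition ta_in (t : T) : vtens U V -> vtens U (vtens V T) :=
  @tlift U V _ (fun u v => tpure u (tpure v t)) (ta_in_linl t) (ta_in_linr t).
Lemma ta_in_lin t : linear (ta_in t). Proof. exact: tlift_lin. Qed.
Lemma ta_linr (x : vtens U V) : linear (fun t => ta_in t x).
Proof.
move=> a t t'; move: x; apply: vtens_ext => [||u v].
- exact: ta_in_lin.
- by apply: lin_comb; apply: ta_in_lin.
- by rewrite /ta_in !tliftE !tpure_linr.
Qed.
Definition ta_fun : vtens (vtens U V) T -> vtens U (vtens V T) :=
  @tlift (vtens U V) T _ (fun x t => ta_in t x) ta_in_lin ta_linr.
Lemma ta_lin : linear ta_fun. Proof. exact: tlift_lin. Qed.
Lemma ta_funE u v t : ta_fun (tpure (tpure u v) t) = tpure u (tpure v t).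
Proof.
have -> : ta_fun (tpure (tpure u v) t) = ta_in t (tpure u v).
  exact: (@tliftE (vtens U V) T _ (fun x t => ta_in t x) ta_in_lin ta_linr).
exact: (@tliftE U V _ (fun u v => tpure u (tpure v t))).
 Qed.

Lemma tav_in_linl (u : U) (t : T) :
  linear (fun v : V => tpure (tpure u v) t).
Proof. exact: lin_comp (tpure_linl t) (tpure_linr u). Qed.
Lemma tav_in_linr (u : U) (v : V) :
  linear (fun t : T => tpure (tpure u v) t).
Proof. exact: tpure_linr. Qed.
Definition tav_in (u : U) : vtens V T -> vtens (vtens U V) T :=
  @tlift V T _ (fun v t => tpure (tpure u v) t) (tav_in_linl u) (tav_in_linr u).
Lemma tav_in_lin u : linear (tav_in u). Proof. exact: tlift_lin. Qed.
Lemma tav_linl (x : vtens V T) : linear (fun u => tav_in u x).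
Proof.
move=> a u u'; move: x; apply: vtens_ext => [||v t].
- exact: tav_in_lin.
- by apply: lin_comb; apply: tav_in_lin.
- by rewrite /tav_in !tliftE !tpure_linl.
Qed.
Definition tav_fun : vtens U (vtens V T) -> vtens (vtens U V) T :=
  @tlift U (vtens V T) _ tav_in tav_linl tav_in_lin.
Lemma tav_lin : linear tav_fun. Proof. exact: tlift_lin. Qed.
Lemma tav_funE u v t : tav_fun (tpure u (tpure v t)) = tpure (tpure u v) t.
Proof.
have -> : tav_fun (tpure u (tpure v t)) = tav_in u (tpure v t).
  exact: (@tliftE U (vtens V T) _ tav_in tav_linl tav_in_lin).
exact: (@tliftE V T _ (fun v t => tpure (tpure u v) t)).
 Qed.
End TAssoc.

Section TBraid.
Variables U V : lmodType F.
Definition tb_fun : vtens U V -> vtens V U :=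
  @tlift U V _ (fun u v => tpure v u) (@tpure_linr V U) (@tpure_linl V U).
Lemma tb_lin : linear tb_fun. Proof. exact: tlift_lin. Qed.
Lemma tb_funE u v : tb_fun (tpure u v) = tpure v u. Proof. exact: tliftE. Qed.
End TBraid.

Section TUnit.
Variable U : lmodType F.
Lemma tl_linl (u : U) : linear (fun a : F^o => a *: u).
Proof. by move=> a b c; rewrite scalerDl scalerA. Qed.
Lemma tl_linr (a : F^o) : linear (fun u : U => a *: u).
Proof. by move=> b u v; rewrite scalerDr !scalerA mulrC. Qed.
Definition tl_fun : vtens F^o U -> U :=
  @tlift F^o U U (fun a u => a *: u) tl_linl tl_linr.
Lemma tl_lin : linear tl_fun. Proof. exact: tlift_lin. Qed.
Lemma tl_funE a u : tl_fun (tpure a u) = a *: u. Proof. exact: tliftE. Qed.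
Definition tlv_fun (u : U) : vtens F^o U := tpure 1 u.
Lemma tlv_lin : linear tlv_fun. Proof. exact: tpure_linr. Qed.
Lemma tl_funK x : tlv_fun (tl_fun x) = x.
Proof.
move: x; apply: (vtens_ext (f := fun x => tlv_fun (tl_fun x)) (g := id)).
- exact: lin_comp tlv_lin tl_lin.
- by [].
- move=> a u; rewrite tl_funE /tlv_fun (lin_Z _ _ (tpure_linr _)).
  by rewrite -(lin_Z _ _ (tpure_linl u)) /GRing.scale /= mulr1.
Qed.
Lemma tlv_funK u : tl_fun (tlv_fun u) = u.
Proof. by rewrite tl_funE scale1r. Qed.
End TUnit.

End VTens.
Arguments tpure {F U V} u v.

Section Rep.
Variables (F : fieldType) (G : groupType).

Record rep := MkRep {
  rep_sp :> lmodType F;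
  rho : G -> rep_sp -> rep_sp;
  rho_lin : forall g, linear (rho g);
  rho1 : forall x, rho 1%g x = x;
  rhoM : forall g h x, rho (g * h)%g x = rho g (rho h x) }.
Arguments rho N g x : clear implicits, rename.

HB.instance Definition _ (N : rep) g :=
  GRing.isLinear.Build F N N *:%R (rho N g) (@rho_lin N g).

Record rephom (N N' : rep) := MkRepHom {
  rh :> N -> N';
  rh_lin : linear rh;
  rh_eq : forall g x, rh (rho N g x) = rho N' g (rh x) }.
Arguments rh {N N'} f x : rename.

HB.instance Definition _ (N N' : rep) (f : rephom N N') :=
  GRing.isLinear.Build F N N' *:%R (rh f) (@rh_lin N N' f).

Lemma rephom_ext (N N' : rep) (f g : rephom N N') :
  (forall x, f x = g x) -> f = g.
Proof.
case: f g => f fl fn [g gl gn] /= h.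
have e : f = g by apply/funext.
by case: g / e gl gn h => gl gn _; congr MkRepHom; apply: Prop_irrelevance.
Qed.

Section HomSpace.
Variables (M N : rep).
HB.instance Definition _ := gen_eqMixin (rephom M N).
HB.instance Definition _ := gen_choiceMixin (rephom M N).

Lemma rh0_lin : linear (fun _ : M => 0 : N).
Proof. by move=> a u v; rewrite scaler0 addr0. Qed.
Lemma rh0_eq g (x : M) : (0 : N) = rho N g 0.
Proof. by rewrite linear0. Qed.
Definition rh0 : rephom M N := MkRepHom rh0_lin rh0_eq.

Lemma rhP_lin a (f g : rephom M N) : linear (fun x => a *: f x + g x).
Proof. apply: lin_comb; exact: rh_lin. Qed.
Lemma rhP_eq a (f h : rephom M N) g (x : M) :
  a *: f (rho M g x) + h (rho M g x) = rho N g (a *: f x + h x).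
Proof. by rewrite linearP /= !rh_eq. Qed.
Definition rhP a (f g : rephom M N) : rephom M N :=
  MkRepHom (rhP_lin a f g) (rhP_eq a f g).

Definition rh_add (f g : rephom M N) := rhP 1 f g.
Definition rh_scale a (f : rephom M N) := rhP a f rh0.
Definition rh_opp (f : rephom M N) := rhP (-1) f rh0.

Lemma rh_addA : associative rh_add.
Proof. by move=> f g h; apply: rephom_ext => x /=; rewrite !scale1r addrA. Qed.
Lemma rh_addC : commutative rh_add.
Proof. by move=> f g; apply: rephom_ext => x /=; rewrite !scale1r addrC. Qed.
Lemma rh_add0 : left_id rh0 rh_add.
Proof. by move=> f; apply: rephom_ext => x /=; rewrite scale1r add0r. Qed.
Lemma rh_addN : left_inverse rh0 rh_opp rh_add.
Proof.
by move=> f; apply: rephom_ext => x /=; rewrite scale1r addr0 scaleN1r addNr.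
Qed.
HB.instance Definition _ :=
  GRing.isZmodule.Build (rephom M N) rh_addA rh_addC rh_add0 rh_addN.

Lemma rh_addE (f g : rephom M N) x : (f + g) x = f x + g x.
Proof. by rewrite -[LHS]/(1 *: f x + g x) scale1r. Qed.

Lemma rh_scaleA a b f : rh_scale a (rh_scale b f) = rh_scale (a * b) f.
Proof. by apply: rephom_ext => x /=; rewrite !addr0 scalerA. Qed.
Lemma rh_scale1 : left_id 1 rh_scale.
Proof. by move=> f; apply: rephom_ext => x /=; rewrite addr0 scale1r. Qed.
Lemma rh_scaleDr : right_distributive rh_scale +%R.
Proof.
move=> a f g; apply: rephom_ext => x.
by rewrite rh_addE /= !addr0 scale1r scalerDr.
Qed.
Lemma rh_scaleDl f : {morph rh_scale^~ f : a b / a + b}.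
Proof.
by move=> a b; apply: rephom_ext => x; rewrite rh_addE /= !addr0 scalerDl.
Qed.
HB.instance Definition _ := GRing.Zmodule_isLmodule.Build F (rephom M N)
  rh_scaleA rh_scale1 rh_scaleDr rh_scaleDl.

Lemma rh_PE a (f g : rephom M N) x : (a *: f + g) x = a *: f x + g x.
Proof. by rewrite rh_addE -[(a *: f) x]/(a *: f x + 0) addr0. Qed.
End HomSpace.

Definition rhid (N : rep) : rephom N N :=
  MkRepHom (@lin_id F N) (fun g x => erefl).

Section HomComp.
Variables (M N P : rep) (g : rephom N P) (f : rephom M N).
Lemma rhcomp_lin : linear (fun x => g (f x)).
Proof. apply: lin_comp; exact: rh_lin. Qed.
Lemma rhcomp_eq h (x : M) : g (f (rho M h x)) = rho P h (g (f x)).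
Proof. by rewrite !rh_eq. Qed.
Definition rhcomp : rephom M P := MkRepHom rhcomp_lin rhcomp_eq.
End HomComp.

Lemma rhcomp_linl (M N P : rep) (f : rephom M N) :
  linear (fun g : rephom N P => rhcomp g f).
Proof.
move=> a g h; apply: rephom_ext => x.
rewrite rh_PE; exact: (rh_PE a g h (f x)).
Qed.
Lemma rhcomp_linr (M N P : rep) (g : rephom N P) :
  linear (fun f : rephom M N => rhcomp g f).
Proof.
move=> a f h; apply: rephom_ext => x; rewrite rh_PE.
rewrite -[LHS]/(g ((a *: f + h) x)) rh_PE; exact: rh_lin.
Qed.
Lemma rhcompA (M N P Q : rep) (h : rephom P Q) (g : rephom N P)
    (f : rephom M N) : rhcomp h (rhcomp g f) = rhcomp (rhcomp h g) f.
Proof. exact: rephom_ext. Qed.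
Lemma rhcomp1m (M N : rep) (f : rephom M N) : rhcomp (rhid N) f = f.
Proof. exact: rephom_ext. Qed.
Lemma rhcompm1 (M N : rep) (f : rephom M N) : rhcomp f (rhid M) = f.
Proof. exact: rephom_ext. Qed.

Definition Rep : lincat F :=
  @LinCat F rep (fun M N => rephom M N) rhid rhcomp
    rhcomp_linl rhcomp_linr rhcompA rhcomp1m rhcompm1.

Section RTens.
Variables N N' : rep.
Definition rt_rho g : vtens N N' -> vtens N N' :=
  tmap (@rho_lin N g) (@rho_lin N' g).
Lemma rt_lin g : linear (rt_rho g). Proof. exact: tmap_lin. Qed.
Lemma rt_rhoE g x y : rt_rho g (tpure x y) = tpure (rho N g x) (rho N' g y).
Proof. exact: tmapE. Qed.
Lemma rt_rho1 x : rt_rho 1%g x = x.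
Proof.
move: x; apply: (vtens_ext (f := rt_rho 1%g) (g := id)) => // [|x y].
  exact: rt_lin.
by rewrite rt_rhoE !rho1.
Qed.
Lemma rt_rhoM g h x : rt_rho (g * h)%g x = rt_rho g (rt_rho h x).
Proof.
move: x; apply: vtens_ext => [||x y].
- exact: rt_lin.
- exact: lin_comp (rt_lin g) (rt_lin h).
- by rewrite !rt_rhoE !rhoM.
Qed.
Definition rtens : rep := MkRep rt_lin rt_rho1 rt_rhoM.
End RTens.

Definition runit_rho (g : G) (x : F^o) := x.
Definition runit_rep : rep :=
  @MkRep F^o runit_rho (fun _ => @lin_id F F^o) (fun _ => erefl)
    (fun _ _ _ => erefl).

Section RTMor.
Variables (M M' N N' : rep) (f : rephom M M') (g : rephom N N').
Definition rtmor_fun : rtens M N -> rtens M' N' := tmap (rh_lin f) (rh_lin g).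
Lemma rtmor_lin : linear rtmor_fun. Proof. exact: tmap_lin. Qed.
Lemma rtmor_eq h x : rtmor_fun (rho _ h x) = rho _ h (rtmor_fun x).
Proof.
move: x; apply: vtens_ext => [||x y].
- exact: lin_comp rtmor_lin (@rt_lin M N h).
- exact: lin_comp (@rt_lin M' N' h) rtmor_lin.
- by rewrite /= rt_rhoE /rtmor_fun !tmapE rt_rhoE !rh_eq.
Qed.
Definition rtmor : rephom (rtens M N) (rtens M' N') :=
  MkRepHom rtmor_lin rtmor_eq.
Lemma rtmorE x y : rtmor (tpure x y) = tpure (f x) (g y).
Proof. exact: tmapE. Qed.
End RTMor.

Lemma rh_text (M N P : rep) (f g : rephom (rtens M N) P) :
  (forall x y, f (tpure x y) = g (tpure x y)) -> f = g.
Proof.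
by move=> h; apply: rephom_ext; apply: vtens_ext => //;
  [exact: (rh_lin f) | exact: (rh_lin g)].
Qed.
Lemma rh_text3 (M N P Q : rep) (f g : rephom (rtens (rtens M N) P) Q) :
  (forall x y z, f (tpure (tpure x y) z) = g (tpure (tpure x y) z)) -> f = g.
Proof.
by move=> h; apply: rephom_ext; apply: vtens3l_ext => //;
  [exact: (rh_lin f) | exact: (rh_lin g)].
Qed.
Lemma rh_text3r (M N P Q : rep) (f g : rephom (rtens M (rtens N P)) Q) :
  (forall x y z, f (tpure x (tpure y z)) = g (tpure x (tpure y z))) -> f = g.
Proof.
by move=> h; apply: rephom_ext; apply: vtens3r_ext => //;
  [exact: (rh_lin f) | exact: (rh_lin g)].
Qed.
Lemma rh_text4 (M N P Q R : rep)
    (f g : rephom (rtens (rtens (rtens M N) P) Q) R) :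
  (forall x y z t, f (tpure (tpure (tpure x y) z) t) =
                   g (tpure (tpure (tpure x y) z) t)) -> f = g.
Proof.
by move=> h; apply: rephom_ext; apply: vtens4l_ext => //;
  [exact: (rh_lin f) | exact: (rh_lin g)].
Qed.

Section RAssoc.
Variables M N P : rep.
Lemma ra_eq h (x : rtens (rtens M N) P) :
  ta_fun (rho _ h x) = rho (rtens M (rtens N P)) h (ta_fun x).
Proof.
move: x; apply: vtens3l_ext => [||x y z].
- exact: lin_comp (@ta_lin _ _ _ _) (@rt_lin (rtens M N) P h).
- exact: lin_comp (@rt_lin M (rtens N P) h) (@ta_lin _ _ _ _).
- by rewrite /= ta_funE !rt_rhoE /= !rt_rhoE ta_funE.
Qed.
Definition ra_hom : rephom (rtens (rtens M N) P) (rtens M (rtens N P)) :=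
  @MkRepHom (rtens (rtens M N) P) (rtens M (rtens N P))
    (@ta_fun F M N P) (@ta_lin F M N P) ra_eq.
Lemma rav_eq h (x : rtens M (rtens N P)) :
  tav_fun (rho _ h x) = rho (rtens (rtens M N) P) h (tav_fun x).
Proof.
move: x; apply: vtens3r_ext => [||x y z].
- exact: lin_comp (@tav_lin _ _ _ _) (@rt_lin M (rtens N P) h).
- exact: lin_comp (@rt_lin (rtens M N) P h) (@tav_lin _ _ _ _).
- by rewrite /= tav_funE !rt_rhoE /= !rt_rhoE tav_funE.
Qed.
Definition rav_hom : rephom (rtens M (rtens N P)) (rtens (rtens M N) P) :=
  @MkRepHom (rtens M (rtens N P)) (rtens (rtens M N) P)
    (@tav_fun F M N P) (@tav_lin F M N P) rav_eq.
Lemma ra_homK : rhcomp rav_hom ra_hom = rhid _.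
Proof. by apply: rh_text3 => x y z; rewrite /= ta_funE tav_funE. Qed.
Lemma rav_homK : rhcomp ra_hom rav_hom = rhid _.
Proof. by apply: rh_text3r => x y z; rewrite /= tav_funE ta_funE. Qed.
Definition ra_iso : @iso F Rep (rtens (rtens M N) P) (rtens M (rtens N P)) :=
  @Iso F Rep _ _ ra_hom rav_hom ra_homK rav_homK.
End RAssoc.

Section RBraid.
Variables M N : rep.
Lemma rb_eq h (x : rtens M N) : tb_fun (rho _ h x) = rho (rtens N M) h (tb_fun x).
Proof.
move: x; apply: vtens_ext => [||x y].
- exact: lin_comp (@tb_lin _ _ _) (@rt_lin M N h).
- exact: lin_comp (@rt_lin N M h) (@tb_lin _ _ _).
- by rewrite /= tb_funE !rt_rhoE tb_funE.
Qed.
Definition rb_hom : rephom (rtens M N) (rtens N M) :=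
  @MkRepHom (rtens M N) (rtens N M)
    (@tb_fun F M N) (@tb_lin F M N) rb_eq.
End RBraid.
Lemma rb_homK M N : rhcomp (rb_hom N M) (rb_hom M N) = rhid _.
Proof. by apply: rh_text => x y; rewrite /= !tb_funE. Qed.

Section RUnit.
Variable M : rep.
Lemma rl_eq h (x : rtens runit_rep M) : tl_fun (rho _ h x) = rho M h (tl_fun x).
Proof.
move: x; apply: vtens_ext => [||a y].
- exact: lin_comp (@tl_lin _ M) (@rt_lin runit_rep M h).
- exact: lin_comp (@rho_lin M h) (@tl_lin _ M).
- by rewrite /= rt_rhoE !tl_funE linearZ.
Qed.
Definition rl_hom : rephom (rtens runit_rep M) M :=
  @MkRepHom (rtens runit_rep M) M
    (@tl_fun F M) (@tl_lin F M) rl_eq.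
Lemma rlv_eq h (x : M) : tlv_fun (rho _ h x) = rho (rtens runit_rep M) h (tlv_fun x).
Proof. by rewrite /= /tlv_fun rt_rhoE. Qed.
Definition rlv_hom : rephom M (rtens runit_rep M) :=
  @MkRepHom M (rtens runit_rep M)
    (@tlv_fun F M) (@tlv_lin F M) rlv_eq.
Lemma rl_homK : rhcomp rlv_hom rl_hom = rhid _.
Proof. by apply: rephom_ext => x; exact: tl_funK. Qed.
Lemma rlv_homK : rhcomp rl_hom rlv_hom = rhid _.
Proof. by apply: rephom_ext => x; exact: tlv_funK. Qed.
Definition rl_iso : @iso F Rep (rtens runit_rep M) M :=
  @Iso F Rep _ _ rl_hom rlv_hom rl_homK rlv_homK.
Lemma rr_homK :
  rhcomp (rhcomp (rb_hom _ _) rlv_hom) (rhcomp rl_hom (rb_hom M runit_rep)) =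
  rhid _.
Proof.
rewrite -rhcompA [X in rhcomp _ X]rhcompA rl_homK rhcomp1m; exact: rb_homK.
Qed.
Lemma rrv_homK :
  rhcomp (rhcomp rl_hom (rb_hom M runit_rep)) (rhcomp (rb_hom _ _) rlv_hom) =
  rhid _.
Proof.
rewrite -rhcompA [X in rhcomp _ X]rhcompA rb_homK rhcomp1m; exact: rlv_homK.
Qed.
Definition rr_iso : @iso F Rep (rtens M runit_rep) M :=
  @Iso F Rep _ _ (rhcomp rl_hom (rb_hom M runit_rep))
    (rhcomp (rb_hom _ _) rlv_hom) rr_homK rrv_homK.
End RUnit.

Lemma ra_nat M M' N N' P P' (f : rephom M M') (g : rephom N N')
    (h : rephom P P') :
  rhcomp (ra_hom M' N' P') (rtmor (rtmor f g) h) =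
  rhcomp (rtmor f (rtmor g h)) (ra_hom M N P).
Proof.
by apply: rh_text3 => x y z; rewrite /= !ta_funE /rtmor_fun !tmapE /= /rtmor_fun !tmapE ta_funE.
Qed.
Lemma rl_nat M M' (f : rephom M M') :
  rhcomp (rl_hom M') (rtmor (rhid runit_rep) f) = rhcomp f (rl_hom M).
Proof.
by apply: rh_text => a y; rewrite /= /rtmor_fun tmapE !tl_funE linearZ.
Qed.
Lemma rb_nat M M' N N' (f : rephom M M') (g : rephom N N') :
  rhcomp (rb_hom M' N') (rtmor f g) = rhcomp (rtmor g f) (rb_hom M N).
Proof.
by apply: rh_text => x y; rewrite /= /rtmor_fun tmapE !tb_funE tmapE.
Qed.
Lemma rr_nat M M' (f : rephom M M') :
  rhcomp (rhcomp (rl_hom M') (rb_hom _ _)) (rtmor f (rhid runit_rep)) =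
  rhcomp f (rhcomp (rl_hom M) (rb_hom _ _)).
Proof. by rewrite -rhcompA rb_nat !rhcompA rl_nat. Qed.
Lemma r_triangle M N :
  rhcomp (rtmor (rhid M) (rl_hom N)) (ra_hom M runit_rep N) =
  rtmor (rhcomp (rl_hom M) (rb_hom M runit_rep)) (rhid N).
Proof.
apply: rh_text3 => x a y; rewrite /= ta_funE /rtmor_fun !tmapE /= tb_funE !tl_funE.
by rewrite (lin_Z _ _ (tpure_linl _)) (lin_Z _ _ (tpure_linr _)).
Qed.
Lemma r_pentagon M N P Q :
  rhcomp (ra_hom M N (rtens P Q)) (ra_hom (rtens M N) P Q) =
  rhcomp (rhcomp (rtmor (rhid M) (ra_hom N P Q)) (ra_hom M (rtens N P) Q))
    (rtmor (ra_hom M N P) (rhid Q)).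
Proof.
apply: rh_text4 => x y z t.
rewrite /= /rtmor_fun tmapE /= !ta_funE tmapE /= !ta_funE.
done.
Qed.
Lemma r_hexagon M N P :
  rhcomp (rhcomp (ra_hom N P M) (rb_hom M (rtens N P))) (ra_hom M N P) =
  rhcomp (rhcomp (rtmor (rhid N) (rb_hom M P)) (ra_hom N M P))
    (rtmor (rb_hom M N) (rhid P)).
Proof.
apply: rh_text3 => x y z.
by rewrite /= /rtmor_fun ta_funE tb_funE ta_funE tmapE /= tb_funE ta_funE tmapE /= tb_funE.
Qed.
Lemma rtmor_linl M M' N N' (g : rephom N N') :
  linear (fun f : rephom M M' => rtmor f g).
Proof.
move=> a f f'; apply: rh_text => x y.
by rewrite rh_PE !rtmorE rh_PE tpure_linl.
Qed.
Lemma rtmor_linr M M' N N' (f : rephom M M') :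
  linear (fun g : rephom N N' => rtmor f g).
Proof.
move=> a g g'; apply: rh_text => x y.
by rewrite rh_PE !rtmorE rh_PE tpure_linr.
Qed.
Lemma rtmor1 M N : rtmor (rhid M) (rhid N) = rhid (rtens M N).
Proof. by apply: rh_text => x y; rewrite rtmorE. Qed.
Lemma rtmorM M M' M'' N N' N'' (f' : rephom M' M'') (f : rephom M M')
    (g' : rephom N' N'') (g : rephom N N') :
  rtmor (rhcomp f' f) (rhcomp g' g) = rhcomp (rtmor f' g') (rtmor f g).
Proof. by apply: rh_text => x y; rewrite /= /rtmor_fun !tmapE. Qed.

Definition Rep_ten : tencat F :=
  @TenCat F Rep rtens
    (fun M M' N N' f g => rtmor f g)
    (fun M M' N N' g => @rtmor_linl M M' N N' g)
    (fun M M' N N' f => @rtmor_linr M M' N N' f)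
    rtmor1
    (fun M M' M'' N N' N'' f' f g' g => rtmorM f' f g' g)
    runit_rep ra_iso rl_iso rr_iso rb_hom
    (fun M M' N N' P P' f g h => ra_nat f g h)
    (fun M M' f => rl_nat f)
    (fun M M' f => rr_nat f)
    (fun M M' N N' f g => rb_nat f g)
    rb_homK r_triangle r_pentagon r_hexagon.

End Rep.
Arguments rho {F G} N g x : rename.
Arguments rh {F G N N'} f x : rename.

Section Cinf.
Variable F : fieldType.

Record Cinf := MkCinf {
  cc :> nat -> F;
  cc_fin : exists d, forall i, (d <= i)%N -> cc i = 0 }.

Lemma Cinf_ext (u v : Cinf) : (forall i, u i = v i) -> u = v.
Proof.
case: u v => u hu [v hv] /= h; have e : u = v by apply/funext.
by case: v / e hv h => hv _; congr MkCinf; apply: Prop_irrelevance.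
Qed.

HB.instance Definition _ := gen_eqMixin Cinf.
HB.instance Definition _ := gen_choiceMixin Cinf.

Lemma c0_fin : exists d, forall i, (d <= i)%N -> (0 : F) = 0.
Proof. by exists 0%N. Qed.
Definition c0 : Cinf := MkCinf c0_fin.
Lemma cP_fin a (u v : Cinf) :
  exists d, forall i, (d <= i)%N -> a * u i + v i = 0.
Proof.
have [d hd] := cc_fin u; have [d' hd'] := cc_fin v.
exists (maxn d d') => i; rewrite geq_max => /andP[h h'].
by rewrite hd // hd' // mulr0 addr0.
Qed.
Definition cP a u v : Cinf := MkCinf (cP_fin a u v).
Definition c_add u v := cP 1 u v.
Definition c_scale a u := cP a u c0.
Definition c_opp u := cP (-1) u c0.
Lemma c_addA : associative c_add.
Proof. by move=> u v w; apply: Cinf_ext => i /=; rewrite !mul1r addrA. Qed.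
Lemma c_addC : commutative c_add.
Proof. by move=> u v; apply: Cinf_ext => i /=; rewrite !mul1r addrC. Qed.
Lemma c_add0 : left_id c0 c_add.
Proof. by move=> u; apply: Cinf_ext => i /=; rewrite mul1r add0r. Qed.
Lemma c_addN : left_inverse c0 c_opp c_add.
Proof.
by move=> u; apply: Cinf_ext => i /=; rewrite mul1r addr0 mulN1r addNr.
Qed.
HB.instance Definition _ :=
  GRing.isZmodule.Build Cinf c_addA c_addC c_add0 c_addN.
Lemma c_addE (u v : Cinf) i : (u + v) i = u i + v i.
Proof. by rewrite -[LHS]/(1 * u i + v i) mul1r. Qed.
Lemma c_scaleA a b u : c_scale a (c_scale b u) = c_scale (a * b) u.
Proof. by apply: Cinf_ext => i /=; rewrite !addr0 mulrA. Qed.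
Lemma c_scale1 : left_id 1 c_scale.
Proof. by move=> u; apply: Cinf_ext => i /=; rewrite addr0 mul1r. Qed.
Lemma c_scaleDr : right_distributive c_scale +%R.
Proof.
by move=> a u v; apply: Cinf_ext => i; rewrite c_addE /= !addr0 mul1r mulrDr.
Qed.
Lemma c_scaleDl u : {morph c_scale^~ u : a b / a + b}.
Proof. by move=> a b; apply: Cinf_ext => i; rewrite c_addE /= !addr0 mulrDl. Qed.
HB.instance Definition _ := GRing.Zmodule_isLmodule.Build F Cinf
  c_scaleA c_scale1 c_scaleDr c_scaleDl.
Lemma c_PE a (u v : Cinf) i : (a *: u + v) i = a * u i + v i.
Proof. by rewrite c_addE -[(a *: u) i]/(a * u i + 0) addr0. Qed.

(* Coordinates are numbered from 0, so this is e_1^*. *)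
Definition tform (v : Cinf) : F := v 0%N.
Lemma tform_lin : linear (tform : Cinf -> F^o).
Proof. by move=> a u v; rewrite /tform c_PE. Qed.

(* f preserves C^d and is the identity on the span of the other basis vectors:
   f is of the form A (+) id along C^oo = C^d (+) <e_i | i >= d>. *)
Definition gl_block (d : nat) (f : Cinf -> Cinf) : Prop :=
  (forall v : Cinf, (forall i, (d <= i)%N -> v i = 0) ->
     forall i, (d <= i)%N -> f v i = 0) /\
  (forall v : Cinf, (forall i, (i < d)%N -> v i = 0) -> f v = v).

Record GLinf := MkGL {
  gl :> Cinf -> Cinf;
  glV : Cinf -> Cinf;
  gl_lin : linear gl;
  glK : cancel gl glV;
  glVK : cancel glV gl;
  gl_fin : exists d, gl_block d gl /\ gl_block d glV }.

Lemma GL_ext (g h : GLinf) : (forall v, g v = h v) -> g = h.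
Proof.
case: g h => g g' gl1 gK g'K gf [h h' hl hK h'K hf] /= e.
have e1 : g = h by apply/funext.
case: h / e1 {e} hl hK h'K hf => hl hK h'K hf.
have e2 : g' = h' by apply/funext => v; rewrite -{1}[v]h'K gK.
case: h' / e2 hK h'K hf => hK h'K hf.
by congr MkGL; apply: Prop_irrelevance.
Qed.
HB.instance Definition _ := gen_eqMixin GLinf.
HB.instance Definition _ := gen_choiceMixin GLinf.

Lemma gl_block_id d : gl_block d id. Proof. by []. Qed.
Lemma gl_block_comp d f g : gl_block d f -> gl_block d g -> gl_block d (f \o g).
Proof.
move=> [f1 f2] [g1 g2]; split=> v hv /=; last by rewrite g2 ?f2.
by apply: f1; apply: g1.
Qed.

Section Trunc.
Variables (d : nat) (v : Cinf).
Lemma trl_fin : exists k, forall i, (k <= i)%N -> (if (i < d)%N then v i else 0) = 0.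
Proof. by exists d => i; rewrite leqNgt => /negbTE ->. Qed.
Definition trl : Cinf := MkCinf trl_fin.
Lemma trr_fin : exists k, forall i, (k <= i)%N -> (if (i < d)%N then 0 else v i) = 0.
Proof. by have [k hk] := cc_fin v; exists k => i hi; rewrite hk // if_same. Qed.
Definition trr : Cinf := MkCinf trr_fin.
Lemma trlr : v = trl + trr.
Proof.
by apply: Cinf_ext => i; rewrite c_addE /=; case: ifP; rewrite ?addr0 ?add0r.
Qed.
End Trunc.

Lemma gl_block_le d d' f :
  linear f -> (d <= d')%N -> gl_block d f -> gl_block d' f.
Proof.
move=> fl hd [f1 f2]; split=> v hv.
  move=> i hi; rewrite (trlr d v) (lin_D _ _ fl) c_addE f1 //=.
  - rewrite add0r f2 /=; last by move=> j ->.
    by rewrite hv // if_same.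
  - by move=> j; rewrite leqNgt => /negbTE ->.
  - exact: leq_trans hd hi.
by apply: f2 => i hi; apply: hv; exact: leq_trans hi hd.
Qed.

Lemma glV_lin (g : GLinf) : linear (glV g).
Proof.
by move=> a u v; apply: (can_inj (@glK g)); rewrite gl_lin !glVK.
Qed.

Definition gl1 : GLinf :=
  @MkGL id id (@lin_id F Cinf) (fun _ => erefl) (fun _ => erefl)
    (ex_intro _ 0%N (conj (gl_block_id 0) (gl_block_id 0))).
Definition gl_inv (g : GLinf) : GLinf :=
  @MkGL (glV g) (gl g) (@glV_lin g) (@glVK g) (@glK g)
    (let: ex_intro d h := gl_fin g in ex_intro _ d (conj h.2 h.1)).
Lemma gl_mul_fin (g h : GLinf) :
  exists d, gl_block d (g \o h) /\ gl_block d (glV h \o glV g).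
Proof.
have [d [g1 g2]] := gl_fin g; have [e [h1 h2]] := gl_fin h.
have [dm em] := (leq_maxl d e, leq_maxr d e).
exists (maxn d e); split; apply: gl_block_comp.
- exact: gl_block_le (@gl_lin g) dm g1.
- exact: gl_block_le (@gl_lin h) em h1.
- exact: gl_block_le (@glV_lin h) em h2.
- exact: gl_block_le (@glV_lin g) dm g2.
Qed.
Definition gl_mul (g h : GLinf) : GLinf :=
  @MkGL (g \o h) (glV h \o glV g) (lin_comp (@gl_lin g) (@gl_lin h))
    (can_comp (@glK g) (@glK h)) (can_comp (@glVK h) (@glVK g))
    (gl_mul_fin g h).
Lemma gl_mulA : associative gl_mul. Proof. by move=> f g h; apply: GL_ext. Qed.
Lemma gl_mul1g : left_id gl1 gl_mul. Proof. by move=> f; apply: GL_ext. Qed.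
Lemma gl_mulg1 : right_id gl1 gl_mul. Proof. by move=> f; apply: GL_ext. Qed.
Lemma gl_mulVg : left_inverse gl1 gl_inv gl_mul.
Proof. by move=> f; apply: GL_ext => v; exact: glK. Qed.
Lemma gl_mulgV : right_inverse gl1 gl_inv gl_mul.
Proof. by move=> f; apply: GL_ext => v; exact: glVK. Qed.
HB.instance Definition _ :=
  isGroup.Build GLinf gl_mulA gl_mul1g gl_mulg1 gl_mulVg gl_mulgV.

Record GAinf := MkGA {
  ga :> GLinf;
  ga_t : forall v, tform (ga v) = tform v }.
Lemma GA_ext (g h : GAinf) : ga g = ga h -> g = h.
Proof.
case: g h => g gt [h ht] /= e; case: h / e ht => ht.
by congr MkGA; apply: Prop_irrelevance.
Qed.
HB.instance Definition _ := gen_eqMixin GAinf.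
HB.instance Definition _ := gen_choiceMixin GAinf.
Definition ga1 : GAinf := @MkGA 1%g (fun _ => erefl).
Lemma ga_inv_t (g : GAinf) v : tform ((ga g)^-1%g v) = tform v.
Proof. by rewrite -(ga_t g) (@glVK (ga g)). Qed.
Definition ga_inv (g : GAinf) : GAinf := MkGA (ga_inv_t g).
Lemma ga_mul_t (g h : GAinf) v : tform ((ga g * ga h)%g v) = tform v.
Proof. by rewrite -[LHS]/(tform (g (h v))) !ga_t. Qed.
Definition ga_mul (g h : GAinf) : GAinf := MkGA (ga_mul_t g h).
Lemma ga_mulA : associative ga_mul.
Proof. by move=> f g h; apply: GA_ext; exact: mulgA. Qed.
Lemma ga_mul1g : left_id ga1 ga_mul.
Proof. by move=> f; apply: GA_ext; exact: mul1g. Qed.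
Lemma ga_mulg1 : right_id ga1 ga_mul.
Proof. by move=> f; apply: GA_ext; exact: mulg1. Qed.
Lemma ga_mulVg : left_inverse ga1 ga_inv ga_mul.
Proof. by move=> f; apply: GA_ext; exact: mulVg. Qed.
Lemma ga_mulgV : right_inverse ga1 ga_inv ga_mul.
Proof. by move=> f; apply: GA_ext; exact: mulgV. Qed.
HB.instance Definition _ :=
  isGroup.Build GAinf ga_mulA ga_mul1g ga_mulg1 ga_mulVg ga_mulgV.

Section Power.
Variable I : finType.

Definition upd (x : I -> Cinf) (i : I) (v : Cinf) : I -> Cinf :=
  fun j => if j == i then v else x j.

Definition multilinear (W : lmodType F) (phi : (I -> Cinf) -> W) : Prop :=
  forall x i, linear (fun v => phi (upd x i v)).

Definition kpow : lmodType F := univ multilinear.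
Definition mpure (x : I -> Cinf) : kpow := gen multilinear x.

Lemma mpure_lin : multilinear mpure.
Proof.
move=> x i a u v; apply: univ_sep => W phi hp.
by rewrite (evq_linear hp) !evq_gen // hp.
Qed.
Lemma kpow_ext (W : lmodType F) (f g : kpow -> W) :
  linear f -> linear g -> (forall x, f (mpure x) = g (mpure x)) ->
  forall u, f u = g u.
Proof. by move=> hf hg h u; apply: (@univ_ext F _ multilinear W f g hf hg). Qed.

Lemma kg_adm (g : GAinf) : multilinear (fun x => mpure (fun i => g (x i))).
Proof.
move=> x i; have e v :
    (fun j => g (upd x i v j)) = upd (fun j => g (x j)) i (g v).
  by apply/funext => j; rewrite /upd; case: eqP.
move=> a u v /=; rewrite !e gl_lin; exact: (mpure_lin (fun j => g (x j)) i).
Qed.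
Definition kg (g : GAinf) : kpow -> kpow := lift (kg_adm g).
Lemma kg_lin g : linear (kg g). Proof. exact: linearP. Qed.
Lemma kgE g x : kg g (mpure x) = mpure (fun i => g (x i)).
Proof. exact: lift_gen. Qed.
Lemma kg1 x : kg 1%g x = x.
Proof.
move: x; apply: (kpow_ext (f := kg 1%g) (g := id)) => // [|x].
  exact: kg_lin.
by rewrite kgE.
Qed.
Lemma kgM g h x : kg (g * h)%g x = kg g (kg h x).
Proof.
move: x; apply: kpow_ext => [||x].
- exact: kg_lin.
- exact: lin_comp (kg_lin g) (kg_lin h).
- by rewrite !kgE.
Qed.
Definition krep : rep F GAinf := MkRep kg_lin kg1 kgM.
End Power.

Section Relabel.
Variables (I J : finType) (f : J -> I) (fb : bijective f).
Lemma krl_adm : multilinear (fun x : I -> Cinf => mpure (fun j => x (f j))).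
Proof.
move=> x i; have [g fK gK] := fb; have e v :
    (fun j => upd x i v (f j)) = upd (fun j => x (f j)) (g i) v.
  by apply/funext => j; rewrite /upd (can2_eq fK gK).
by move=> a u v /=; rewrite !e; exact: (mpure_lin (fun j => x (f j)) (g i)).
Qed.
Definition krl : kpow I -> kpow J := lift krl_adm.
Lemma krl_lin : linear krl. Proof. exact: linearP. Qed.
Lemma krlE x : krl (mpure x) = mpure (fun j => x (f j)).
Proof. exact: lift_gen. Qed.
Lemma krl_eq g x : krl (rho (krep I) g x) = rho (krep J) g (krl x).
Proof.
move: x; apply: kpow_ext => [||x].
- exact: lin_comp krl_lin (kg_lin g).
- exact: lin_comp (kg_lin g) krl_lin.
- by rewrite /= kgE !krlE kgE.
Qed.
Definition krl_hom : rephom (krep I) (krep J) :=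
  @MkRepHom _ _ (krep I) (krep J) krl krl_lin krl_eq.
End Relabel.
Lemma krlK (I J : finType) (f : J -> I) (fb : bijective f) (g : I -> J)
    (gb : bijective g) : cancel g f -> cancel (krl fb) (krl gb).
Proof.
move=> gK; apply: (kpow_ext (f := fun u => krl gb (krl fb u)) (g := id)).
- exact: lin_comp (krl_lin gb) (krl_lin fb).
- by [].
- by move=> x; rewrite !krlE; congr mpure; apply/funext => i; rewrite gK.
Qed.

Section KAct.
Variables (L L' : FinSet) (p : dsmor L L').

Lemma ds_finv_ex : exists g, cancel (ds_f p) g /\ cancel g (ds_f p).
Proof. by have [g h1 h2] := ds_bij p; exists g. Qed.
Definition ds_finv : L' -> {x : L | x \notin ds_U p} := projT1 (cid ds_finv_ex).
Lemma ds_finvK : cancel (ds_f p) ds_finv.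
Proof. exact: (projT2 (cid ds_finv_ex)).1. Qed.
Lemma ds_finvVK : cancel ds_finv (ds_f p).
Proof. exact: (projT2 (cid ds_finv_ex)).2. Qed.

(* The factor of the target at l' is the one of the source at f^-1(l'). *)
Definition kphi (x : L -> Cinf) : kpow L' :=
  (\prod_(l in ds_U p) tform (x l)) *: mpure (fun l' => x (val (ds_finv l'))).

Lemma kphi_adm : multilinear kphi.
Proof.
move=> x i; case: (boolP (i \in ds_U p)) => hi.
  have e v : kphi (upd x i v) = tform v *:
      ((\prod_(l in ds_U p | l != i) tform (x l)) *:
        mpure (fun l' => x (val (ds_finv l')))).
    rewrite /kphi (bigD1 i) //= {1}/upd eqxx scalerA; congr (_ * _ *: _).
      by apply: eq_bigr => j /andP[_ /negbTE]; rewrite /upd => ->.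
    congr mpure; apply/funext => l'; rewrite /upd; case: eqP => // h.
    by have /negP[] := valP (ds_finv l'); rewrite -h in hi.
  by move=> a u v /=; rewrite !e tform_lin scalerDl; congr (_ + _); rewrite [RHS]scalerA.
have e v : kphi (upd x i v) = (\prod_(l in ds_U p) tform (x l)) *:
    mpure (upd (fun l' => x (val (ds_finv l'))) (ds_f p (exist _ i hi)) v).
  rewrite /kphi; congr (_ *: _).
    apply: eq_bigr => j hj; rewrite /upd; case: eqP => // h.
    by move: hi; rewrite -h hj.
  congr mpure; apply/funext => l'; rewrite /upd.
  rewrite -(can2_eq ds_finvVK ds_finvK) -(inj_eq val_inj) /=.
  by [].
move=> a u v /=; rewrite !e (mpure_lin _ _ a u v).
by rewrite scalerDr !scalerA [_ * a]mulrC.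
Qed.
Definition kact : kpow L -> kpow L' := lift kphi_adm.
Lemma kact_lin : linear kact. Proof. exact: linearP. Qed.
Lemma kactE x : kact (mpure x) = kphi x. Proof. exact: lift_gen. Qed.
Lemma kact_eq g x : kact (rho (krep L) g x) = rho (krep L') g (kact x).
Proof.
move: x; apply: kpow_ext => [||x].
- exact: lin_comp kact_lin (kg_lin g).
- exact: lin_comp (kg_lin g) kact_lin.
- rewrite /= kgE !kactE /kphi (lin_Z _ _ (kg_lin g)) kgE; congr (_ *: _).
  by apply: eq_bigr => l _; exact: ga_t.
Qed.
Definition kmor : rephom (krep L) (krep L') :=
  @MkRepHom _ _ (krep L) (krep L') kact kact_lin kact_eq.
End KAct.

Lemma kact_id (L : FinSet) (x : kpow L) : kact (ds_id L) x = x.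
Proof.
move: x; apply: (kpow_ext (f := kact (ds_id L)) (g := id)) => // [|x].
  exact: kact_lin.
rewrite kactE /kphi big1 => [|l]; last by rewrite inE.
rewrite scale1r; congr mpure; apply/funext => l; congr (x _).
exact: (ds_finvVK (ds_id L)).
Qed.

Lemma ds_finv_pm L L' (p : dsmor L L') x y :
  ds_pm p x = Some y -> val (ds_finv p y) = x.
Proof.
case: (boolP (x \in ds_U p)) => h; first by rewrite ds_pmF.
by rewrite (ds_pmT h) => -[<-]; rewrite ds_finvK.
Qed.
Lemma ds_pm_finv L L' (p : dsmor L L') y :
  ds_pm p (val (ds_finv p y)) = Some y.
Proof. by have [x hx] := ds_pm_surj p y; rewrite (ds_finv_pm hx). Qed.

Lemma kact_comp (L L' L'' : FinSet) (q : dsmor L' L'') (p : dsmor L L') (x : kpow L) :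
  kact (ds_comp q p) x = kact q (kact p x).
Proof.
move: x; apply: kpow_ext => [||x].
- exact: kact_lin.
- exact: lin_comp (kact_lin q) (kact_lin p).
rewrite !kactE /kphi (lin_Z _ _ (kact_lin q)) kactE /kphi scalerA.
congr (_ *: _); last first.
  congr mpure; apply/funext => l; congr (x _); apply: ds_finv_pm.
  by rewrite ds_pm_comp ds_pm_finv /= ds_pm_finv.
set W := [set val y | y in [set y | ds_f p y \in ds_U q]].
rewrite (_ : ds_U (ds_comp q p) = ds_U p :|: W) //.
rewrite (big_setID (ds_U p)) /= (setIidPr (subsetUl _ _)) setDUl setDv set0U.
rewrite (setDidPl _); last first.
  rewrite disjoint_subset; apply/subsetP => l /imsetP[y _ ->].
  by rewrite inE (valP y).
congr (_ * _); rewrite big_imset /=; last by move=> y z _ _; apply: val_inj.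
rewrite (reindex (ds_finv p)) /=; last first.
  by apply: onW_bij; exists (ds_f p); [exact: ds_finvVK | exact: ds_finvK].
by apply: eq_bigl => l; rewrite inE ds_finvVK.
Qed.

Definition Kds : dsmod F := @MkDsMod F (fun L => kpow L) kact kact_lin kact_id kact_comp.

Section DSum.
Variables (k : nat) (W : 'I_k -> rep F GAinf).
Definition dsum_sp : Type := forall j : 'I_k, W j.
HB.instance Definition _ := gen_eqMixin dsum_sp.
HB.instance Definition _ := gen_choiceMixin dsum_sp.
Definition dsum_add (x y : dsum_sp) : dsum_sp := fun j => x j + y j.
Definition dsum_zero : dsum_sp := fun j => 0.
Definition dsum_opp (x : dsum_sp) : dsum_sp := fun j => - x j.
Definition dsum_scale (a : F) (x : dsum_sp) : dsum_sp := fun j => a *: x j.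
Lemma dsum_addA : associative dsum_add.
Proof.
by move=> x y z; apply: functional_extensionality_dep => j; exact: addrA.
Qed.
Lemma dsum_addC : commutative dsum_add.
Proof.
by move=> x y; apply: functional_extensionality_dep => j; exact: addrC.
Qed.
Lemma dsum_add0 : left_id dsum_zero dsum_add.
Proof. by move=> x; apply: functional_extensionality_dep => j; exact: add0r. Qed.
Lemma dsum_addN : left_inverse dsum_zero dsum_opp dsum_add.
Proof. by move=> x; apply: functional_extensionality_dep => j; exact: addNr. Qed.
HB.instance Definition _ :=
  GRing.isZmodule.Build dsum_sp dsum_addA dsum_addC dsum_add0 dsum_addN.
Lemma dsum_scaleA a b x : dsum_scale a (dsum_scale b x) = dsum_scale (a * b) x.
Proof. by apply: functional_extensionality_dep => j; exact: scalerA. Qed.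
Lemma dsum_scale1 : left_id 1 dsum_scale.
Proof. by move=> x; apply: functional_extensionality_dep => j; exact: scale1r. Qed.
Lemma dsum_scaleDr : right_distributive dsum_scale +%R.
Proof.
by move=> a x y; apply: functional_extensionality_dep => j; exact: scalerDr.
Qed.
Lemma dsum_scaleDl x : {morph dsum_scale^~ x : a b / a + b}.
Proof.
by move=> a b; apply: functional_extensionality_dep => j; exact: scalerDl.
Qed.
HB.instance Definition _ := GRing.Zmodule_isLmodule.Build F dsum_sp
  dsum_scaleA dsum_scale1 dsum_scaleDr dsum_scaleDl.
Definition dsum_rho (g : GAinf) (x : dsum_sp) : dsum_sp := fun j => rho (W j) g (x j).
Lemma dsum_lin g : linear (dsum_rho g).
Proof.
by move=> a x y; apply: functional_extensionality_dep => j; exact: rho_lin.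
Qed.
Lemma dsum_rho1 x : dsum_rho 1%g x = x.
Proof. by apply: functional_extensionality_dep => j; exact: rho1. Qed.
Lemma dsum_rhoM g h x : dsum_rho (g * h)%g x = dsum_rho g (dsum_rho h x).
Proof. by apply: functional_extensionality_dep => j; exact: rhoM. Qed.
Definition dsum : rep F GAinf := MkRep dsum_lin dsum_rho1 dsum_rhoM.
End DSum.

(* N is a quotient of a subrepresentation S of a finite direct sum of tensor
   powers of V. *)
Definition polynomial_rep (N : rep F GAinf) : Prop :=
  exists (k : nat) (n : 'I_k -> nat) (S : rep F GAinf)
    (i : rephom S (dsum (fun j => krep 'I_(n j)))) (q : rephom S N),
    injective i /\ (forall y, exists x, q x = y).

Lemma krep_polynomial (I : finType) : polynomial_rep (krep I).
Proof.
pose W := fun j : 'I_1 => krep 'I_(#|I|).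
pose rl := krl (@enum_val_bij I).
pose i : krep I -> dsum W := fun x _ => rl x.
have il : linear i.
  by move=> a x y; apply: functional_extensionality_dep => j; exact: krl_lin.
have ie g x : i (rho (krep I) g x) = rho (dsum W) g (i x).
  by apply: functional_extensionality_dep => j; exact: krl_eq.
exists 1%N, (fun _ => #|I|), (krep I), (@MkRepHom _ _ (krep I) (dsum W) i il ie),
  (rhid _); split; last by move=> y; exists y.
move=> x y e; have {}e : rl x = rl y by exact: (congr1 (fun f => f ord0) e).
apply: (can_inj (krlK (@enum_val_bij I) (@enum_rank_bij I) _)) e.
exact: enum_rankK.
Qed.

Section PhiOb.
Variable M : dsmod F.
Section PhiRho.
Variables (g : GAinf) (f : dshom M Kds).
Lemma phi_rho_lin L : linear (fun x : M L => rho (krep L) g (f L x)).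
Proof. exact: lin_comp (@kg_lin L g) (@dh_lin _ _ _ f L). Qed.
Lemma phi_rho_nat L L' (p : dsmor L L') (x : M L) :
  rho (krep L') g (f L' (dsact M p x)) =
  dsact Kds p (rho (krep L) g (f L x)).
Proof. by rewrite dh_nat; symmetry; exact: kact_eq. Qed.
Definition phi_rho : dshom M Kds := @MkDsHom F M Kds _ phi_rho_lin phi_rho_nat.
End PhiRho.
Lemma phi_lin g : linear (phi_rho g).
Proof.
move=> a f h; apply: dshom_ext => L x; rewrite dh_PE.
by rewrite -[LHS]/(kg g ((a *: f + h) L x)) dh_PE; exact: kg_lin.
Qed.
Lemma phi_rho1 f : phi_rho 1%g f = f.
Proof. by apply: dshom_ext => L x; exact: kg1. Qed.
Lemma phi_rhoM g h f : phi_rho (g * h)%g f = phi_rho g (phi_rho h f).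
Proof. by apply: dshom_ext => L x; exact: kgM. Qed.
Definition Phi_ob : rep F GAinf := MkRep phi_lin phi_rho1 phi_rhoM.
End PhiOb.

Section PhiMor.
Variables (M N : dsmod F) (f : dshom M N).
Lemma Phi_mor_lin : linear (fun h : dshom N Kds => dhcomp h f).
Proof. exact: dhcomp_linl. Qed.
Lemma Phi_mor_eq g (h : dshom N Kds) :
  dhcomp (phi_rho g h) f = phi_rho g (dhcomp h f).
Proof. exact: dshom_ext. Qed.
Definition Phi_mor : rephom (Phi_ob N) (Phi_ob M) :=
  @MkRepHom F GAinf (Phi_ob N) (Phi_ob M) _ Phi_mor_lin Phi_mor_eq.
End PhiMor.

Lemma Phi_lin M N : linear (@Phi_mor M N).
Proof. by move=> a f g; apply: rephom_ext => h; rewrite rh_PE; exact: dhcomp_linr. Qed.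
Lemma Phi_id M : Phi_mor (dhid M) = rhid (Phi_ob M).
Proof. by apply: rephom_ext => h; exact: dhcompm1. Qed.
Lemma Phi_comp M N P (g : dshom N P) (f : dshom M N) :
  Phi_mor (dhcomp g f) = rhcomp (Phi_mor f) (Phi_mor g).
Proof. by apply: rephom_ext => h; exact: dhcompA. Qed.

Definition Phi : cfunctor (Mod_ds F) (Rep F GAinf) :=
  @CFunctor F (Mod_ds F) (Rep F GAinf) Phi_ob Phi_mor Phi_lin Phi_id Phi_comp.

Section PsiOb.
Variable N : rep F GAinf.
Definition psi_act L L' (p : dsmor L L') (h : rephom N (krep L)) :
  rephom N (krep L') := rhcomp (kmor p) h.
Lemma psi_lin L L' (p : dsmor L L') : linear (psi_act p).
Proof. exact: rhcomp_linr. Qed.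
Lemma psi_id L h : psi_act (ds_id L) h = h.
Proof. by apply: rephom_ext => x; exact: kact_id. Qed.
Lemma psi_comp L L' L'' (q : dsmor L' L'') (p : dsmor L L') h :
  psi_act (ds_comp q p) h = psi_act q (psi_act p h).
Proof. by apply: rephom_ext => x; exact: kact_comp. Qed.
Definition Psi_ob : dsmod F :=
  @MkDsMod F (fun L => rephom N (krep L)) psi_act psi_lin psi_id psi_comp.
End PsiOb.

Section PsiMor.
Variables (N N' : rep F GAinf) (f : rephom N N').
Definition psi_mor L (h : rephom N' (krep L)) : rephom N (krep L) := rhcomp h f.
Lemma psi_mor_lin L : linear (@psi_mor L).
Proof. exact: rhcomp_linl. Qed.
Lemma psi_mor_nat L L' (p : dsmor L L') (h : Psi_ob N' L) :
  psi_mor (dsact (Psi_ob N') p h) = dsact (Psi_ob N) p (psi_mor h).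
Proof. by symmetry; exact: rhcompA. Qed.
Definition Psi_mor : dshom (Psi_ob N') (Psi_ob N) :=
  @MkDsHom F (Psi_ob N') (Psi_ob N) psi_mor psi_mor_lin psi_mor_nat.
End PsiMor.

Lemma Psi_lin N N' : linear (@Psi_mor N N').
Proof.
by move=> a f g; apply: dshom_ext => L h; rewrite dh_PE; exact: rhcomp_linr.
Qed.
Lemma Psi_id N : Psi_mor (rhid N) = dhid (Psi_ob N).
Proof. by apply: dshom_ext => L h; exact: rhcompm1. Qed.
Lemma Psi_comp N N' N'' (g : rephom N' N'') (f : rephom N N') :
  Psi_mor (rhcomp g f) = dhcomp (Psi_mor f) (Psi_mor g).
Proof. by apply: dshom_ext => L h; exact: rhcompA. Qed.

Definition Psi : cfunctor (Rep F GAinf) (Mod_ds F) :=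
  @CFunctor F (Rep F GAinf) (Mod_ds F) Psi_ob Psi_mor Psi_lin Psi_id Psi_comp.

End Cinf.

Definition Rep_GA (F : fieldType) : tencat F := Rep_ten F (GAinf F).

(* Main.v *)
Require Import Defs.
From HB Require Import structures.
From mathcomp Require Import all_boot all_algebra generic_quotient boolp reals complex.

(* A ds-morphism I -> L amounts to an injection psi : L -> I, so Mod_ds is the
   category of modules over the opposite of FI.  The whole proof rests on two
   facts about a finite sum D of tensor powers K_(L_j).

   (1) An equivariant map S -> K_L on a subrepresentation S of D is the
   restriction of a combination of the maps K_psi : K_(L_j) -> K_L.
   (2) If Y is a subrepresentation of D and x is not in Y, some combination of
   the maps K_psi kills Y but not x.

   Both follow from the polarization operators
     P_i (x) = sum_psi e_i^*(K_psi x) e_psi      (i : L -> nat),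
   where e_psi is the basis tensor that has fresh basis vectors, indexed by L, in
   the positions psi(l) and the vector e_0 elsewhere.  On vectors of bounded
   support, P_i is the action of an element of the group algebra: affine
   endomorphisms of V are limits of elements of GA, and P_i is the multilinear
   coefficient of the action of the affine maps
   v |-> t(v) e_0 + sum_l s_l v_(i l) e_(w l), where w l is the fresh index
   attached to l.  Hence P_i preserves
   subrepresentations and commutes with equivariant maps.  The vectors e_psi span
   a space of finite dimension, where linear forms separate and extend, and a
   linear form lambda on it yields the combination sum_psi lambda(e_psi) K_psi.
   In (2), characteristic 0 is used to recover x from its polarizations:
   substituting e_(i l) for e_(w l) and summing over i : L -> nat multiplies a basis
   tensor with n = #|L| factors other than e_0 by n!, and kills the others.

   By (2) polynomial representations embed in sums of tensor powers; (1) then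
   identifies Hom(N, K_L), and the two double duality maps are seen to be
   bijective by evaluating at generators. *)

Set Implicit Arguments.
Unset Strict Implicit.
Unset Printing Implicit Defensive.

Import GRing.Theory.
Local Open Scope ring_scope.
Local Notation FinSet := Defs.FinSet.

(** * Linear algebra for subspaces and relations given by predicates *)

Section LinearAlgebra.
Variable F : fieldType.

(** In characteristic 0 the Vandermonde matrix at the nodes 1, ..., n+1 is invertible, so the
    coefficient of X^b in a polynomial of degree at most n is a fixed combination of its values
    there. The node 0 is avoided: the maps evaluated at these nodes have to be invertible, while
    their degenerate limit is the coefficient sought. *)
Lemma coef_extraction (n b : nat) :
  (forall m, m.+1%:R != 0 :> F) -> (b <= n)%N ->
  exists c : 'I_n.+1 -> F, forall a, (a <= n)%N ->
    \sum_k c k * k.+1%:R ^+ a = (a == b)%:R.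
Proof.
move=> char0 hb; pose z : 'rV[F]_n.+1 := \row_k k.+1%:R.
have zinj (i j : 'I_n.+1) : (i < j)%N -> z 0 j - z 0 i != 0.
  move=> hij; rewrite !mxE -natrB ?ltnS 1?ltnW // subSS.
  by rewrite -(ltn_predK (m := 0) (n := j - i)) ?subn_gt0.
have Vu : Vandermonde n.+1 z \in unitmx.
  rewrite unitmxE det_Vandermonde unitfE; apply/prodf_neq0 => i _.
  by apply/prodf_neq0 => j hij; exact: zinj.
pose d : 'cV[F]_n.+1 := delta_mx (inord b) 0.
exists (fun k => (invmx (Vandermonde n.+1 z) *m d) k 0) => a ha.
have := mulKVmx Vu d => /matrixP/(_ (inord a) 0).
rewrite mxE [RHS]mxE andbT -val_eqE /= !inordK ?ltnS // => <-.
by apply: eq_bigr => k _; rewrite mulrC !mxE inordK.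
Qed.

(** Take a matrix of maximal rank among those with row space inside [P]. A vector of [P] outside its
    row space could be added as a row and would increase the rank. *)
Lemma Prop_subspace_mx (n : nat) (P : 'rV[F]_n -> Prop) :
  P 0 -> (forall a u v, P u -> P v -> P (a *: u + v)) ->
  exists M : 'M[F]_n, forall u, P u <-> (u <= M)%MS.
Proof.
move=> P0 PP.
pose Q r := `[< exists M : 'M[F]_n,
  (forall u : 'rV_n, (u <= M)%MS -> P u) /\ \rank M = r >].
have exQ : exists r, Q r.
  exists 0%N; apply/asboolP; exists 0; split; last by rewrite mxrank0.
  by move=> u; rewrite submx0 => /eqP ->.
have bQ r : Q r -> (r <= n)%N.
  by move=> /asboolP[M [_ <-]]; exact: rank_leq_row.
case: (ex_maxnP exQ bQ) => r /asboolP[M [MP rM]] rmax.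
exists M => u; split; last exact: MP.
move=> Pu; apply: contraT => uM.
suff /rmax : Q (\rank (M + u)%MS).
  rewrite -rM leqNgt -(_ : (M < M + u)%MS = (\rank M < \rank (M + u))%N).
    by rewrite /ltmx addsmxSl addsmx_sub submx_refl /= uM.
  by rewrite ltmxErank addsmxSl.
apply/asboolP; exists (M + u)%MS; split=> // v /sub_addsmxP[[a b] /= ->].
rewrite addrC [b *m u](_ : _ = b 0 0 *: u).
  by apply: PP => //; apply: MP; exact: submxMl.
apply/rowP => j; rewrite !mxE big_ord1.
by rewrite (ord1 (0 : 'I_1)) //.
Qed.

(** The columns of the cokernel matrix are linear forms whose common zeros are exactly the subspace,
    so one of them does not vanish at [x]. *)
Lemma Prop_subspace_sep (H : finType) (P : (H -> F) -> Prop) (x : H -> F) :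
  P (fun _ => 0) ->
  (forall a u v, P u -> P v -> P (fun h => a * u h + v h)) -> ~ P x ->
  exists2 c : H -> F,
    forall y, P y -> \sum_h c h * y h = 0 & \sum_h c h * x h != 0.
Proof.
move=> P0 PP Px.
pose up (u : 'rV[F]_#|H|) : H -> F := fun h => u 0 (enum_rank h).
pose dn (u : H -> F) : 'rV[F]_#|H| := \row_i u (enum_val i).
have dnK : cancel dn up by move=> u; apply/funext => h; rewrite /up mxE enum_rankK.
have [||M hM] := @Prop_subspace_mx _ (fun u => P (up u)).
- by rewrite (_ : up 0 = fun _ => 0) //; apply/funext => h; rewrite /up mxE.
- move=> a u v hu hv; rewrite (_ : up _ = fun h => a * up u h + up v h); first exact: PP.
  by apply/funext => h; rewrite /up !mxE.
have : ~~ (dn x <= M)%MS by apply/negP => /hM; rewrite dnK.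
rewrite submxE => nz.
have [j hj] : exists j, (dn x *m cokermx M) 0 j != 0.
  apply: contrapT => h; move/eqP: nz; apply; apply/matrixP => i j.
  rewrite (ord1 i) [RHS]mxE.
  by apply/eqP; apply: contraT => hh; case: h; exists j.
have E y : \sum_h cokermx M (enum_rank h) j * y h = (dn y *m cokermx M) 0 j.
  rewrite mxE (reindex (@enum_val H H)) /=; last by apply: onW_bij; exact: enum_val_bij.
  by apply: eq_bigr => i _; rewrite enum_valK mulrC [dn y _ _]mxE.
exists (fun h => cokermx M (enum_rank h) j) => [y Py|]; rewrite E //.
have : (dn y <= M)%MS by apply/hM; rewrite dnK.
by rewrite submxE => /eqP ->; rewrite mxE.
Qed.

Lemma big_option_type (R : nmodType) (H : finType) (G : option H -> R) :
  \sum_o G o = G None + \sum_h G (Some h).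
Proof.
rewrite (bigD1 None) //=; congr (_ + _).
rewrite (reindex_omap Some id) /=; last by case.
by apply: eq_bigl => h; rewrite eqxx.
Qed.

(* Separate (0, 1) from the graph of the partial linear form [Z]. *)
Lemma functional_extension (H : finType) (Z : (H -> F) -> F -> Prop) :
  Z (fun _ => 0) 0 ->
  (forall s u v a b, Z u a -> Z v b ->
     Z (fun h => s * u h + v h) (s * a + b)) ->
  (forall a, Z (fun _ => 0) a -> a = 0) ->
  exists c : H -> F, forall u a, Z u a -> a = \sum_h c h * u h.
Proof.
move=> Z0 ZP Zf.
pose P (w : option H -> F) := Z (fun h => w (Some h)) (w None).
have [//|s u v hu hv|/Zf/eqP|c hc] := @Prop_subspace_sep _ P (fun o => (o == None)%:R).
- exact: ZP.
- by rewrite oner_eq0.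
rewrite big_option_type eqxx mulr1 big1 ?addr0 => [nz|h _]; last by rewrite mulr0.
exists (fun h => - c (Some h) / c None) => u a hZ.
have := hc (fun o => if o is Some h then u h else a) hZ.
rewrite big_option_type => /eqP; rewrite addr_eq0 => /eqP e.
rewrite -[LHS](mulKf nz) e mulrN mulr_sumr -sumrN; apply: eq_bigr => h _.
by rewrite mulrA mulNr mulNr [_ / _]mulrC.
Qed.

(** Induction on [s]: a new vector is added to the family only if it is not yet a combination. The
    ambient space may be infinite-dimensional; it will be a space of morphisms. *)
Lemma independent_spanning (U : lmodType F) (s : seq U) :
  exists (r : nat) (w : 'I_r -> U),
    (forall c : 'I_r -> F, \sum_k c k *: w k = 0 -> forall k, c k = 0) /\
    (forall u, u \in s -> exists c : 'I_r -> F, u = \sum_k c k *: w k).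
Proof.
elim: s => [|u s [r [w [wi ws]]]].
  by exists 0%N, (fun _ => 0); split=> // c _ [].
have [[c hc]|nu] := pselect (exists c : 'I_r -> F, u = \sum_k c k *: w k).
  exists r, w; split=> // v; rewrite inE => /orP[/eqP ->|]; last exact: ws.
  by exists c.
pose w' (k : 'I_r.+1) := if unlift ord0 k is Some k' then w k' else u.
have w'0 : w' ord0 = u by rewrite /w' unlift_none.
have w'S k : w' (lift ord0 k) = w k by rewrite /w' liftK.
have sumE (c : 'I_r.+1 -> F) : \sum_k c k *: w' k =
    c ord0 *: u + \sum_k c (lift ord0 k) *: w k.
  by rewrite big_ord_recl w'0; congr (_ + _); apply: eq_bigr => k _; rewrite w'S.
exists r.+1, w'; split.
  move=> c; rewrite sumE => e.
  have c0 : c ord0 = 0.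
    apply: contrapT => /eqP nz; case: nu.
    exists (fun k => - (c ord0)^-1 * c (lift ord0 k)).
    rewrite -[LHS]scale1r -(mulVf nz) -scalerA.
    move/eqP: e; rewrite addr_eq0 => /eqP ->.
    by rewrite scalerN scaler_sumr -sumrN; apply: eq_bigr => k _; rewrite scalerA mulNr scaleNr.
  move: e; rewrite c0 scale0r add0r => /wi h k.
  by case: (unliftP ord0 k) => [j|] ->.
move=> v; rewrite inE => /orP[/eqP ->|/ws [c ->]].
  exists (fun k => (k == ord0)%:R); rewrite sumE eqxx scale1r big1 ?addr0 // => k _.
  by rewrite scale0r.
exists (fun k => if unlift ord0 k is Some k' then c k' else 0).
rewrite sumE unlift_none scale0r add0r; apply: eq_bigr => k _.
by rewrite liftK.
Qed.

End LinearAlgebra.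

(** * Coordinates on tensor powers *)

Section Coordinates.
Variable F : fieldType.
Local Notation V := (Cinf F).

Lemma lin0 (U W : lmodType F) (f : U -> W) : linear f -> f 0 = 0.
Proof. by move=> h; rewrite -[LHS]/(to_lin h _) linear0. Qed.
Lemma linN (U W : lmodType F) (f : U -> W) u : linear f -> f (- u) = - f u.
Proof. by move=> h; rewrite -[LHS]/(to_lin h _) linearN. Qed.
Lemma linB (U W : lmodType F) (f : U -> W) u v :
  linear f -> f (u - v) = f u - f v.
Proof. by move=> h; rewrite -[LHS]/(to_lin h _) linearB. Qed.
Lemma lin_sum (U W : lmodType F) (f : U -> W) (I : Type) (r : seq I)
    (P : pred I) (u : I -> U) :
  linear f -> f (\sum_(i <- r | P i) u i) = \sum_(i <- r | P i) f (u i).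
Proof. by move=> h; rewrite -[LHS]/(to_lin h _) linear_sum. Qed.
Lemma linear_sum_pw (U W : lmodType F) (I : Type) (r : seq I) (P : pred I)
    (c : I -> F) (f : I -> U -> W) :
  (forall i, linear (f i)) -> linear (fun u => \sum_(i <- r | P i) c i *: f i u).
Proof.
move=> h a u v; rewrite scaler_sumr -big_split /=; apply: eq_bigr => i _.
by rewrite h scalerDr !scalerA mulrC.
Qed.

Lemma Cinf_coord_lin i : linear (fun v : V => v i : F^o).
Proof. by move=> a u v; rewrite c_PE. Qed.
Lemma Cinf_scaleE a (u : V) i : (a *: u) i = a * u i.
Proof. exact: (lin_Z _ _ (Cinf_coord_lin i)). Qed.
Lemma Cinf_sumE (I : Type) (r : seq I) (P : pred I) (u : I -> V) i :
  (\sum_(k <- r | P k) u k) i = \sum_(k <- r | P k) u k i.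
Proof. exact: (lin_sum _ _ _ (Cinf_coord_lin i)). Qed.
Lemma Cinf_0E i : (0 : V) i = 0.
Proof. exact: (lin0 (Cinf_coord_lin i)). Qed.
Lemma Cinf_oppE (u : V) i : (- u) i = - u i.
Proof. exact: (linN u (Cinf_coord_lin i)). Qed.

Lemma ebas_fin n : exists d, forall i, (d <= i)%N -> ((i == n)%:R : F) = 0.
Proof. by exists n.+1 => i; case: eqP => // ->; rewrite ltnn. Qed.
Definition ebas n : V := MkCinf (ebas_fin n).
Lemma ebasE n i : ebas n i = (i == n)%:R. Proof. by []. Qed.

Definition supp_lt d (v : V) := forall i, (d <= i)%N -> v i = 0.

Lemma trlE d (v : V) i : trl d v i = if (i < d)%N then v i else 0.
Proof. by []. Qed.
Lemma trl_ebas d (v : V) : trl d v = \sum_(k < d) v k *: ebas k.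
Proof.
apply: Cinf_ext => i; rewrite Cinf_sumE; rewrite trlE; case: ltnP => hi.
  rewrite (bigD1 (Ordinal hi)) // Cinf_scaleE ebasE eqxx mulr1 big1 => [|k hk].
    by rewrite /= addr0.
  rewrite Cinf_scaleE ebasE; case: eqP => e; rewrite ?mulr0 //.
  by case/eqP: hk; apply: val_inj; rewrite /= e.
rewrite big1 // => k _; rewrite Cinf_scaleE ebasE; case: eqP => e; rewrite ?mulr0 //.
by move: (ltn_ord k); rewrite -e ltnNge hi.
Qed.
Lemma trl_lin d : linear (@trl F d).
Proof.
move=> a u v; apply: Cinf_ext => i; rewrite c_PE !trlE; case: ifP => _.
  by rewrite c_PE.
by rewrite mulr0 addr0.
Qed.
Lemma trl_supp d (v : V) : supp_lt d (trl d v).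
Proof. by move=> i /=; rewrite leqNgt => /negbTE ->. Qed.
Lemma supp_trl d (v : V) : supp_lt d v -> trl d v = v.
Proof. by move=> h; apply: Cinf_ext => i /=; case: ltnP => // /h. Qed.
Lemma supp_le d d' (v : V) : (d <= d')%N -> supp_lt d v -> supp_lt d' v.
Proof. by move=> hd h i hi; apply: h; exact: leq_trans hi. Qed.
Lemma tform_trl d (v : V) : (0 < d)%N -> tform (trl d v) = tform v.
Proof. by rewrite /tform /= => ->. Qed.

Section Kmap.
Variable I : finType.
Implicit Types (A B : V -> V).

Lemma multilinear_precomp A (Al : linear A) (W : lmodType F)
    (phi : (I -> V) -> W) : multilinear phi ->
  multilinear (fun x => phi (fun i => A (x i))).
Proof.
move=> hp x i; have e v :
    (fun j => A (upd x i v j)) = upd (fun j => A (x j)) i (A v).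
  by apply/funext => j; rewrite /upd; case: eqP.
by move=> a u v /=; rewrite !e Al hp.
Qed.
(** The tensor power of an arbitrary linear endomorphism; [kg] is the case of group elements, and
    the degenerate limits of those need this generality. *)
Definition kmap A (Al : linear A) : kpow F I -> kpow F I :=
  Defs.lift (multilinear_precomp Al (@mpure_lin F I)).
Lemma kmap_lin A (Al : linear A) : linear (kmap Al). Proof. exact: linearP. Qed.
Lemma kmapE A (Al : linear A) x : kmap Al (mpure x) = mpure (fun i => A (x i)).
Proof. exact: lift_gen. Qed.

(** Multilinear expansion, one position at a time: the induction runs over the list of positions
    already expanded. *)
Lemma mpure_sum (J : finType) (j0 : J) (W : lmodType F) (phi : (I -> V) -> W)
    (y : I -> J -> V) : multilinear phi ->
  phi (fun i => \sum_j y i j) = \sum_(f : {ffun I -> J}) phi (fun i => y i (f i)).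
Proof.
move=> hp.
(* The choice functions are pinned to the default [j0] off [s], so that each choice on [s] is
   counted once. *)
pose S (s : seq I) (f : {ffun I -> J}) := [forall i, (i \notin s) ==> (f i == j0)].
have main (s : seq I) : uniq s -> forall z : I -> V,
    phi (fun i => if i \in s then \sum_j y i j else z i) =
    \sum_(f | S s f) phi (fun i => if i \in s then y i (f i) else z i).
  elim: s => [_ z|i0 s IH /andP[i0s us] z].
    rewrite (big_pred1 [ffun=> j0]) // => f /=.
    apply/forallP/eqP => [h|-> i]; last by rewrite ffunE eqxx implybT.
    by apply/ffunP => i; have /eqP := h i; rewrite ffunE => ->.
  pose X i := if i \in s then \sum_j y i j else z i.
  have -> : (fun i => if i \in i0 :: s then \sum_j y i j else z i) =
      upd X i0 (\sum_j y i0 j).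
    by apply/funext => i; rewrite /upd /X inE; case: eqP => [->|].
  rewrite (lin_sum _ _ _ (hp X i0)) (partition_big (fun f : {ffun I -> J} => f i0) predT) //=.
  apply: eq_bigr => j _.
  have -> : upd X i0 (y i0 j) =
      (fun i => if i \in s then \sum_j y i j else upd z i0 (y i0 j) i).
    by apply/funext => i; rewrite /upd /X; case: eqP => [->|//]; rewrite (negbTE i0s).
  rewrite (IH us) [RHS](reindex_onto
     (fun f : {ffun I -> J} => [ffun i => if i == i0 then j else f i])
     (fun f : {ffun I -> J} => [ffun i => if i == i0 then j0 else f i])) /=; last first.
    move=> f /andP[_ /eqP <-]; apply/ffunP => i; rewrite !ffunE.
    by case: eqP => // ->.
  apply: eq_big => [f|f hf].
    apply/forallP/andP => [h|[/andP[/forallP h _] /eqP e] i].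
      split; first (apply/andP; split).
      - apply/forallP => i; apply/implyP; rewrite inE negb_or => /andP[n1 n2].
        by rewrite ffunE (negbTE n1); exact: (implyP (h i) n2).
      - by rewrite ffunE eqxx.
      - apply/eqP/ffunP => i; rewrite !ffunE; case: eqP => // ->.
        by have /eqP := implyP (h i0) i0s.
    apply/implyP => ni; have [->|n0] := eqVneq i i0.
      by rewrite -e ffunE eqxx.
    have := h i; rewrite inE negb_or n0 ni /= ffunE (negbTE n0).
    by [].
  congr phi; apply/funext => i; rewrite /upd inE ffunE.
  by case: eqP => [->|//]; rewrite (negbTE i0s).
have := main (enum I) (enum_uniq I) (fun _ => 0).
rewrite (_ : (fun i => _) = fun i => \sum_j y i j); last first.
  by apply/funext => i; rewrite mem_enum.
move=> ->; apply: eq_big => [f|f _].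
  by apply/forallP => i; rewrite mem_enum.
by congr phi; apply/funext => i; rewrite mem_enum.
Qed.

Lemma mpure_scale (c : I -> F) (x : I -> V) :
  mpure (fun i => c i *: x i) = (\prod_i c i) *: mpure x.
Proof.
have main (s : seq I) : uniq s ->
    mpure (fun i => if i \in s then c i *: x i else x i) =
    (\prod_(i <- s) c i) *: mpure x.
  elim: s => [_|i0 s IH /andP[i0s us]]; first by rewrite big_nil scale1r.
  have e (a : F) : (fun i => if i \in s then c i *: x i else if i == i0 then a *: x i else x i) =
      upd (fun i => if i \in s then c i *: x i else x i) i0 (a *: x i0).
    apply/funext => i; rewrite /upd; case: eqP => [->|_]; last by [].
    by rewrite (negbTE i0s).
  rewrite big_cons -scalerA -(IH us).
  have := e 1; rewrite scale1r => e1.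
  transitivity (mpure (upd (fun i => if i \in s then c i *: x i else x i) i0 (c i0 *: x i0))).
    rewrite -e; congr mpure; apply/funext => i; rewrite inE.
    by case: eqP => [->|_] /=; [rewrite (negbTE i0s)|].
  rewrite (lin_Z _ _ (@mpure_lin F I _ i0)); congr (_ *: mpure _).
  apply/funext => i; rewrite /upd; case: eqP => [->|//]; by rewrite (negbTE i0s).
rewrite -[RHS](_ : (\prod_(i <- enum I) c i) *: mpure x = _); last by rewrite big_enum.
rewrite -(main _ (enum_uniq I)); congr mpure; apply/funext => i; by rewrite mem_enum.
Qed.

Lemma kform_adm (g : I -> V -> F^o) : (forall i, linear (g i)) ->
  @multilinear F I F^o (fun x => \prod_i g i (x i)).
Proof.
move=> gl x i a u v /=.
rewrite !(bigD1 i (P := predT)) //= /upd eqxx gl.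
set p := \prod_(j | _) _; set p' := \prod_(j | _) _; set p'' := \prod_(j | _) _.
have -> : p = p'' by apply: eq_bigr => j /negbTE ->.
have -> : p' = p'' by apply: eq_bigr => j /negbTE ->.
by rewrite mulrDl -!mulrA.
Qed.
Definition kform (g : I -> V -> F^o) (gl : forall i, linear (g i)) :
  kpow F I -> F^o := Defs.lift (kform_adm gl).
Lemma kform_lin g gl : linear (@kform g gl). Proof. exact: linearP. Qed.
Lemma kformE g gl x : @kform g gl (mpure x) = \prod_i g i (x i).
Proof. exact: lift_gen. Qed.

Definition kcoord (k : I -> nat) : kpow F I -> F^o :=
  kform (fun i => Cinf_coord_lin (k i)).
Lemma kcoord_lin k : linear (kcoord k). Proof. exact: kform_lin. Qed.
Lemma kcoordE k x : kcoord k (mpure x) = \prod_i x i (k i).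
Proof. exact: kformE. Qed.

Definition kbas (k : I -> nat) : kpow F I := mpure (fun i => ebas (k i)).

(** After truncation every tensor is a finite combination of basis tensors. The bound is [d.+1] so
    that the index type is inhabited, as the default value in [mpure_sum] requires. *)
Lemma kmap_trlE d u : kmap (@trl_lin d.+1) u =
  \sum_(f : {ffun I -> 'I_d.+1}) kcoord (fun i => f i) u *: kbas (fun i => f i).
Proof.
move: u; apply: kpow_ext => [||x].
- exact: kmap_lin.
- move=> a u v; rewrite scaler_sumr -big_split /=; apply: eq_bigr => f _.
  by rewrite kcoord_lin scalerDl scalerA.
rewrite kmapE (_ : (fun i => _) = fun i => \sum_(k < d.+1) x i k *: ebas k).
  rewrite (mpure_sum ord0 _ (@mpure_lin F I)); apply: eq_bigr => f _.
  by rewrite mpure_scale kcoordE.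
by apply/funext => i; rewrite trl_ebas.
Qed.

Lemma kpow_pure_sum (u : kpow F I) : exists r (c : 'I_r -> F) (x : 'I_r -> I -> V),
  u = \sum_k c k *: mpure (x k).
Proof.
have := univ_sum u; set s := repr u => e.
exists (size s), (fun k => (tnth (in_tuple s) k).1), (fun k => (tnth (in_tuple s) k).2).
by rewrite {1}e (big_tnth _ _ s).
Qed.

Lemma kpow_supp (u : kpow F I) : exists d0, forall d, (d0 <= d)%N ->
  kmap (@trl_lin d) u = u.
Proof.
have [r [c [x ->]]] := kpow_pure_sum u.
have /choice[b hb] (p : 'I_r * I) : exists d, supp_lt d (x p.1 p.2).
  exact: cc_fin.
exists (\max_p b p) => d hd; rewrite (lin_sum _ _ _ (kmap_lin _)).
apply: eq_bigr => k _; rewrite (lin_Z _ _ (kmap_lin _)) kmapE; congr (_ *: mpure _).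
apply/funext => i; apply: supp_trl; apply: supp_le (hb (k, i)).
by apply: leq_trans hd; apply: leq_bigmax.
Qed.

(** Both tensors are fixed by a large enough truncation, and truncated tensors are written out in
    coordinates by [kmap_trlE]. *)
Lemma kcoord_inj (u v : kpow F I) : (forall k, kcoord k u = kcoord k v) -> u = v.
Proof.
move=> h; have [d1 h1] := kpow_supp u; have [d2 h2] := kpow_supp v.
rewrite -(h1 (maxn d1 d2).+1) ?leqW ?leq_maxl //.
rewrite -(h2 (maxn d1 d2).+1) ?leqW ?leq_maxr //.
by rewrite !kmap_trlE; apply: eq_bigr => f _; rewrite h.
Qed.

End Kmap.
End Coordinates.

(** * Affine endomorphisms in the group algebra *)

Section GroupAlgebra.
Variables (F : fieldType) (G : groupType).
Implicit Types (T : seq (F * G)) (N : rep F G).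

(** An element of the group algebra is given by an unreduced list of coefficients and group
    elements; it acts on all representations, compatibly with equivariant maps ([gact_hom]). *)
Definition gact N T (x : N) : N := \sum_(a <- T) a.1 *: rho N a.2 x.
Definition gmul T T' : seq (F * G) :=
  [seq (a.1 * b.1, (a.2 * b.2)%g) | a <- T, b <- T'].
Definition gscale (c : F) T : seq (F * G) := [seq (c * a.1, a.2) | a <- T].

Lemma gact_lin N T : linear (@gact N T).
Proof. by apply: linear_sum_pw => a; exact: rho_lin. Qed.
Lemma gact_mul N T T' (x : N) : gact (gmul T T') x = gact T (gact T' x).
Proof.
rewrite /gact /gmul big_allpairs_dep /=; apply: eq_bigr => a _.
rewrite (lin_sum _ _ _ (@rho_lin _ _ N a.2)) scaler_sumr; apply: eq_bigr => b _.
by rewrite (lin_Z _ _ (@rho_lin _ _ N a.2)) rhoM scalerA.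
Qed.
Lemma gact_scale N c T (x : N) : gact (gscale c T) x = c *: gact T x.
Proof.
rewrite /gact big_map scaler_sumr; apply: eq_bigr => a _.
by rewrite scalerA.
Qed.
Lemma gact_flatten N (TT : seq (seq (F * G))) (x : N) :
  gact (flatten TT) x = \sum_(T <- TT) gact T x.
Proof. by rewrite /gact big_flatten. Qed.
Lemma gact1 N g (x : N) : gact [:: (1, g)] x = rho N g x.
Proof. by rewrite /gact big_seq1 scale1r. Qed.
Lemma gact_hom N N' (f : rephom N N') T (x : N) : f (gact T x) = gact T (f x).
Proof.
rewrite /gact linear_sum; apply: eq_bigr => a _.
by rewrite linearZ /= rh_eq.
Qed.
Lemma gact_stable N (X : N -> Prop) T (x : N) : X 0 ->
  (forall a u v, X u -> X v -> X (a *: u + v)) ->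
  (forall g u, X u -> X (rho N g u)) -> X x -> X (gact T x).
Proof.
move=> X0 XP Xg Xx; rewrite /gact; elim: T => [|a T IH]; first by rewrite big_nil.
by rewrite big_cons; apply: XP => //; exact: Xg.
Qed.
End GroupAlgebra.

Section AffineMonoid.
Variable F : fieldType.
Hypothesis char0 : forall m, m.+1%:R != 0 :> F.
Local Notation V := (Cinf F).

Section Kill.
Variables (C : pred nat) (D : nat).
Hypotheses (C0 : ~~ C 0%N) (CD : forall k, C k -> (k < D)%N).

Lemma cscal_fin (r : F) (v : V) : exists d, forall i, (d <= i)%N ->
  (if C i then r else 1) * v i = 0.
Proof. by have [d h] := cc_fin v; exists d => i /h ->; rewrite mulr0. Qed.
Definition cscal r v : V := MkCinf (cscal_fin r v).
Lemma cscalE r v i : cscal r v i = (if C i then r else 1) * v i.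
Proof. by []. Qed.
Lemma cscal_lin r : linear (cscal r).
Proof.
move=> a u v; apply: Cinf_ext => i; rewrite c_PE !cscalE c_PE mulrDr.
by rewrite mulrCA.
Qed.
Lemma cscalK r s : r * s = 1 -> cancel (cscal s) (cscal r).
Proof.
move=> e v; apply: Cinf_ext => i; rewrite !cscalE mulrA.
by case: ifP; rewrite ?e ?mul1r.
Qed.
Lemma cscal_block r : gl_block D (cscal r).
Proof.
split=> v hv; first by move=> i hi; rewrite cscalE hv // mulr0.
apply: Cinf_ext => i; rewrite cscalE; case: ifP => h; last by rewrite mul1r.
by rewrite hv ?mulr0 // CD.
Qed.
Lemma cscal_t r v : tform (cscal r v) = tform v.
Proof. by rewrite /tform cscalE (negbTE C0) mul1r. Qed.
Definition cscal_ga r (r0 : r != 0) : GAinf F :=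
  @MkGA F (@MkGL F (cscal r) (cscal r^-1) (cscal_lin r)
    (cscalK (mulVf r0)) (cscalK (mulfV r0))
    (ex_intro _ D (conj (cscal_block r) (cscal_block r^-1)))) (cscal_t r).

(** The tensor power of [cscal r] on #|I| <= n factors is a polynomial in r of degree at most n,
    whose constant term is the value at the non-invertible point r = 0. Coefficient extraction
    writes it through r = 1, ..., n+1, where [cscal r] lies in the group. *)
Lemma kill_approx n : exists T : seq (F * GAinf F), forall I : finType,
  (#|I| <= n)%N -> forall x : I -> V,
  gact (N := krep F I) T (mpure x) = mpure (fun i => cscal 0 (x i)).
Proof.
have [c hc] := @coef_extraction F n 0 char0 (leq0n n).
exists [seq (c k, cscal_ga (char0 k)) | k <- enum 'I_n.+1] => I hI x.
rewrite /gact big_map big_enum /=.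
(* The subset [f] marks the positions where the part of x_i with coordinates in [C] is chosen; that
   term carries r^(m f), so only the empty subset has exponent 0. *)
pose m (f : {ffun I -> bool}) := #|[pred i | f i]|.
pose y i (b : bool) : V := if b then x i - cscal 0 (x i) else cscal 0 (x i).
have e r : mpure (fun i => cscal r (x i)) =
    \sum_(f : {ffun I -> bool}) r ^+ m f *: mpure (fun i => y i (f i)).
  pose yr i (b : bool) : V := (if b then r else 1) *: y i b.
  transitivity (mpure (fun i => \sum_b yr i b)).
    congr mpure; apply/funext => i; apply: Cinf_ext => k.
    rewrite (big_bool _ (yr i)) c_addE !Cinf_scaleE c_addE Cinf_oppE !cscalE.
    by case: (C k); rewrite ?mul0r ?mul1r ?subr0 ?subrr ?mulr0 ?addr0 ?add0r.
  rewrite (mpure_sum false yr (@mpure_lin F I)); apply: eq_bigr => f _.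
  by rewrite mpure_scale -big_mkcond /= prodr_const.
transitivity (\sum_(k < n.+1) c k *:
    \sum_(f : {ffun I -> bool}) k.+1%:R ^+ m f *: mpure (fun i => y i (f i))).
  by apply: eq_bigr => k _; rewrite kgE -e.
transitivity (\sum_(f : {ffun I -> bool}) (m f == 0%N)%:R *: mpure (fun i => y i (f i))).
  under eq_bigr => k _ do rewrite scaler_sumr.
  rewrite exchange_big /=; apply: eq_bigr => f _.
  under eq_bigr => k _ do rewrite scalerA.
  rewrite -scaler_suml hc //; exact: leq_trans (max_card _) hI.
rewrite (bigD1 [ffun => false]) //= big1 ?addr0 => [|f].
  rewrite (eqP (_ : m _ == 0%N)) ?scale1r; last first.
    by apply/eqP/eq_card0 => i; rewrite inE /= ffunE.
  by congr mpure; apply/funext => i; rewrite ffunE.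
move=> nf; case: eqP => [/card0_eq h|_]; last by rewrite scale0r.
case/eqP: nf; apply/ffunP => i; rewrite ffunE.
exact: (h i).
Qed.
End Kill.

Section Unipotent.
Variables (N : V -> V) (D : nat).
Hypotheses (Nl : linear N) (NN : forall v, N (N v) = 0)
  (Nt : forall v, tform (N v) = 0) (N1 : forall v, supp_lt D (N v))
  (N2 : forall v : V, (forall i, (i < D)%N -> v i = 0) -> N v = 0).
Definition unip (s : F) (v : V) := v + s *: N v.
Lemma unip_lin s : linear (unip s).
Proof.
move=> a u v; rewrite /unip Nl scalerDr !scalerDr !scalerA [s * a]mulrC.
by rewrite addrACA.
Qed.
Lemma unipK s s' : s + s' = 0 -> cancel (unip s) (unip s').
Proof.
move=> e v; rewrite /unip addrC [N _](_ : _ = N v); last first.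
  by rewrite -{1}(scale1r v) Nl scale1r (lin_Z _ _ Nl) NN scaler0 addr0.
by rewrite addrCA -scalerDl [s' + s]addrC e scale0r addr0.
Qed.
Lemma unip_block s : gl_block D (unip s).
Proof.
split=> v hv.
  by move=> i hi; rewrite c_addE Cinf_scaleE hv // N1 // mulr0 addr0.
by rewrite /unip N2 // scaler0 addr0.
Qed.
Lemma unip_t s v : tform (unip s v) = tform v.
Proof.
by rewrite /tform c_addE Cinf_scaleE -[N v 0%N]/(tform (N v)) Nt mulr0 addr0.
Qed.
(** As [N] squares to zero, 1 - N inverts 1 + N; [D] bounds the coordinates that [N] reads and
    writes. *)
Definition unip_ga : GAinf F :=
  @MkGA F (@MkGL F (unip 1) (unip (-1)) (unip_lin 1)
    (unipK (subrr 1)) (unipK (addNr 1))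
    (ex_intro _ D (conj (unip_block 1) (unip_block (-1))))) (unip_t 1).
Lemma unip_gaE v : unip_ga v = v + N v.
Proof. by rewrite /= /unip scale1r. Qed.
End Unipotent.

Section Shift.
Variable D : nat.
Lemma shiftup_fin (v : V) : exists d, forall i, (d <= i)%N ->
  (if (i < D)%N then 0 else trl D v (i - D)%N) = 0.
Proof.
exists (D + D)%N => i hi; case: ifP => // _; apply: trl_supp.
by rewrite leq_subRL // (leq_trans _ hi) // leq_addr.
Qed.
Definition shiftup v : V := MkCinf (shiftup_fin v).
Lemma shiftupE v i : shiftup v i = if (i < D)%N then 0 else trl D v (i - D)%N.
Proof. by []. Qed.
Lemma shiftup_lin : linear shiftup.
Proof.
move=> a u v; apply: Cinf_ext => i; rewrite c_PE !shiftupE trl_lin.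
by case: ifP => _; rewrite ?c_PE // mulr0 addr0.
Qed.
Lemma shiftdn_fin (v : V) : exists d, forall i, (d <= i)%N ->
  (if (0 < i < D)%N then v (i + D)%N else 0) = 0.
Proof.
by exists D => i hi; rewrite [(i < D)%N]ltnNge hi andbF.
Qed.
(** Coordinate 0 is not filled, so that t vanishes on the image and [unip_ga] applies. *)
Definition shiftdn v : V := MkCinf (shiftdn_fin v).
Lemma shiftdnE v i : shiftdn v i = if (0 < i < D)%N then v (i + D)%N else 0.
Proof. by []. Qed.
Lemma shiftdn_lin : linear shiftdn.
Proof.
move=> a u v; apply: Cinf_ext => i; rewrite c_PE !shiftdnE.
by case: ifP => _; rewrite ?c_PE // mulr0 addr0.
Qed.
End Shift.

(* On C^d, [A] is the composite of: adding a copy of its linear part in the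
   coordinates >= D, killing the coordinates 0 < k < D, moving the copy back,
   and killing the coordinates >= D. *)
Lemma affine_approx (A : V -> V) (n d : nat) : linear A ->
  (forall v, tform (A v) = tform v) ->
  exists T : seq (F * GAinf F), forall I : finType, (#|I| <= n)%N ->
    forall x : I -> V, (forall i, supp_lt d (x i)) ->
    gact (N := krep F I) T (mpure x) = mpure (fun i => A (x i)).
Proof.
move=> Al At.
(* One bound for d and for the supports of the A e_k with k < d, positive so that e_0 lies in
   C^D. *)
have [D [D0 dD hD]] : exists D, [/\ (0 < D)%N, (d <= D)%N &
    forall v, supp_lt d v -> supp_lt D (A v)].
  have /choice[b hb] (k : 'I_d) : exists e, supp_lt e (A (ebas F k)).
    exact: cc_fin.
  exists (maxn d.+1 (\max_k b k)); split=> [||v hv i].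
  - by rewrite leq_max.
  - by rewrite leq_max leqW.
  rewrite geq_max => /andP[_ hi].
  rewrite -(supp_trl hv) trl_ebas (lin_sum _ _ _ Al) Cinf_sumE big1 // => k _.
  rewrite (lin_Z _ _ Al) Cinf_scaleE hb ?mulr0 //.
  by apply: leq_trans hi; apply: leq_bigmax.
pose e0 := ebas F 0.
(* On C^d this is the linear part of the affine map, A v = t(v) e_0 + a v, and a v has coordinate 0
   equal to 0 because A preserves t. Truncating the argument makes [a] vanish on the coordinates >=
   D, whence [M1M1]. *)
pose a v := A (trl d v) - tform v *: e0.
have al : linear a.
  move=> s u v; rewrite /a trl_lin Al tform_lin scalerDl scalerBr scalerA.
  by rewrite addrACA opprD.
have adE v : supp_lt d v -> A v = tform v *: e0 + a v.
  by move=> h; rewrite /a (supp_trl h) addrC subrK.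
have aD v : supp_lt D (a v).
  move=> i hi; rewrite c_addE Cinf_oppE Cinf_scaleE hD //; last exact: trl_supp.
  by rewrite ebasE gtn_eqF ?mulr0 ?subr0 // (leq_trans D0).
have a0 v : supp_lt d v -> a v 0%N = 0.
  move=> h; rewrite c_addE Cinf_oppE Cinf_scaleE ebasE eqxx mulr1 (supp_trl h).
  by rewrite -[A v 0%N]/(tform (A v)) At subrr.
pose M1 v := shiftup D (a v).
pose C1 k := (0 < k < D)%N.
pose C2 k := (D <= k < D + D)%N.
have M1s v i : (i < D)%N -> M1 v i = 0 by rewrite shiftupE => ->.
have M1l : linear M1 by exact: lin_comp (shiftup_lin D) al.
have z0 (v : V) : (forall i, (i < D)%N -> v i = 0) -> a v = 0.
  move=> h; rewrite /a (_ : trl d v = 0); last first.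
    apply: Cinf_ext => i; rewrite Cinf_0E trlE; case: ltnP => // hi.
    by rewrite h // (leq_trans hi).
  by rewrite (lin0 Al) /tform h // scale0r subr0.
have M1M1 v : M1 (M1 v) = 0.
  by rewrite {1}/M1 z0 ?(lin0 (shiftup_lin D)) // => i /M1s.
have M1t v : tform (M1 v) = 0 by exact: M1s.
have M1d v : supp_lt (D + D) (M1 v).
  move=> i hi; rewrite shiftupE; case: ifP => // _; apply: trl_supp.
  by rewrite leq_subRL // (leq_trans _ hi) // leq_addr.
have M12 (v : V) : (forall i, (i < D + D)%N -> v i = 0) -> M1 v = 0.
  move=> h; rewrite /M1 z0 ?(lin0 (shiftup_lin D)) // => i hi.
  by rewrite h // (leq_trans hi) // leq_addr.
have M2M2 (v : V) : shiftdn D (shiftdn D v) = 0.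
  apply: Cinf_ext => i; rewrite !shiftdnE Cinf_0E; case: ifP => // /andP[i0 iD].
  by rewrite [(i + D < D)%N]ltnNge leq_addl /= andbF.
have M2t (v : V) : tform (shiftdn D v) = 0 by [].
have M2d (v : V) : supp_lt (D + D) (shiftdn D v).
  move=> i hi; rewrite shiftdnE [(i < D)%N]ltnNge.
  by rewrite (leq_trans (leq_addr D D) hi) /= andbF.
have M22 (v : V) : (forall i, (i < D + D)%N -> v i = 0) -> shiftdn D v = 0.
  move=> h; apply: Cinf_ext => i; rewrite shiftdnE Cinf_0E; case: ifP => // /andP[_ hi].
  by rewrite h // ltn_add2r.
have [T1 hT1] := @kill_approx C1 D isT (fun k h => proj2 (andP h)) n.
have C20 : ~~ C2 0%N by rewrite /C2 leqNgt D0.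
have [T2 hT2] := @kill_approx C2 (D + D) C20 (fun k h => proj2 (andP h)) n.
pose g1 := unip_ga M1l M1M1 M1t M1d M12.
pose g2 := unip_ga (shiftdn_lin D) M2M2 M2t M2d M22.
exists (gmul T2 (gmul [:: (1, g2)] (gmul T1 [:: (1, g1)]))) => I hI x hx.
rewrite !gact_mul !gact1 [rho _ g1 _]kgE hT1 // [rho _ g2 _]kgE hT2 //.
congr mpure; apply/funext => i; rewrite !unip_gaE (adE _ (hx i)).
move: (x i) (hx i) => v hv {i}.
move: (M1 v) (M1s v) (M1d v) (shiftupE D (a v) : forall i, M1 v i = _) => w w1 w2.
move: (a v) (a0 v hv) (aD v) => u u0 uD wE; apply: Cinf_ext => i.
rewrite cscalE c_addE shiftdnE !cscalE !c_addE Cinf_scaleE ebasE /C1 /C2.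
have [->|i0] /= := posnP i.
  by rewrite leqNgt D0 /= !mul1r !addr0 u0 // mulr1 addr0 w1 // addr0.
rewrite mulr0 add0r; case: (ltnP i D) => iD /=.
  rewrite mul0r add0r !mul1r addn_gt0 i0 /=.
  rewrite [(i + D < D)%N]ltnNge leq_addl /= mul1r.
  rewrite hv ?add0r; last by rewrite (leq_trans dD) // leq_addl.
  by rewrite wE ltnNge leq_addl /= addnK iD.
rewrite uD // addr0; case: ltnP => hi; first by rewrite mul0r.
by rewrite !mul1r hv ?w2 ?addr0 // (leq_trans dD).
Qed.

End AffineMonoid.

(** * Polarization *)

Section Injections.
Variables I L : FinSet.

(** The morphisms I -> L of the downwards subset category, seen through their inverse injections: in
    this form they are a finite type over which sums can range. *)
Definition dsinj : Type := {p : {ffun L -> I} | injectiveb p}.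
HB.instance Definition _ := Finite.on dsinj.
Definition mk_dsinj (f : {ffun L -> I}) (h : injectiveb f) : dsinj := exist _ f h.

Lemma dsinj_inj (p : dsinj) : injective (val p).
Proof. exact/injectiveP/(valP p). Qed.
Definition inj_pm (p : dsinj) (q : I) : option L := [pick l | val p l == q].
Lemma inj_pmP (p : dsinj) q l : inj_pm p q = Some l <-> val p l = q.
Proof.
rewrite /inj_pm; case: pickP => [l' /eqP e|h]; split.
- by case=> <-.
- by move=> e'; congr Some; apply: (dsinj_inj (p := p)); rewrite e e'.
- by [].
- by move=> e; have := h l; rewrite e eqxx.
Qed.
Lemma inj_pmK (p : dsinj) l : inj_pm p (val p l) = Some l.
Proof. exact/inj_pmP. Qed.
Lemma inj_pm_none (p : dsinj) q : inj_pm p q = None <-> q \notin val p @: [set: L].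
Proof.
split=> [h|h].
  by apply/imsetP => -[l _ e]; rewrite e inj_pmK in h.
case e: (inj_pm p q) => [l|//]; move/inj_pmP: e => e.
by move: h; rewrite -e imset_f ?inE.
Qed.
Lemma inj_pm_inj (p : dsinj) x y z : inj_pm p x = Some z -> inj_pm p y = Some z -> x = y.
Proof. by move=> /inj_pmP <- /inj_pmP <-. Qed.
Lemma inj_pm_surj (p : dsinj) z : exists x, inj_pm p x = Some z.
Proof. by exists (val p z); exact: inj_pmK. Qed.
Definition ds_of_inj (p : dsinj) : dsmor I L :=
  ds_of_pm (@inj_pm_inj p) (@inj_pm_surj p).
Lemma ds_of_injE p q : ds_pm (ds_of_inj p) q = inj_pm p q.
Proof. exact: ds_of_pmE. Qed.
Lemma ds_of_inj_finv p l : val (ds_finv (ds_of_inj p) l) = val p l.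
Proof. by apply: ds_finv_pm; rewrite ds_of_injE inj_pmK. Qed.
Lemma ds_of_inj_U p q : (q \in ds_U (ds_of_inj p)) = (q \notin val p @: [set: L]).
Proof.
rewrite ds_UE ds_of_injE; apply/idP/idP => [|/inj_pm_none -> //].
by case e: (inj_pm p q) => // _; apply/inj_pm_none.
Qed.
Lemma ds_of_inj_surj (d : dsmor I L) : exists p, d = ds_of_inj p.
Proof.
have h : injectiveb [ffun l => val (ds_finv d l)].
  apply/injectiveP => l l'; rewrite !ffunE => /val_inj.
  by move/(can_inj (ds_finvVK d)).
exists (mk_dsinj h); apply: ds_ext => q; rewrite ds_of_injE.
case e: (inj_pm _ q) => [l|].
  by move/inj_pmP: e; rewrite /= ffunE => <-; rewrite ds_pm_finv.
case e': (ds_pm d q) => [l|//]; move/inj_pm_none/imsetP: e => [].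
by exists l; rewrite // ffunE (ds_finv_pm e').
Qed.

Lemma prod_over_inj (R : comNzRingType) (p : dsinj) (G : I -> R) :
  \prod_q G q = (\prod_(q | q \notin val p @: [set: L]) G q) * \prod_l G (val p l).
Proof.
rewrite (bigID (mem (val p @: [set: L]))) /= mulrC; congr (_ * _).
rewrite big_imset /=; last by move=> l l' _ _; apply: dsinj_inj.
by apply: eq_bigl => l; rewrite inE.
Qed.

Section KactInj.
Variable F : fieldType.
Lemma kact_inj (p : dsinj) (x : I -> Cinf F) : kact (ds_of_inj p) (mpure x) =
  (\prod_(q | q \notin val p @: [set: L]) tform (x q)) *: mpure (fun l => x (val p l)).
Proof.
rewrite kactE /kphi; congr (_ *: mpure _).
  by apply: eq_bigl => q; rewrite ds_of_inj_U.
by apply/funext => l; rewrite ds_of_inj_finv.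
Qed.
Lemma kcoord_kact_inj (p : dsinj) (x : I -> Cinf F) (i : L -> nat) :
  kcoord i (kact (ds_of_inj p) (mpure x)) =
  (\prod_(q | q \notin val p @: [set: L]) tform (x q)) *
  \prod_l x (val p l) (i l).
Proof. by rewrite kact_inj (lin_Z _ _ (kcoord_lin i)) kcoordE. Qed.

(** The tensor e_psi for psi = [p], with [w] the choice of fresh indices; [polarize w i] below is
    the operator P_i. *)
Definition kstd (w : L -> nat) (p : dsinj) : kpow F I :=
  kbas F (fun q => if inj_pm p q is Some l then w l else 0%N).

Definition polarize (w i : L -> nat) (u : kpow F I) : kpow F I :=
  \sum_p kcoord i (kact (ds_of_inj p) u) *: kstd w p.
Lemma polarize_lin w i : linear (polarize w i).
Proof.
move=> a u v; rewrite /polarize scaler_sumr -big_split /=; apply: eq_bigr => p _.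
by rewrite kact_lin kcoord_lin scalerDl scalerA.
Qed.
End KactInj.
End Injections.

Section Polarize.
Variable F : fieldType.
Hypothesis char0 : forall m, m.+1%:R != 0 :> F.
Local Notation V := (Cinf F).

Lemma kpow_ext_supp (I : finType) d (W : lmodType F) (f g : kpow F I -> W) :
  linear f -> linear g ->
  (forall x : I -> V, (forall i, supp_lt d (x i)) -> f (mpure x) = g (mpure x)) ->
  forall u, kmap (@trl_lin F d) u = u -> f u = g u.
Proof.
move=> fl gl h u <-; move: u; apply: kpow_ext => [||x].
- exact: lin_comp fl (kmap_lin _).
- exact: lin_comp gl (kmap_lin _).
- by rewrite kmapE h // => i; exact: trl_supp.
Qed.

Section PolarizeSum.
Variables (L I : FinSet) (w i : L -> nat).

Let om (o : option L) : nat := if o is Some l then w l else 0%N.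
Let be (s : L -> F) (o : option L) (v : V) : F :=
  if o is Some l then s l * v (i l) else tform v.

(** The affine map v |-> t(v) e_0 + sum_l s_l v_(i l) e_(w l). Writing it as one sum over [option L]
    makes the expansion of its tensor power a sum over functions I -> option L. *)
Definition polar_map (s : L -> F) (v : V) : V := \sum_o be s o v *: ebas F (om o).
Lemma polar_map_lin s : linear (polar_map s).
Proof.
move=> a u v; rewrite scaler_sumr -big_split /=; apply: eq_bigr => o _.
rewrite scalerA -scalerDl; congr (_ *: _); case: o => [l|]; rewrite /be.
  by rewrite c_PE mulrDr mulrCA.
exact: tform_lin.
Qed.
Lemma polar_map_t s v : (forall l, (0 < w l)%N) -> tform (polar_map s v) = tform v.
Proof.
move=> w0; rewrite /tform Cinf_sumE (bigD1 None) //= big1 => [|[l|] //= _].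
  by rewrite /= addr0 addr0 mulr1.
by rewrite addr0 (ltn_eqF (w0 l)) mulr0.
Qed.

(** In the expansion of the tensor power of [polar_map s], the term of h : I -> option L carries the
    product of the s_l to the power #|h^-1(Some l)|. The weights [c] extract exponent 1 for each l
    separately, which leaves the h taking every value Some l exactly once. *)
Lemma polarize_sum (n : nat) (c : 'I_n.+1 -> F) (x : I -> V) :
  (forall a, (a <= n)%N -> \sum_k c k * k.+1%:R ^+ a = (a == 1%N)%:R) ->
  (#|{: I}| <= n)%N ->
  \sum_(s : {ffun L -> 'I_n.+1}) (\prod_l c (s l)) *:
     mpure (fun q => polar_map (fun l => (s l).+1%:R) (x q)) =
  polarize w i (mpure x).
Proof.
move=> hc hI.
pose m (h : {ffun I -> option L}) l := #|[pred q | h q == Some l]|.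
have e1 (s : L -> F) : mpure (fun q => polar_map s (x q)) =
   \sum_(h : {ffun I -> option L}) (\prod_l s l ^+ m h l) *:
     ((\prod_q be (fun _ => 1) (h q) (x q)) *: kbas F (fun q => om (h q))).
  rewrite (mpure_sum None (fun q o => be s o (x q) *: ebas F (om o)) (@mpure_lin F I)).
  apply: eq_bigr => h _; rewrite mpure_scale scalerA; congr (_ *: _).
  rewrite -[X in X * _](_ : \prod_q (if h q is Some l then s l else 1) = _).
    by rewrite -big_split /=; apply: eq_bigr => q _; case: (h q) => [l|] /=;
      rewrite mul1r.
  transitivity (\prod_q \prod_l (if h q == Some l then s l else 1)).
    apply: eq_bigr => q _; case: (h q) => [l|]; last by rewrite big1.
    rewrite (bigD1 l) //= eqxx big1 ?mulr1 // => l' hl; case: eqP => // -[e].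
    by rewrite e eqxx in hl.
  rewrite exchange_big /=; apply: eq_bigr => l _.
  by rewrite -big_mkcond /= prodr_const.
under eq_bigr => s _ do rewrite e1 scaler_sumr.
rewrite exchange_big /=.
pose G (h : {ffun I -> option L}) :=
  (\prod_q be (fun _ => 1) (h q) (x q)) *: kbas F (fun q => om (h q)).
transitivity (\sum_(h : {ffun I -> option L} | [forall l, m h l == 1%N]) G h).
  rewrite [RHS]big_mkcond /=; apply: eq_bigr => h _.
  under eq_bigr => s _ do rewrite scalerA -big_split.
  rewrite -scaler_suml -(bigA_distr_bigA (fun l k => c k * k.+1%:R ^+ m h l)) /=.
  have -> : \prod_l \sum_k c k * k.+1%:R ^+ m h l = \prod_l (m h l == 1%N)%:R :> F.
    by apply: eq_bigr => l _; rewrite hc // (leq_trans (max_card _)).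
  case: forallP => [hh|/forallP]; first by rewrite big1 ?scale1r // => l _; rewrite hh.
  rewrite negb_forall => /existsP[l hl].
  by rewrite (bigD1 l) //= (negbTE hl) mul0r scale0r.
(* Such an h is the partial inverse of a unique injection L -> I, and its term is the summand of
   [polarize] at that injection. *)
pose hp (p : dsinj I L) : {ffun I -> option L} := [ffun q => inj_pm p q].
transitivity (\sum_(h in hp @: [set: dsinj I L]) G h).
  apply: eq_bigl => h; apply/forallP/imsetP => [hm|[p _ ->] l]; last first.
    rewrite -[1%N](card1 (val p l)); apply/eqP/eq_card => q.
    rewrite !inE /= ffunE; apply/eqP/eqP => [/inj_pmP <- //|->]; exact: inj_pmK.
  have /choice[f hf] l : exists q0, forall q, (h q == Some l) = (q == q0).
    have /card1P[q0 hq0] := hm l.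
    by exists q0 => q; have := hq0 q; rewrite !inE.
  have fi : injectiveb [ffun l => f l].
    apply/injectiveP => l l'; rewrite !ffunE => e.
    have := hf l (f l); have := hf l' (f l); rewrite {2}e !eqxx => /eqP -> /eqP.
    by case.
  exists (mk_dsinj fi); rewrite ?inE //; apply/ffunP => q; rewrite ffunE.
  case e: (inj_pm _ q) => [l|].
    by move/inj_pmP: e; rewrite /= ffunE => <-; apply/eqP; rewrite hf.
  case e': (h q) => [l|//]; move/inj_pm_none/imsetP: e => [].
  by exists l; rewrite // ffunE; apply/eqP; rewrite -hf e'.
rewrite big_imset /=; last first.
  move=> p p' _ _ /ffunP e; apply: val_inj; apply/ffunP => l.
  by have := e (val p l); rewrite !ffunE inj_pmK => /esym/inj_pmP.
rewrite /polarize (eq_bigl predT) => [|p]; last by rewrite inE.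
apply: eq_bigr => p _; rewrite /G kcoord_kact_inj (prod_over_inj p); congr (_ * _ *: _).
- by apply: eq_bigr => q /inj_pm_none; rewrite ffunE => ->.
- by apply: eq_bigr => l _; rewrite ffunE inj_pmK /= mul1r.
- by congr kbas; apply/funext => q; rewrite ffunE.
Qed.
End PolarizeSum.

(** Each tensor power of an affine map in [polarize_sum] is replaced by its element of the group
    algebra from [affine_approx]. The resulting [T] serves all [I] with at most n points, hence acts
    as P_i on a whole sum of tensor powers at once. *)
Lemma polarize_approx (L : FinSet) (w i : L -> nat) (n d : nat) :
  (forall l, (0 < w l)%N) ->
  exists T : seq (F * GAinf F), forall I : FinSet, (#|{: I}| <= n)%N ->
    forall u : krep F I, kmap (@trl_lin F d) u = u -> gact T u = polarize w i u.
Proof.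
(* The bound must be at least 1 for the exponent 1 to be extracted. *)
move=> w0; pose N := maxn n 1.
have [c hc] := @coef_extraction F N 1 char0 (leq_maxr n 1).
have /choice[T hT] (s : {ffun L -> 'I_N.+1}) := @affine_approx F char0
  (polar_map w i (fun l => (s l).+1%:R)) n d (polar_map_lin w i _)
  (fun v => polar_map_t i _ v w0).
exists (flatten [seq gscale (\prod_l c (s l)) (T s : seq (F * GAinf F)) |
  s : {ffun L -> 'I_N.+1} <- enum {ffun L -> 'I_N.+1}]).
move=> I hI; apply: (kpow_ext_supp (f := @gact _ _ (krep F I) _)).
- exact: (@gact_lin _ _ (krep F I)).
- exact: polarize_lin.
- move=> x hx; rewrite gact_flatten big_map big_enum /=.
  under eq_bigr => s _ do rewrite gact_scale hT //.
  by apply: polarize_sum hc _; rewrite leq_max hI.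
Qed.

End Polarize.

(* Ordinals live above [Set], hence this copy of 'I_n. *)
Section OrdFs.
Variable n : nat.
Definition ord_fs_of (i : 'I_n) : {m : nat | (m < n)%N} := exist _ (val i) (ltn_ord i).
Lemma ord_fs_fin : exists (k : nat) (e : 'I_k -> {m : nat | (m < n)%N}),
  forall x, exists i, e i = x.
Proof.
exists n, ord_fs_of => -[m hm]; exists (Ordinal hm).
by rewrite /ord_fs_of; congr exist; exact: bool_irrelevance.
Qed.
Definition ord_fs : FinSet := MkFinSet ord_fs_fin.
Lemma ord_fs_bij : bijective (ord_fs_of : 'I_n -> ord_fs).
Proof.
exists (fun x : ord_fs => Ordinal (proj2_sig x)) => [i|[m hm]].
  exact: val_inj.
by rewrite /ord_fs_of; congr exist; exact: bool_irrelevance.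
Qed.
Lemma card_ord_fs : #|{: ord_fs}| = n.
Proof. by rewrite -(bij_eq_card ord_fs_bij) card_ord. Qed.
End OrdFs.

(** The source of the factorial in the recovery formula: injections with image [S] are bijections
    onto [S]. *)
Lemma card_inj_image (I L : FinSet) (S : {set I}) :
  #|[set p : dsinj I L | val p @: [set: L] == S]| =
  if #|S| == #|{: L}| then (#|{: L}|)`! else 0%N.
Proof.
case: eqP => [e|ne]; last first.
  apply/eqP; rewrite cards_eq0; apply/eqP/setP => p; rewrite !inE.
  apply/negP => /eqP e; apply: ne; rewrite -e card_imset ?cardsT //.
  exact: dsinj_inj.
rewrite -[RHS]ffactnn -{1}e -card_inj_ffuns_on.
rewrite -(card_imset _ (f := val : dsinj I L -> {ffun L -> I})); last exact: val_inj.
apply: eq_card => f; rewrite !inE; apply/imsetP/andP => [[p]|[fS fi]].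
  rewrite inE => /eqP pS ->; split; last exact: valP p.
  by apply/ffun_onP => l; rewrite -pS imset_f ?inE.
exists (mk_dsinj fi); rewrite // inE eqEcard e card_imset ?cardsT ?leqnn ?andbT.
  by apply/subsetP => _ /imsetP[l _ ->]; exact: (ffun_onP fS).
exact/injectiveP.
Qed.

(** * Recovering a tensor from its polarizations *)

Section Depolarize.
Variable F : fieldType.
Hypothesis char0 : forall m, m.+1%:R != 0 :> F.
Local Notation V := (Cinf F).

(** The fresh indices used from here on; the shift by one keeps index 0 for e_0. *)
Definition std_index (L : FinSet) (l : L) : nat := (enum_rank l).+1.
Lemma std_index_gt0 (L : FinSet) (l : L) : (0 < std_index l)%N.
Proof. by []. Qed.
Lemma std_index_inj (L : FinSet) : injective (@std_index L).
Proof. by move=> l l' [] /val_inj /enum_rank_inj. Qed.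

Lemma kcoord_kstd (L : FinSet) (p : dsinj L L) :
  kcoord (@std_index L) (kstd F (@std_index L) p) =
  [forall l, val p l == l]%:R.
Proof.
rewrite kcoordE; case: (boolP [forall l, val p l == l]) => [/forallP h|].
  rewrite big1 // => q _; rewrite ebasE.
  by rewrite (proj2 (inj_pmP p q q)) ?eqxx //; apply/eqP/h.
rewrite negb_forall => /existsP[l hl].
rewrite (bigD1 (val p l)) //= inj_pmK.
by rewrite (inj_eq (@std_index_inj L)) (negbTE hl) mul0r.
Qed.

Lemma id_injectiveb (L : FinSet) : injectiveb [ffun l : L => l].
Proof. by apply/injectiveP => l l'; rewrite !ffunE. Qed.
Definition id_dsinj (L : FinSet) : dsinj L L := mk_dsinj (id_injectiveb L).
Lemma ds_of_inj_id (L : FinSet) : ds_of_inj (id_dsinj L) = ds_id L.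
Proof.
apply: ds_ext => l; rewrite ds_of_injE ds_pm_id; apply/inj_pmP.
by rewrite /= ffunE.
Qed.

Lemma kcoord_sum_kstd (L : FinSet) (G : dsinj L L -> F) :
  kcoord (@std_index L) (\sum_p G p *: kstd F (@std_index L) p) = G (id_dsinj L).
Proof.
rewrite (lin_sum _ _ _ (kcoord_lin _)) (bigD1 (id_dsinj L)) //=.
rewrite (lin_Z _ _ (kcoord_lin _)) kcoord_kstd big1 ?addr0 => [|p np].
  rewrite (_ : [forall l, _] = true); last by apply/forallP => l; rewrite ffunE.
  by rewrite /GRing.scale /= mulr1.
rewrite (lin_Z _ _ (kcoord_lin _)) kcoord_kstd; case: forallP => [h|_]; last exact: scaler0.
case/eqP: np; apply: val_inj; apply/ffunP => l; rewrite /= ffunE; exact/eqP.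
Qed.

(** When I = L, the coordinate at the fresh indices reads off the coefficient of e_id, and K_id is
    the identity. Thus all coordinates of u become one fixed coordinate of its polarizations. *)
Lemma kcoord_polarize (L : FinSet) (i : L -> nat) (u : kpow F L) :
  kcoord (@std_index L) (polarize (@std_index L) i u) = kcoord i u.
Proof. by rewrite kcoord_sum_kstd ds_of_inj_id kact_id. Qed.

Section OneSet.
Variables (L I : FinSet) (d : nat).

Definition unpolar (i : L -> nat) (v : V) : V :=
  v 0%N *: ebas F 0 + \sum_l v (std_index l) *: ebas F (i l).
Lemma unpolar_lin i : linear (unpolar i).
Proof.
move=> a u v; rewrite /unpolar c_PE scalerDr addrACA scalerA -scalerDl.
congr (_ + _); rewrite scaler_sumr -big_split /=; apply: eq_bigr => l _.
by rewrite scalerA -scalerDl mul1r addr0.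
Qed.
Lemma unpolar_t i v : (forall l, (0 < i l)%N) -> tform (unpolar i v) = tform v.
Proof.
move=> h; rewrite /tform /unpolar c_addE Cinf_scaleE ebasE eqxx mulr1 Cinf_sumE.
by rewrite big1 ?addr0 // => l _; rewrite Cinf_scaleE ebasE ltn_eqF ?mulr0.
Qed.
Lemma unpolar0 i : unpolar i (ebas F 0) = ebas F 0.
Proof.
rewrite /unpolar ebasE eqxx scale1r big1 ?addr0 // => l _.
by rewrite ebasE scale0r.
Qed.
Lemma unpolarS i l : unpolar i (ebas F (std_index l)) = ebas F (i l).
Proof.
rewrite /unpolar ebasE scale0r add0r (bigD1 l) // big1 => [|l' hl].
    by rewrite ebasE eqxx scale1r /= addr0.
by rewrite ebasE (inj_eq (@std_index_inj L)) (negbTE hl) scale0r.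
Qed.

(** Excluding i l = 0 makes [unpolar] preserve t, and forces the contributing injections to avoid
    the positions that carry e_0. *)
Definition depolarize (u : kpow F I) : kpow F I :=
  \sum_(i : {ffun L -> 'I_d.+1} | [forall l, i l != 0%N :> nat])
    kmap (unpolar_lin (fun l => i l)) (polarize (@std_index L) (fun l => i l) u).
Lemma depolarize_lin : linear depolarize.
Proof.
move=> a u v; rewrite /depolarize scaler_sumr -big_split /=; apply: eq_bigr => i _.
by rewrite polarize_lin kmap_lin.
Qed.

(** The term of (p, i) is u when i = f p and the image of p contains the set S of factors other than
    e_0, and 0 otherwise. As i takes no value 0, the image is then exactly S, so the multiplicity is
    the number of injections with image S. *)
Lemma depolarize_kbas (f : {ffun I -> 'I_d.+1}) :
  depolarize (kbas F (fun q => f q)) =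
  (if #|[set q | f q != 0%N :> nat]| == #|{: L}| then (#|{: L}|)`! else 0%N)%:R *:
  kbas F (fun q => f q).
Proof.
set S := [set q | _]; set u := kbas F _.
pose ok (p : dsinj I L) (i : {ffun L -> 'I_d.+1}) :=
  (S \subset val p @: [set: L]) && (i == [ffun l => f (val p l)]).
have term (i : {ffun L -> 'I_d.+1}) (p : dsinj I L) :
    kmap (unpolar_lin (fun l => i l))
      (kcoord (fun l => i l) (kact (ds_of_inj p) u) *: kstd F (@std_index L) p) =
    (ok p i)%:R *: u.
  rewrite (lin_Z _ _ (kmap_lin _)) kcoord_kact_inj kmapE.
  case: (boolP (ok p i)) => [/andP[/subsetP sS /eqP ->]|].
    have f0 q : q \notin val p @: [set: L] -> f q = ord0.
      move=> h; apply: val_inj => /=; apply/eqP; apply: contraT => nz.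
      by rewrite sS ?inE in h.
    rewrite big1 => [|q /f0 e]; last by rewrite /tform ebasE e.
    rewrite big1 => [|l _]; last by rewrite ebasE ffunE eqxx.
    rewrite mulr1; congr (_ *: mpure _); apply/funext => q.
    case e: (inj_pm p q) => [l|].
      by rewrite unpolarS ffunE; move/inj_pmP: e => ->.
    by rewrite unpolar0 f0 //; apply/inj_pm_none.
  rewrite negb_and scale0r => /orP[/subsetPn[q]|/eqP ni].
    rewrite inE => fq hq; rewrite (bigD1 q) // /tform ebasE.
    by rewrite eq_sym (negbTE fq) /= !mul0r scale0r.
  have [l hl] : exists l, i l != f (val p l).
    apply: contrapT => h; apply: ni; apply/ffunP => l; rewrite ffunE.
    by apply/eqP; apply: contraT => hl; case: h; exists l.
  rewrite [X in _ * X](bigD1 l) // ebasE.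
  move: hl; rewrite -val_eqE => /negbTE; rewrite [val _]/= => -> /=.
  by rewrite mul0r mulr0 scale0r.
rewrite /depolarize /polarize.
transitivity (\sum_(i : {ffun L -> 'I_d.+1} | [forall l, i l != 0%N :> nat])
   \sum_p (ok p i)%:R *: u).
  apply: eq_bigr => i _; rewrite (lin_sum _ _ _ (kmap_lin _)).
  by apply: eq_bigr => p _; exact: term.
rewrite exchange_big /=.
transitivity (\sum_(p in [set p : dsinj I L | val p @: [set: L] == S]) u).
  rewrite [RHS]big_mkcond /=; apply: eq_bigr => p _; rewrite inE.
  pose i0 := [ffun l => f (val p l)]; rewrite big_mkcond (bigD1 i0) //=.
  rewrite big1 => [|i ni]; last first.
    by rewrite /ok (negbTE ni) andbF scale0r if_same.
  rewrite addr0 /ok eqxx andbT eq_sym eqEsubset.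
  rewrite (_ : (val p @: setT \subset S) = [forall l, i0 l != 0%N :> nat]).
    by case: forallP; case: subsetP; rewrite ?scale1r ?scale0r.
  apply/subsetP/forallP => [h l|h _ /imsetP[l _ ->]].
    by rewrite ffunE; have := h _ (imset_f (val p) (in_setT l)); rewrite inE.
  by have := h l; rewrite ffunE inE.
by rewrite sumr_const card_inj_image scaler_nat.
Qed.
End OneSet.

(** On a basis tensor only the n equal to its number of factors other than e_0 contributes, with
    multiplicity n!, which is invertible in characteristic 0. *)
Lemma depolarizeK (I : FinSet) (d N : nat) (u : kpow F I) :
  kmap (@trl_lin F d.+1) u = u -> (#|{: I}| <= N)%N ->
  u = \sum_(n < N.+1) (n`!%:R)^-1 *: depolarize (ord_fs n) d u.
Proof.
move=> hu hN.
have fact0 n : n`!%:R != 0 :> F.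
  by have := fact_gt0 n; case: n`! => // m _; exact: char0.
have sl : linear (fun u : kpow F I =>
    \sum_(n < N.+1) (n`!%:R)^-1 *: depolarize (ord_fs n) d u).
  by apply: linear_sum_pw => n; exact: depolarize_lin.
rewrite -{2}hu kmap_trlE (lin_sum _ _ _ sl) -{1}hu kmap_trlE; apply: eq_bigr => f _.
rewrite (lin_Z _ _ sl); congr (_ *: _).
set S := [set q | f q != 0%N :> nat].
have hS : (#|S| < N.+1)%N by rewrite ltnS (leq_trans (max_card _) hN).
rewrite (bigD1 (Ordinal hS)) //= depolarize_kbas card_ord_fs eqxx scalerA mulVf //.
rewrite scale1r big1 ?addr0 // => n hn.
rewrite depolarize_kbas card_ord_fs ifN ?scale0r ?scaler0 //.
by apply: contra hn => /eqP e; apply/eqP/val_inj.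
Qed.
End Depolarize.

(** * Sums of tensor powers *)

Section SumsOfPowers.
Variable F : fieldType.
Hypothesis char0 : forall m, m.+1%:R != 0 :> F.
Local Notation V := (Cinf F).
Variables (k : nat) (Ls : 'I_k -> FinSet).

Definition ksum : rep F (GAinf F) := dsum (fun j => krep F (Ls j)).

Lemma dsum_proj_lin j : linear (fun x : ksum => (x : forall j, kpow F (Ls j)) j).
Proof. by []. Qed.
Definition kproj j : rephom ksum (krep F (Ls j)) :=
  @MkRepHom _ _ ksum (krep F (Ls j)) _ (@dsum_proj_lin j) (fun _ _ => erefl).
Lemma ksum_ext (x y : ksum) : (forall j, kproj j x = kproj j y) -> x = y.
Proof. exact: functional_extensionality_dep. Qed.

Variable L : FinSet.
Definition dsidx : Type := {j : 'I_k & dsinj (Ls j) L}.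
HB.instance Definition _ := Finite.on dsidx.

Definition comb_fun (c : dsidx -> F) (x : ksum) : krep F L :=
  \sum_h c h *: kact (ds_of_inj (tagged h)) (kproj (tag h) x).
Lemma comb_lin c : linear (comb_fun c).
Proof.
apply: linear_sum_pw => h; exact: lin_comp (kact_lin _) (rh_lin (kproj _)).
Qed.
Lemma comb_eq c g x : comb_fun c (rho ksum g x) = rho (krep F L) g (comb_fun c x).
Proof.
rewrite /comb_fun linear_sum; apply: eq_bigr => h _.
rewrite linearZ; congr (_ *: _); exact: kact_eq.
Qed.
Definition comb c : rephom ksum (krep F L) := MkRepHom (comb_lin c) (comb_eq c).
Lemma combE c x : comb c x = \sum_h c h *: kact (ds_of_inj (tagged h)) (kproj (tag h) x).
Proof. by []. Qed.

Definition coords (i : L -> nat) (x : ksum) (h : dsidx) : F :=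
  kcoord i (kact (ds_of_inj (tagged h)) (kproj (tag h) x)).
(** [of_coords (coords i x)] is P_i x. Its coefficients on the finite family e_psi are kept as a
    function on [dsidx], where linear forms extend and separate; by [kcoord_comb] such a form [c] is
    evaluated through [comb c]. *)
Definition of_coords (b : dsidx -> F) : ksum :=
  fun j => \sum_(p : dsinj (Ls j) L) b (existT _ j p) *: kstd F (@std_index L) p.
Lemma kproj_of_coords b j :
  kproj j (of_coords b) = \sum_(p : dsinj (Ls j) L) b (existT _ j p) *: kstd F (@std_index L) p.
Proof. by []. Qed.
Lemma of_coordsP a b b' :
  of_coords (fun h => a * b h + b' h) = a *: of_coords b + of_coords b'.
Proof.
apply: ksum_ext => j; rewrite (rh_lin (kproj j)) !kproj_of_coords scaler_sumr -big_split /=.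
by apply: eq_bigr => p _; rewrite scalerDl scalerA.
Qed.
Lemma of_coords0 : of_coords (fun _ => 0) = 0.
Proof.
by apply: ksum_ext => j; rewrite linear0 kproj_of_coords big1 // => p _; rewrite scale0r.
Qed.
Lemma kcoord_comb c i x : kcoord i (comb c x) = \sum_h c h * coords i x h.
Proof.
rewrite combE (lin_sum _ _ _ (kcoord_lin i)); apply: eq_bigr => h _.
by rewrite (lin_Z _ _ (kcoord_lin i)).
Qed.

Lemma ksum_supp (x : ksum) : exists d0, forall d, (d0 <= d)%N -> forall j,
  kmap (@trl_lin F d) (kproj j x) = kproj j x.
Proof.
have /choice[b hb] (j : 'I_k) := kpow_supp (kproj j x).
exists (\max_j b j) => d hd j; apply: hb; apply: leq_trans hd.
exact: leq_bigmax.
Qed.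

Definition ksum_bound := \max_j #|{: Ls j}|.
Lemma ksum_boundP j : (#|{: Ls j}| <= ksum_bound)%N.
Proof. exact: (@leq_bigmax _ (fun j => #|{: Ls j}|) j). Qed.

(* The polarization of [x] and that of [f x] are computed by the same element
   of the group algebra. *)
Lemma polarize_witness (S : rep F (GAinf F)) (io : rephom S ksum)
    (f : rephom S (krep F L)) (i : L -> nat) (s : S) :
  exists2 s', io s' = of_coords (coords i (io s)) &
    f s' = polarize (@std_index L) i (f s).
Proof.
have [d1 h1] := ksum_supp (io s); have [d2 h2] := kpow_supp (f s).
pose d := maxn d1 d2; pose n := maxn ksum_bound #|{: L}|.
have [T hT] := @polarize_approx F char0 L (@std_index L) i n d (@std_index_gt0 L).
exists (gact T s); rewrite gact_hom.
  apply: ksum_ext => j; rewrite gact_hom hT; last by apply: h1; rewrite leq_maxl.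
    by rewrite kproj_of_coords.
  by rewrite leq_max ksum_boundP.
by rewrite hT ?leq_maxr // h2 // leq_maxr.
Qed.

(** Fact (1). For s with io s = sum_psi u_psi e_psi, the coordinate of f s at the fresh indices
    depends only on u, since f kills the kernel of io; this partial linear form [Z] extends to some
    c. For arbitrary s, coordinate i of f s is that of the witness s' whose image under io is P_i
    (io s), so f s and comb c (io s) agree in every coordinate. *)
Lemma rephom_extension (S : rep F (GAinf F)) (io : rephom S ksum)
    (f : rephom S (krep F L)) :
  (forall s, io s = 0 -> f s = 0) ->
  exists c, forall s, f s = comb c (io s).
Proof.
move=> hf.
pose Z u a := exists s, io s = of_coords u /\ a = kcoord (@std_index L) (f s).
have [|||c hc] := @functional_extension F _ Z.
- by exists 0; rewrite of_coords0 !linear0 (lin0 (kcoord_lin _)).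
- move=> a u v b b' [s [es ->]] [t [et ->]]; exists (a *: s + t).
  by rewrite of_coordsP (rh_lin io) es et (rh_lin f) kcoord_lin.
- by move=> a [s [es ->]]; rewrite hf ?(lin0 (kcoord_lin _)) // es of_coords0.
exists c => s; apply: kcoord_inj => i; rewrite kcoord_comb; apply: hc.
have [s' e1 e2] := polarize_witness io f i s.
by exists s'; rewrite e1 e2 kcoord_polarize.
Qed.

End SumsOfPowers.

(** * Separating a vector from a subrepresentation *)

Section Separation.
Variable F : fieldType.
Hypothesis char0 : forall m, m.+1%:R != 0 :> F.
Variables (k : nat) (Ls : 'I_k -> FinSet).
Local Notation D := (ksum F Ls).

(** Fact (2), by contradiction: if every combination killing Y kills x, then Y contains all
    polarizations of x, and therefore x, which is rebuilt from them by affine maps and division by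
    factorials. *)
Lemma ksum_separation (Y : D -> Prop) (x : D) : Y 0 ->
  (forall a u v, Y u -> Y v -> Y (a *: u + v)) ->
  (forall g u, Y u -> Y (rho D g u)) -> ~ Y x ->
  exists (L : FinSet) (c : dsidx Ls L -> F),
    (forall y, Y y -> comb c y = 0) /\ comb c x <> 0.
Proof.
move=> Y0 YP Yg nYx; apply: contrapT => h.
have {}h L (c : dsidx Ls L -> F) : (forall y, Y y -> comb c y = 0) -> comb c x = 0.
  by move=> hc; apply: contrapT => n; apply: h; exists L, c.
apply: nYx.
(* On y, polarization is the action of an element of the group algebra, which preserves Y. *)
have Ypol (L : FinSet) (i : L -> nat) y : Y y -> Y (of_coords (coords i y)).
  have [d hd] := ksum_supp y.
  have [T hT] := @polarize_approx F char0 L (@std_index L) i (ksum_bound Ls) d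
    (@std_index_gt0 L).
  move=> Yy; rewrite (_ : of_coords _ = gact T y); first exact: gact_stable.
  by apply: ksum_ext => j; rewrite gact_hom hT ?hd ?ksum_boundP.
(* Otherwise a form c on the coefficient space vanishes on the part inside Y but not at P_i x. By
   [Ypol], [comb c] then kills Y in every coordinate, hence kills x by assumption, although
   coordinate i of [comb c x] is the nonzero value of c at P_i x. *)
have Yx (L : FinSet) (i : L -> nat) : Y (of_coords (coords i x)).
  apply: contrapT => nY.
  have [||c hc /eqP] := @Prop_subspace_sep F _ (fun u => Y (of_coords u))
    (coords i x) _ _ nY.
  - by rewrite of_coords0.
  - by move=> a u v hu hv; rewrite of_coordsP; exact: YP.
  apply; rewrite -kcoord_comb h ?(lin0 (kcoord_lin _)) // => y Yy.
  apply: kcoord_inj => i'; rewrite kcoord_comb hc ?(lin0 (kcoord_lin _)) //.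
  exact: Ypol.
have Ysum (I : finType) (P : pred I) (c : I -> F) (u : I -> D) :
    (forall i, P i -> Y (u i)) -> Y (\sum_(i | P i) c i *: u i).
  move=> hu; apply: (big_ind Y) => // [u1 u2 h1 h2|i /hu hi].
    by rewrite -[u1]scale1r; exact: YP.
  by rewrite -[_ *: _]addr0; exact: YP.
have [d hd] := ksum_supp x.
pose N := ksum_bound Ls.
(* All components are depolarized simultaneously, because one element of the group algebra realizes
   [unpolar] on every summand. *)
have /choice[y hy] (n : 'I_N.+1) : exists y, Y y /\
    forall j, kproj F Ls j y = depolarize (ord_fs n) d (kproj F Ls j x).
  have /choice[z hz] (i : {ffun ord_fs n -> 'I_d.+1}) :
      exists z, [forall l, i l != 0%N :> nat] -> Y z /\ forall j, kproj F Ls j z =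
        kmap (unpolar_lin (F := F) (fun l => i l))
          (polarize (@std_index (ord_fs n)) (fun l => i l) (kproj F Ls j x)).
    case: forallP => [i0|_]; last by exists 0.
    have i1 l : (0 < i l)%N by rewrite lt0n.
    pose P := of_coords (coords (fun l => i l) x).
    have [d' hd'] := ksum_supp P.
    have [T hT] := @affine_approx F char0 (@unpolar F _ (fun l => i l)) N d'
      (unpolar_lin (F := F) (fun l => i l))
      (fun v => unpolar_t v i1).
    exists (gact T P) => _; split; first by apply: gact_stable => //; exact: Yx.
    move=> j; rewrite gact_hom.
    apply: (kpow_ext_supp (d := d') (f := @gact _ _ (krep F (Ls j)) T)).
    - exact: (@gact_lin _ _ (krep F _)).
    - exact: kmap_lin.
    - by move=> v hv; rewrite kmapE; apply: hT hv; exact: ksum_boundP.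
    - exact: hd'.
  exists (\sum_(i : {ffun ord_fs n -> 'I_d.+1} | [forall l, i l != 0%N :> nat]) 1 *: z i); split.
    by apply: Ysum => i /hz[].
  move=> j; rewrite (lin_sum _ _ _ (rh_lin (kproj F Ls j))).
  by apply: eq_bigr => i /hz[_ e]; rewrite scale1r e.
rewrite (_ : x = \sum_(n < N.+1) (n`!%:R)^-1 *: y n).
  by apply: Ysum => n _; case: (hy n).
apply: ksum_ext => j; rewrite (lin_sum _ _ _ (rh_lin (kproj F Ls j))).
rewrite {1}(@depolarizeK F char0 (Ls j) d N (kproj F Ls j x)) ?ksum_boundP //; last first.
  exact: hd.
by apply: eq_bigr => n _; rewrite (lin_Z _ _ (rh_lin (kproj F Ls j))) (hy n).2.
Qed.
End Separation.

(** * Finite length *)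

Section FiniteGeneration.
Variables (F : fieldType) (M : dsmod F).

Definition lin_closed (V : lmodType F) (S : V -> Prop) : Prop :=
  S 0 /\ forall a x y, S x -> S y -> S (a *: x + y).

Definition gen_by (s : {L : FinSet & M L}) L (x : M L) : Prop :=
  exists c : dsinj (tag s) L -> F,
    x = \sum_p c p *: dsact M (ds_of_inj p) (tagged s).

Lemma gen_byP s L a (x y : M L) : gen_by s x -> gen_by s y -> gen_by s (a *: x + y).
Proof.
move=> [c ->] [c' ->]; exists (fun p => a * c p + c' p).
rewrite scaler_sumr -big_split /=; apply: eq_bigr => p _.
by rewrite scalerA -scalerDl.
Qed.
Lemma gen_by0 s L : gen_by s (0 : M L).
Proof. by exists (fun _ => 0); rewrite big1 // => p _; rewrite scale0r. Qed.
Lemma gen_by_dsact s L (d : dsmor (tag s) L) : gen_by s (dsact M d (tagged s)).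
Proof.
have [p ->] := ds_of_inj_surj d; exists (fun p' => (p' == p)%:R).
rewrite (bigD1 p) //= eqxx scale1r big1 ?addr0 // => p' /negbTE ->.
by rewrite scale0r.
Qed.
Lemma gen_by_self s : gen_by s (tagged s).
Proof. by rewrite -(dsact_id (tagged s)); exact: gen_by_dsact. Qed.
Lemma gen_by_act s L L' (d : dsmor L L') (x : M L) :
  gen_by s x -> gen_by s (dsact M d x).
Proof.
move=> [c ->]; rewrite linear_sum; apply: (big_ind (@gen_by s L')).
- exact: gen_by0.
- by move=> u v hu hv; rewrite -[u]scale1r; exact: gen_byP.
- move=> p _; rewrite linearZ /= -dsact_comp -[X in gen_by _ X]addr0.
  by apply: gen_byP; [exact: gen_by_dsact | exact: gen_by0].
Qed.

(** Finite generation. The coefficients are indexed by [dsidx] as in [comb], so that evaluating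
    morphisms to K at the generators turns one expression into the other. *)
Definition fgen : Prop :=
  exists (k : nat) (Ls : 'I_k -> FinSet) (m : forall j, M (Ls j)),
    forall L (x : M L), exists c : dsidx Ls L -> F,
      x = \sum_h c h *: dsact M (ds_of_inj (tagged h)) (m (tag h)).

(** One generator per step of the filtration: for x0 in S_(i+1) but not in S_i, the submodule S_i
    plus that generated by x0 lies strictly above S_i, hence is S_(i+1) by simplicity. *)
Lemma finite_length_fgen : finite_length M -> fgen.
Proof.
move=> [n [S [S0 Sn Sstep]]].
have main i : (i <= n)%N -> exists (k : nat) (g : 'I_k -> {L : FinSet & M L}),
    forall L (x : M L), S i L x -> exists y : 'I_k -> M L,
      (forall j, gen_by (g j) (y j)) /\ x = \sum_j y j.
  elim: i => [_|i IH hi].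
    exists 0%N, (fun _ => existT (fun L : FinSet => M L : Type) fs_empty 0) => L x /S0 ->.
    by exists (fun _ => 0); split; [case | rewrite big_ord0].
  have [k [g hg]] := IH (ltnW hi); have [le nle smp] := Sstep i hi.
  have [L0 [x0 [x0S x0n]]] : exists L0 (x0 : M L0), S i.+1 L0 x0 /\ ~ S i L0 x0.
    apply: contrapT => h; apply: nle => L x hx; apply: contrapT => nx.
    by apply: h; exists L, x.
  pose s0 : {L : FinSet & M L} := existT _ L0 x0.
  pose Z L (x : M L) := exists y z, [/\ S i L y, gen_by s0 z & x = y + z].
  have Z0 L : Z L 0.
    by exists 0, 0; split; [exact: ss0 | exact: gen_by0 | rewrite addr0].
  have ZP L a (x y : M L) : Z L x -> Z L y -> Z L (a *: x + y).
    move=> [x1 [x2 [h1 h2 ->]]] [y1 [y2 [h1' h2' ->]]].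
    exists (a *: x1 + y1), (a *: x2 + y2); split.
    - exact: ssP.
    - exact: gen_byP.
    - by rewrite scalerDr addrACA.
  have Za L L' (p : dsmor L L') (x : M L) : Z L x -> Z L' (dsact M p x).
    move=> [x1 [x2 [h1 h2 ->]]]; exists (dsact M p x1), (dsact M p x2).
    by split; [exact: ss_act | exact: gen_by_act | rewrite linearD].
  pose ZS := MkDsSub Z0 ZP Za.
  have hZ : dssub_le (S i.+1) ZS.
    case: (smp ZS) => // [L x hx|L x [y [z [hy [c ->] ->]]]|h].
    - by exists x, 0; split=> //; [exact: gen_by0 | rewrite addr0].
    - rewrite -[y]scale1r; apply: ssP; first exact: le.
      apply: (big_ind (S i.+1 L)); first exact: ss0.
        by move=> u v hu hv; rewrite -[u]scale1r; exact: ssP.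
      move=> p _; rewrite -[_ *: _]addr0; apply: ssP; last exact: ss0.
      exact: ss_act.
    - case: x0n; apply: h; exists 0, x0; split; last by rewrite add0r.
        exact: ss0.
      exact: (gen_by_self s0).
  pose g' (j : 'I_k.+1) := if unlift ord0 j is Some j' then g j' else s0.
  have g'0 : g' ord0 = s0 by rewrite /g' unlift_none.
  have g'S j : g' (fintype.lift ord0 j) = g j by rewrite /g' liftK.
  exists k.+1, g' => L x /hZ [y [z [/hg [yy [hyy ->]] hz ->]]].
  exists (fun j => if unlift ord0 j is Some j' then yy j' else z); split.
    move=> j; case: (unliftP ord0 j) => [j' ->|->]; first by rewrite g'S.
    by rewrite g'0.
  rewrite big_ord_recl unlift_none addrC; congr (_ + _).
  by apply: eq_bigr => j _; rewrite liftK.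
have [k [g hg]] := main n (leqnn n).
exists k, (fun j => tag (g j)), (fun j => tagged (g j)) => L x.
have [y [hy ->]] := hg L x (Sn L x).
pose c j := projT1 (cid (hy j)); have hc j := projT2 (cid (hy j)).
exists (fun h => c (tag h) (tagged h)).
rewrite -(sig_big_dep predT (fun _ => predT)
  (fun j (p : dsinj (tag (g j)) L) => c j p *: dsact M (ds_of_inj p) (tagged (g j)))) /=.
by apply: eq_bigr => j _; exact: hc.
Qed.

End FiniteGeneration.

Section Length.
Variables (F : fieldType).

(** [rel] is the graph of a linear surjection from a subspace of F^T onto V; it bounds the dimension
    of V without a choice of basis. *)
Definition subquotient_of (V : lmodType F) (T : finType)
    (rel : (T -> F) -> V -> Prop) : Prop :=
  [/\ rel (fun _ => 0) 0,
      forall a c c' x x', rel c x -> rel c' x' ->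
        rel (fun t => a * c t + c' t) (a *: x + x'),
      forall x, exists c, rel c x &
      forall c x x', rel c x -> rel c x' -> x = x'].

(** The measure of S is the dimension of its preimage in F^T, which detects strict inclusions
    because the relation is onto and single-valued. *)
Lemma subquotient_measure (V : lmodType F) (T : finType) (rel : (T -> F) -> V -> Prop) :
  subquotient_of rel -> exists dim : (V -> Prop) -> nat,
  (forall S, lin_closed S -> (dim S <= #|T|)%N) /\
  forall S S', lin_closed S -> lin_closed S' -> (forall x, S x -> S' x) ->
    (dim S <= dim S')%N /\ ((dim S' <= dim S)%N -> forall x, S' x -> S x).
Proof.
move=> [r0 rP rt rf].
pose pre (S : V -> Prop) (u : 'rV[F]_#|T|) :=
  exists x, rel (fun t => u 0 (enum_rank t)) x /\ S x.
have /choice[A hA] (S : V -> Prop) : exists A : 'M[F]_#|T|, lin_closed S ->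
    forall u, pre S u <-> (u <= A)%MS.
  have [[S0 SP]|n] := pselect (lin_closed S); last by exists 0.
  have [||A hA] := @Prop_subspace_mx F _ (pre S).
  - exists 0; split=> //; move: r0; congr (rel _ _).
    by apply/funext => t; rewrite mxE.
  - move=> a u v [x [hx Sx]] [y [hy Sy]]; exists (a *: x + y); split; last exact: SP.
    have := rP a _ _ _ _ hx hy; congr (rel _ _).
    by apply/funext => t; rewrite !mxE.
  by exists A.
exists (fun S => \rank (A S)); split=> [S _|S S' hS hS' le]; first exact: rank_leq_row.
have leA : (A S <= A S')%MS.
  apply/row_subP => i; apply/hA => //.
  have /hA[//|x [hx Sx]] : (row i (A S) <= A S)%MS by exact: row_sub.
  by exists x; split=> //; exact: le.
split; first exact: mxrankS.
move=> leR x Sx; have eqA : (A S' <= A S)%MS.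
  by have := mxrank_leqif_sup leA; rewrite -(geq_leqif (mxrank_leqif_sup leA)).
have [c hc] := rt x.
have hc' : rel (fun t => (\row_i c (enum_val i)) 0 (enum_rank t)) x.
  by move: hc; congr (rel _ _); apply/funext => t; rewrite mxE enum_rankK.
have : (\row_i c (enum_val i) <= A S')%MS by apply/hA => //; exists x.
move=> /submx_trans/(_ eqA)/hA[//|y [hy Sy]].
by rewrite (rf _ _ _ hc' hy).
Qed.

Variable M : dsmod F.
Variables (n : nat) (T : nat -> finType) (rel : forall m, (T m -> F) -> M (ord_fs m) -> Prop).
Hypothesis M0 : forall L : FinSet, (n < #|{: L}|)%N -> forall x : M L, x = 0.
Hypothesis relP : forall m, subquotient_of (@rel m).

Lemma dssub_closed (S : dssub M) L : lin_closed (S L).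
Proof. by split; [exact: ss0 | exact: ssP]. Qed.

(** Every finite set is isomorphic to some [ord_fs m], and M vanishes on sets with more than n
    elements, so finitely many values determine a submodule. *)
Lemma dssub_le_ord (S S' : dssub M) :
  (forall m, (m <= n)%N -> forall x, S (ord_fs m) x -> S' (ord_fs m) x) ->
  dssub_le S S'.
Proof.
move=> h L x Sx; have [hL|/M0 M0L] := leqP #|{: L}| n; last first.
  by rewrite (M0L x); exact: ss0.
pose e (l : L) : ord_fs #|{: L}| := ord_fs_of (enum_rank l).
have eb : bijective e.
  by apply: bij_comp (ord_fs_bij _) _; exact: enum_rank_bij.
have [e' eK e'K] := eb.
have eb' : bijective e' by exists e.
rewrite -(dsact_id x) (_ : ds_id L = ds_comp (ds_of_bij eb') (ds_of_bij eb)).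
  by rewrite dsact_comp; apply: ss_act; apply: h => //; exact: ss_act.
apply: ds_ext => l; rewrite ds_pm_comp ds_of_bijE ds_pm_id /= ds_of_bijE.
by rewrite eK.
Qed.

(** The total measure [de] is bounded by B and strictly increases along strict inclusions. A
    filtration is built upwards from 0, by induction on the remaining room B - de S. *)
Lemma bounded_finite_length : finite_length M.
Proof.
pose dim m := projT1 (cid (subquotient_measure (relP m))).
have hdim m := projT2 (cid (subquotient_measure (relP m))).
pose de (S : dssub M) := (\sum_(m < n.+1) dim m (S (ord_fs m)))%N.
pose B := (\sum_(m < n.+1) #|T m|)%N.
have deB S : (de S <= B)%N.
  by apply: leq_sum => m _; apply: (hdim m).1; exact: dssub_closed.
have de_le S S' : dssub_le S S' -> (de S <= de S')%N.
  move=> le; apply: leq_sum => m _.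
  by have [] := (hdim m).2 _ _ (dssub_closed S _) (dssub_closed S' _) (le _).
have de_lt S S' : dssub_le S S' -> ~ dssub_le S' S -> (de S < de S')%N.
  move=> le nle; rewrite ltn_neqAle de_le // andbT; apply/negP => /eqP e.
  apply: nle; apply: dssub_le_ord => m hm.
  have lem (i : 'I_n.+1) : (dim i (S (ord_fs i)) <= dim i (S' (ord_fs i)))%N.
    by have [] := (hdim i).2 _ _ (dssub_closed S _) (dssub_closed S' _) (le _).
  have [_] := (hdim m).2 _ _ (dssub_closed S _) (dssub_closed S' _) (le _).
  apply; have hm' : (m < n.+1)%N by [].
  have : (\sum_(i < n.+1 | i != Ordinal hm') dim i (S (ord_fs i)) <=
          \sum_(i < n.+1 | i != Ordinal hm') dim i (S' (ord_fs i)))%N.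
    by apply: leq_sum.
  move: e; rewrite /de (bigD1 (Ordinal hm')) //= [RHS](bigD1 (Ordinal hm')) //=.
  move=> e le2; rewrite leqNgt; apply/negP => lt; move: e.
  apply/eqP; rewrite ltn_eqF //; rewrite -addSn; exact: leq_add.
have chain r : forall S : dssub M, (B - de S <= r)%N -> exists (l : nat) (Z : nat -> dssub M),
    [/\ Z 0%N = S, forall L x, Z l L x &
      forall i, (i < l)%N -> simple_step (Z i) (Z i.+1)].
  elim: r => [|r IH] S hr; have [full|nf] := pselect (forall L x, S L x);
      try by exists 0%N, (fun _ => S).
  - have [L [x hx]] : exists L x, ~ S L x.
      apply: contrapT => h; apply: nf => L x; apply: contrapT => nx.
      by apply: h; exists L, x.
    pose MS := @MkDsSub F M (fun _ _ => True) (fun _ => I) (fun _ _ _ _ _ _ => I)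
      (fun _ _ _ _ _ => I).
    have := de_lt S MS (fun _ _ _ => I) (fun h => hx (h L x I)).
    move: hr; rewrite leqn0 subn_eq0 => hB /leq_trans/(_ (deB MS)).
    by rewrite ltnNge hB.
  (* The next term is a strictly larger submodule of least measure; anything strictly between would
     have smaller measure, so the step is simple. *)
  pose Q d := `[< exists Z, [/\ dssub_le S Z, ~ dssub_le Z S & de Z = d] >].
  have exQ : exists d, Q d.
    pose MS := @MkDsSub F M (fun _ _ => True) (fun _ => I) (fun _ _ _ _ _ _ => I)
      (fun _ _ _ _ _ => I).
    exists (de MS); apply/asboolP; exists MS; split=> // h; apply: nf => L x.
    exact: h.
  case: (ex_minnP exQ) => d /asboolP[Z [leZ nleZ dZ]] dmin.
  have ltZ := de_lt _ _ leZ nleZ.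
  have [|l [ZZ [ZZ0 ZZl ZZs]]] := IH Z.
    have := deB Z; move: hr ltZ; rewrite !leq_subLR => h1 h2 _.
    by apply: leq_trans h1 _; rewrite addnS -addSn leq_add2r.
  exists l.+1, (fun i => if i is j.+1 then ZZ j else S); split=> // -[_|i] /=; last exact: ZZs.
  rewrite ZZ0; split=> // Z' leSZ' leZ'Z.
  have [h|h] := pselect (dssub_le Z' S); [by left | right].
  have [//|h'] := pselect (dssub_le Z Z').
  have := de_lt _ _ leZ'Z h'; rewrite ltnNge dZ dmin //.
  by apply/asboolP; exists Z'.
have z0 L : (0 : M L) = 0 by [].
have zP L a (x y : M L) : x = 0 -> y = 0 -> a *: x + y = 0.
  by move=> -> ->; rewrite scaler0 addr0.
have za L L' (p : dsmor L L') (x : M L) : x = 0 -> dsact M p x = 0.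
  by move=> ->; rewrite linear0.
have [l [Z [Z0 Zl Zs]]] := chain _ (MkDsSub z0 zP za) (leqnn _).
by exists l, Z; split=> // L x; rewrite Z0.
Qed.

End Length.

(** M L is spanned by finitely many images of generators, indexed by injections L -> L_j, and no
    such injection exists once L is larger than every L_j. *)
Lemma fgen_finite_length (F : fieldType) (M : dsmod F) : fgen M -> finite_length M.
Proof.
move=> [k [Ls [m hm]]].
pose rel d (c : dsidx Ls (ord_fs d) -> F) x :=
  x = \sum_h c h *: dsact M (ds_of_inj (tagged h)) (m (tag h)).
apply: (@bounded_finite_length F M (ksum_bound Ls) _ rel) => [L hL x|d].
  have [c ->] := hm L x; rewrite big1 // => -[j p] _.
  have := leq_card _ (dsinj_inj (p := p)) => /leq_trans/(_ (ksum_boundP Ls j)).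
  by rewrite leqNgt hL.
split.
- by rewrite /rel big1 // => h _; rewrite scale0r.
- move=> a c c' x x' -> ->; rewrite /rel scaler_sumr -big_split /=.
  by apply: eq_bigr => h _; rewrite scalerA -scalerDl.
- by move=> x; exact: hm.
- by move=> c x x' -> ->.
Qed.

(** * Tensor products *)

Section Join.
Variable F : fieldType.
Local Notation V := (Cinf F).

Section JoinDef.
Variables I J : FinSet.

Definition join (a : I -> V) (b : J -> V) (s : fs_sum I J) : V :=
  match s with inl i => a i | inr j => b j end.
Lemma join_updl a b i v : join (upd a i v) b = upd (join a b) (inl i) v.
Proof.
apply/funext => -[i'|j]; rewrite /upd /=.
  by case: eqP => [->|ne]; case: eqP => // -[].
by case: eqP.
Qed.
Lemma join_updr a b j v : join a (upd b j v) = upd (join a b) (inr j) v.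
Proof.
apply/funext => -[i|j']; rewrite /upd /=; first by case: eqP.
by case: eqP => [->|ne]; case: eqP => // -[].
Qed.
Lemma join_adml (b : J -> V) :
  multilinear (fun a : I -> V => mpure (I := fs_sum I J) (join a b)).
Proof. by move=> a i c u v; rewrite !join_updl; exact: mpure_lin. Qed.
Definition joinl b : kpow F I -> kpow F (fs_sum I J) := Defs.lift (join_adml b).
Lemma joinl_lin b : linear (joinl b). Proof. exact: linearP. Qed.
Lemma joinlE a b : joinl b (mpure a) = mpure (I := fs_sum I J) (join a b).
Proof. exact: lift_gen. Qed.
Lemma join_admr u : multilinear (fun b => joinl b u).
Proof.
move=> b j c v w; move: u; apply: kpow_ext => [||a].
- exact: joinl_lin.
- by apply: lin_comb; exact: joinl_lin.
- by rewrite !joinlE !join_updr (@mpure_lin F (fs_sum I J)).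
Qed.
(** Concatenation of tensors, lifted to arbitrary tensors in one argument at a time. *)
Definition kjoin (u : kpow F I) (v : kpow F J) : kpow F (fs_sum I J) :=
  Defs.lift (join_admr u) v.
Lemma kjoin_linr u : linear (kjoin u). Proof. exact: linearP. Qed.
Lemma kjoin_purer u b : kjoin u (mpure b) = joinl b u.
Proof. exact: lift_gen. Qed.
Lemma kjoin_linl v : linear (kjoin^~ v).
Proof.
move=> c u u'; move: v; apply: kpow_ext => [||b].
- exact: kjoin_linr.
- by apply: lin_comb; exact: kjoin_linr.
- by rewrite !kjoin_purer joinl_lin.
Qed.
Lemma kjoinE a b : kjoin (mpure a) (mpure b) = mpure (I := fs_sum I J) (join a b).
Proof. by rewrite kjoin_purer joinlE. Qed.

Lemma kjoin_ext (W : lmodType F) (f g : kpow F I -> kpow F J -> W) :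
  (forall v, linear (f^~ v)) -> (forall u, linear (f u)) ->
  (forall v, linear (g^~ v)) -> (forall u, linear (g u)) ->
  (forall a b, f (mpure a) (mpure b) = g (mpure a) (mpure b)) ->
  forall u v, f u v = g u v.
Proof.
move=> fl fr gl gr h u v; move: u; apply: kpow_ext => // a.
by move: v; apply: kpow_ext.
Qed.

Lemma kjoin_equiv g u v :
  kg (I := fs_sum I J) g (kjoin u v) = kjoin (kg g u) (kg g v).
Proof.
move: u v; apply: kjoin_ext => [v|u|v|u|a b].
- exact: lin_comp (kg_lin g) (kjoin_linl v).
- exact: lin_comp (kg_lin g) (kjoin_linr u).
- exact: lin_comp (kjoin_linl _) (kg_lin g).
- exact: lin_comp (kjoin_linr _) (kg_lin g).
- by rewrite !kgE !kjoinE kgE; congr mpure; apply/funext => -[].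
Qed.

Lemma prod_fs_sum (R : comNzRingType) (G : fs_sum I J -> R) :
  \prod_s G s = (\prod_i G (inl i)) * \prod_j G (inr j).
Proof.
rewrite (reindex (fun s : (I + J)%type => s : fs_sum I J)) /=; last first.
  by apply: onW_bij; exists (fun s => s).
exact: big_sumType.
Qed.

Lemma kcoord_kjoin (k : fs_sum I J -> nat) u v :
  kcoord (I := fs_sum I J) k (kjoin u v) =
  kcoord (fun i => k (inl i)) u * kcoord (fun j => k (inr j)) v :> F.
Proof.
move: u v; apply: (kjoin_ext (W := F^o)) => [v|u|v|u|a b].
- exact: lin_comp (kcoord_lin k) (kjoin_linl v).
- exact: lin_comp (kcoord_lin k) (kjoin_linr u).
- by move=> c u u'; rewrite kcoord_lin /GRing.scale /= mulrDl mulrA.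
- by move=> c v v'; rewrite kcoord_lin /GRing.scale /= mulrDr mulrCA.
- by rewrite kjoinE !kcoordE prod_fs_sum.
Qed.

Definition kjoin_map : vtens (kpow F I) (kpow F J) -> kpow F (fs_sum I J) :=
  @tlift F _ _ _ kjoin kjoin_linl kjoin_linr.
Lemma kjoin_mapE u v : kjoin_map (tpure u v) = kjoin u v. Proof. exact: tliftE. Qed.
Lemma kjoin_map_eq g (x : rtens (krep F I) (krep F J)) :
  kjoin_map (rho _ g x) = rho (krep F (fs_sum I J)) g (kjoin_map x).
Proof.
move: x; apply: vtens_ext => [||u v].
- exact: lin_comp (@tlift_lin F _ _ _ _ kjoin_linl kjoin_linr)
    (@rt_lin _ _ (krep F I) (krep F J) g).
- exact: lin_comp (@kg_lin F (fs_sum I J) g)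
    (@tlift_lin F _ _ _ _ kjoin_linl kjoin_linr).
- by rewrite /= (@rt_rhoE _ _ (krep F I) (krep F J)) !kjoin_mapE kjoin_equiv.
Qed.
Definition kjoin_hom : rephom (rtens (krep F I) (krep F J)) (krep F (fs_sum I J)) :=
  @MkRepHom _ _ (rtens (krep F I) (krep F J)) (krep F (fs_sum I J)) kjoin_map
    (@tlift_lin F _ _ _ _ kjoin_linl kjoin_linr) kjoin_map_eq.
End JoinDef.

Lemma kphi_pm (L L' : FinSet) (p : dsmor L L') (x : L -> V) :
  kphi p x = (\prod_l (if ds_pm p l is None then tform (x l) else 1)) *:
    mpure (fun l' => x (val (ds_finv p l'))).
Proof.
rewrite /kphi big_mkcond /=; congr (_ *: _); apply: eq_bigr => l _.
by rewrite ds_UE; case: (ds_pm p l).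
Qed.

Lemma kact_sum (I I' J J' : FinSet) (p : dsmor I I') (q : dsmor J J') u v :
  kact (ds_sum p q) (kjoin u v) = kjoin (kact p u) (kact q v).
Proof.
move: u v; apply: kjoin_ext => [v|u|v|u|a b].
- exact: lin_comp (kact_lin _) (kjoin_linl v).
- exact: lin_comp (kact_lin _) (kjoin_linr u).
- exact: lin_comp (kjoin_linl _) (kact_lin _).
- exact: lin_comp (kjoin_linr _) (kact_lin _).
- rewrite kjoinE !kactE !kphi_pm (lin_Z _ _ (kjoin_linl _)) (lin_Z _ _ (kjoin_linr _)).
  rewrite kjoinE scalerA prod_fs_sum; congr (_ * _ *: mpure _).
  + by apply: eq_bigr => i _; rewrite ds_sumE /=; case: (ds_pm p i).
  + by apply: eq_bigr => i _; rewrite ds_sumE /=; case: (ds_pm q i).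
  + have el i : val (ds_finv (ds_sum p q) (inl i)) = inl (val (ds_finv p i)).
      by apply: ds_finv_pm; rewrite ds_sumE /= ds_pm_finv.
    have er j : val (ds_finv (ds_sum p q) (inr j)) = inr (val (ds_finv q j)).
      by apply: ds_finv_pm; rewrite ds_sumE /= ds_pm_finv.
    by apply/funext => -[i|j]; rewrite ?el ?er.
Qed.

Lemma kact_bij (L L' : FinSet) (h : L -> L') (hb : bijective h) (g : L' -> L)
    (x : L -> V) : cancel g h ->
  kact (ds_of_bij hb) (mpure x) = mpure (fun l' => x (g l')).
Proof.
move=> gK; rewrite kactE kphi_pm big1 => [|l _]; last by rewrite ds_of_bijE.
rewrite scale1r; congr mpure; apply/funext => l'; congr (x _).
by apply: ds_finv_pm; rewrite ds_of_bijE gK.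
Qed.

Lemma kjoin_assoc (A B C : FinSet) (u : kpow F A) (v : kpow F B) (w : kpow F C) :
  kact (ds_assoc A B C) (kjoin (kjoin u v) w) = kjoin u (kjoin v w).
Proof.
move: w; apply: kpow_ext => [||c].
- exact: lin_comp (kact_lin _) (kjoin_linr _).
- exact: lin_comp (kjoin_linr _) (kjoin_linr _).
move: u v; apply: kjoin_ext => [v|u|v|u|a b].
- exact: lin_comp (kact_lin _) (lin_comp (kjoin_linl _) (kjoin_linl v)).
- exact: lin_comp (kact_lin _) (lin_comp (kjoin_linl _) (kjoin_linr u)).
- exact: kjoin_linl.
- exact: lin_comp (kjoin_linr _) (kjoin_linl _).
rewrite !kjoinE (kact_bij _ (g := @sumA_g A B C)); last by case=> [|[]].
by congr mpure; apply/funext => -[|[]].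
Qed.
Lemma kjoin_assocV (A B C : FinSet) (u : kpow F A) (v : kpow F B) (w : kpow F C) :
  kact (ds_assocV A B C) (kjoin u (kjoin v w)) = kjoin (kjoin u v) w.
Proof. by rewrite -kjoin_assoc -kact_comp ds_assocK kact_id. Qed.

Lemma kjoin_swap (A B : FinSet) (u : kpow F A) (v : kpow F B) :
  kact (ds_swap A B) (kjoin u v) = kjoin v u.
Proof.
move: u v; apply: kjoin_ext => [v|u|v|u|a b].
- exact: lin_comp (kact_lin _) (kjoin_linl v).
- exact: lin_comp (kact_lin _) (kjoin_linr u).
- exact: kjoin_linr.
- exact: kjoin_linl.
rewrite !kjoinE (kact_bij _ (g := @sumC_f B A)); last by case.
by congr mpure; apply/funext => -[].
Qed.

Definition kone : kpow F fs_empty := mpure (fun e : fs_empty => match (e : Empty_set) with end).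
Lemma kone_span (u : kpow F fs_empty) : u = kcoord (fun _ => 0%N) u *: kone.
Proof.
move: u; apply: kpow_ext => [//||x].
  move=> a u v; rewrite kcoord_lin scalerDl scalerA //.
rewrite kcoordE big1 => [|[]]; rewrite scale1r; congr mpure.
by apply/funext => -[].
Qed.
Lemma kg_kone g : kg g kone = kone.
Proof. by rewrite kgE; congr mpure; apply/funext => -[]. Qed.
Lemma kcoord_kone k : kcoord k kone = 1.
Proof. by rewrite kcoordE big1 // => -[]. Qed.
Lemma kjoin_kone (A : FinSet) (u : kpow F A) : kjoin kone u = kact (ds_luV A) u.
Proof.
move: u; apply: kpow_ext => [||x].
- exact: kjoin_linr.
- exact: kact_lin.
rewrite kjoinE (kact_bij _ (g := @sum0l_f A)); last by case=> [[]|].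
by congr mpure; apply/funext => -[[]|].
Qed.

End Join.

Section TensorSums.
Variables (F : fieldType) (U V : lmodType F).

Lemma vtens_pure_sum (x : vtens U V) : exists r (f : 'I_r -> U) (g : 'I_r -> V),
  x = \sum_k tpure (f k) (g k).
Proof.
have := univ_sum x; set s := repr x => e.
pose t (k : 'I_(size s)) := tnth (in_tuple s) k.
exists (size s), (fun k => (t k).1 *: (t k).2.1), (fun k => (t k).2.2).
rewrite {1}e (big_tnth _ _ s); apply: eq_bigr => k _.
rewrite (lin_Z _ _ (tpure_linl _)) /tpure /t; congr (_ *: gen _ _).
by case: (tnth _ _) => ? [].
Qed.

(** If the forms in [Lam] separate points of U, contracting with them detects elements of the tensor
    product. Induction on the number of terms: a form that is nonzero on the first f expresses the
    first g through the others, and substituting removes that term. *)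
Lemma tensor_test (Lam : (U -> F^o) -> Prop) :
  (forall l, Lam l -> linear l) ->
  (forall f, (forall l, Lam l -> l f = 0) -> f = 0) ->
  forall r (f : 'I_r -> U) (g : 'I_r -> V),
    (forall l, Lam l -> \sum_k (l (f k) : F) *: g k = 0) ->
    \sum_k tpure (f k) (g k) = 0.
Proof.
move=> Ll Lsep; elim=> [|r IH] f g h; first by rewrite big_ord0.
rewrite big_ord_recl.
have [f0|nf0] := pselect (f ord0 = 0).
  rewrite f0 (lin0 (tpure_linl _)) add0r; apply: IH => l hl.
  by have := h l hl; rewrite big_ord_recl f0 (lin0 (Ll l hl)) scale0r add0r.
have [l0 [hl0 /eqP nl0]] : exists l, Lam l /\ l (f ord0) <> 0.
  apply: contrapT => hh; apply: nf0; apply: Lsep => l hl.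
  by apply: contrapT => n; apply: hh; exists l.
pose c k : F := l0 (f (fintype.lift ord0 k)) / l0 (f ord0).
have g0 : g ord0 = - \sum_k c k *: g (fintype.lift ord0 k).
  have := h l0 hl0; rewrite big_ord_recl => /eqP; rewrite addr_eq0 => /eqP e.
  rewrite -[LHS]scale1r -(mulVf nl0) -scalerA e scalerN scaler_sumr.
  by congr (- _); apply: eq_bigr => k _; rewrite scalerA /c [_ / _]mulrC.
have := IH (fun k => f (fintype.lift ord0 k) - c k *: f ord0)
  (fun k => g (fintype.lift ord0 k)).
rewrite (eq_bigr (fun k => tpure (f (fintype.lift ord0 k)) (g (fintype.lift ord0 k)) -
  tpure (f ord0) (c k *: g (fintype.lift ord0 k)))) => [hI|k _]; last first.
  by rewrite (linB _ _ (tpure_linl _)) (lin_Z _ _ (tpure_linl _)) (lin_Z _ _ (tpure_linr _)).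
rewrite -[RHS]hI.
  rewrite sumrB addrC g0 (linN _ (tpure_linr _)).
  by rewrite (lin_sum _ _ _ (tpure_linr _)).
move=> l hl; have := h l hl; rewrite big_ord_recl g0 scalerN scaler_sumr => e.
rewrite -[RHS]e [RHS]addrC -sumrB; apply: eq_bigr => k _.
by rewrite (linB _ _ (Ll l hl)) (lin_Z _ _ (Ll l hl)) scalerBl scalerA mulrC.
Qed.
End TensorSums.

(** * The comparison map from Phi M (x) Phi N to Phi (M (x) N) *)

Section PhiPair.
Variable F : fieldType.
Local Notation V := (Cinf F).

Lemma dh_eval_lin (M N : dsmod F) L (x : M L) : linear (fun f : dshom M N => f L x).
Proof. by move=> a f g; rewrite dh_PE. Qed.

Variables M N : dsmod F.

Section Pair.
Variables (f : dshom M (Kds F)) (g : dshom N (Kds F)).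
Lemma phi_pair_adm z : cadm (fun h : cgen M N z =>
  kact (ca h) (kjoin (f _ (cm h)) (g _ (cn h)))).
Proof.
split=> [x y al n|x y al m|x x' y y' p q al m n] /=.
- exact: lin_comp (kact_lin al) (lin_comp (kjoin_linl (g y n)) (@dh_lin _ _ _ f x)).
- exact: lin_comp (kact_lin al) (lin_comp (kjoin_linr (f x m)) (@dh_lin _ _ _ g y)).
- by rewrite kact_comp kact_sum !dh_nat.
Qed.
Definition phi_pair_fun z : cmod M N z -> Kds F z := Defs.lift (phi_pair_adm z).
Lemma phi_pair_lin z : linear (@phi_pair_fun z). Proof. exact: linearP. Qed.
Lemma phi_pair_funE z x y (al : dsmor (fs_sum x y) z) m n :
  phi_pair_fun (cpure al m n) = kact al (kjoin (f _ m) (g _ n)).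
Proof. exact: lift_gen. Qed.
Lemma phi_pair_nat L L' (p : dsmor L L') (u : cmod M N L) :
  phi_pair_fun (dsact (cmod M N) p u) = dsact (Kds F) p (phi_pair_fun u).
Proof.
move: u; apply: conv_ext => [||x y al m n].
- exact: lin_comp (phi_pair_lin (z := L')) (cact_lin p).
- exact: lin_comp (@dsact_lin _ (Kds F) _ _ p) (phi_pair_lin (z := L)).
- by rewrite cpure_act !phi_pair_funE kact_comp.
Qed.
Definition phi_pair : dshom (cmod M N) (Kds F) := MkDsHom phi_pair_lin phi_pair_nat.
Lemma phi_pairE z x y (al : dsmor (fs_sum x y) z) m n :
  phi_pair z (cpure al m n) = kact al (kjoin (f _ m) (g _ n)).
Proof. exact: phi_pair_funE. Qed.
End Pair.

Lemma phi_pair_linl g : linear (phi_pair^~ g).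
Proof.
move=> a f f'; apply: dshom_cext => x y m n.
by rewrite dh_PE !phi_pairE dh_PE !kact_id kjoin_linl.
Qed.
Lemma phi_pair_linr f : linear (phi_pair f).
Proof.
move=> a g g'; apply: dshom_cext => x y m n.
by rewrite dh_PE !phi_pairE dh_PE !kact_id kjoin_linr.
Qed.

Definition phi_mon_fun : vtens (dshom M (Kds F)) (dshom N (Kds F)) ->
  dshom (cmod M N) (Kds F) := @tlift F _ _ _ phi_pair phi_pair_linl phi_pair_linr.
Lemma phi_mon_lin : linear phi_mon_fun. Proof. exact: tlift_lin. Qed.
Lemma phi_mon_funE f g : phi_mon_fun (tpure f g) = phi_pair f g.
Proof. exact: tliftE. Qed.
Lemma phi_mon_eq g (x : rtens (Phi_ob M) (Phi_ob N)) :
  phi_mon_fun (rho _ g x) = rho (Phi_ob (cmod M N)) g (phi_mon_fun x).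
Proof.
move: x; apply: vtens_ext => [||f f'].
- exact: lin_comp phi_mon_lin (@rt_lin _ _ (Phi_ob M) (Phi_ob N) g).
- exact: lin_comp (@rho_lin _ _ (Phi_ob (cmod M N)) g) phi_mon_lin.
rewrite /= (@rt_rhoE _ _ (Phi_ob M) (Phi_ob N)) !phi_mon_funE.
by apply: dshom_cext => x y m n; rewrite /= !phi_pair_funE !kact_id kjoin_equiv.
Qed.
Definition phi_mon : rephom (rtens (Phi_ob M) (Phi_ob N)) (Phi_ob (cmod M N)) :=
  @MkRepHom _ _ (rtens (Phi_ob M) (Phi_ob N)) (Phi_ob (cmod M N)) _
    phi_mon_lin phi_mon_eq.
Lemma phi_monE f g : phi_mon (tpure f g) = phi_pair f g.
Proof. exact: phi_mon_funE. Qed.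

(** The coordinates of the values f(m) separate the morphisms f. Contracting the tensor with such a
    form, then evaluating at n and taking coordinate j, gives a joint coordinate of its image at m
    (x) n, by [kcoord_kjoin]. *)
Lemma phi_mon_inj : injective phi_mon.
Proof.
suff h x : phi_mon x = 0 -> x = 0.
  move=> x y e; apply/eqP; rewrite -subr_eq0; apply/eqP; apply: h.
  by rewrite (linB _ _ (rh_lin phi_mon)) e subrr.
have [r [f [g ->]]] := vtens_pure_sum x => e.
pose Lam (l : dshom M (Kds F) -> F^o) := exists L (m : M L) i,
  l = fun f => kcoord i (f L m).
apply: (tensor_test (Lam := Lam)) => [l [L [m [i ->]]]|f0 h0|l [L [m [i ->]]]].
- exact: (@lin_comp F (dshom M (Kds F)) (kpow F L) F^o (kcoord i)
    (fun f => f L m) (kcoord_lin i) (@dh_eval_lin M (Kds F) L m)).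
- apply: dshom_ext => L m; apply: kcoord_inj => i.
  by rewrite (h0 _ (ex_intro _ L (ex_intro _ m (ex_intro _ i erefl)))) (lin0 (kcoord_lin i)).
apply: dshom_ext => y n; apply: kcoord_inj => j.
rewrite (lin_sum _ _ _ (@dh_eval_lin _ _ _ n)) (lin0 (kcoord_lin j)).
pose ij (s : fs_sum L y) : nat := match s with inl a => i a | inr b => j b end.
have := congr1 (fun h : dshom (cmod M N) (Kds F) =>
  kcoord ij (h _ (cpure (ds_id (fs_sum L y)) m n))) e.
rewrite /= (lin0 (kcoord_lin ij)) (lin_sum _ _ _ phi_mon_lin) => <-.
rewrite (lin_sum _ _ _ (@dh_eval_lin _ _ _ _)) !(lin_sum _ _ _ (kcoord_lin _)).
apply: eq_bigr => k _; rewrite phi_mon_funE phi_pairE kact_id kcoord_kjoin.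
by rewrite addr0 (lin_Z _ _ (kcoord_lin j)).
Qed.

End PhiPair.

Section PartialCoordinates.
Variable F : fieldType.
Local Notation V := (Cinf F).
Variables I J : FinSet.

Lemma kpow_sum_ext (W : lmodType F) (f g : kpow F (fs_sum I J) -> W) :
  linear f -> linear g ->
  (forall a b, f (kjoin (mpure a) (mpure b)) = g (kjoin (mpure a) (mpure b))) ->
  forall u, f u = g u.
Proof.
move=> fl gl h; apply: kpow_ext => // x.
have -> : mpure (I := fs_sum I J) x =
    kjoin (mpure (fun i => x (inl i))) (mpure (fun j => x (inr j))).
  by rewrite kjoinE; congr mpure; apply/funext => -[].
exact: h.
Qed.

Lemma kpart_adm (k : J -> nat) : multilinear (fun x : fs_sum I J -> V =>
  (\prod_j x (inr j) (k j)) *: mpure (fun i => x (inl i))).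
Proof.
move=> x s a u v /=.
case: s => [i|j].
  have e w : (fun i' => upd x (inl i : fs_sum I J) w (inl i')) =
      upd (fun i' => x (inl i')) i w.
    apply/funext => i'; rewrite /upd; case: eqP => [[->]|ne]; first by rewrite eqxx.
    by case: eqP => // h; rewrite h in ne.
  have e' w : \prod_j upd x (inl i : fs_sum I J) w (inr j) (k j) =
      \prod_j x (inr j) (k j).
    by apply: eq_bigr => j _; rewrite /upd; case: eqP.
  by rewrite !e !e' (@mpure_lin F I) scalerDr !scalerA [_ * a]mulrC.
have e w : (fun j' => upd x (inr j : fs_sum I J) w (inr j')) =
    upd (fun j' => x (inr j')) j w.
  apply/funext => j'; rewrite /upd; case: eqP => [[->]|ne]; first by rewrite eqxx.
  by case: eqP => // h; rewrite h in ne.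
have e' w : (fun i' => upd x (inr j : fs_sum I J) w (inl i')) = fun i' => x (inl i').
  by apply/funext => i'; rewrite /upd; case: eqP.
have := @kform_adm F J (fun j v => v (k j)) (fun j => Cinf_coord_lin (k j))
  (fun j' => x (inr j')) j a u v.
rewrite !e' -!e /= => ->.
by rewrite scalerDl scalerA.
Qed.
(** Contraction of the factors indexed by J with the coordinate form k; [kpart_sum] rebuilds a
    truncated tensor from these contractions. *)
Definition kpart k : kpow F (fs_sum I J) -> kpow F I := Defs.lift (kpart_adm k).
Lemma kpart_lin k : linear (kpart k). Proof. exact: linearP. Qed.
Lemma kpartE k a b :
  kpart k (kjoin (mpure a) (mpure b)) = kcoord k (mpure b) *: mpure a.
Proof. by rewrite kjoinE [LHS]lift_gen kcoordE. Qed.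

Lemma kpart_sum d (u : kpow F (fs_sum I J)) :
  kmap (I := fs_sum I J) (@trl_lin F d.+1) u =
  \sum_(k : {ffun J -> 'I_d.+1})
    kjoin (kmap (@trl_lin F d.+1) (kpart (fun j => k j) u)) (kbas F (fun j => k j)).
Proof.
move: u; apply: kpow_sum_ext => [||a b].
- exact: kmap_lin.
- move=> c u v; rewrite scaler_sumr -big_split /=; apply: eq_bigr => k _.
  by rewrite kpart_lin kmap_lin kjoin_linl.
have e : mpure (I := fs_sum I J) (fun t => trl d.+1 (join a b t)) =
    kjoin (mpure (fun i => trl d.+1 (a i))) (mpure (fun j => trl d.+1 (b j))).
  by rewrite kjoinE; congr mpure; apply/funext => -[].
rewrite {1}kjoinE kmapE e.
rewrite -(kmapE (@trl_lin F d.+1) b) kmap_trlE (lin_sum _ _ _ (kjoin_linr _)).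
apply: eq_bigr => k _; rewrite kpartE (lin_Z _ _ (kmap_lin _)) kmapE.
by rewrite (lin_Z _ _ (kjoin_linr _)) (lin_Z _ _ (kjoin_linl _)).
Qed.
End PartialCoordinates.

Section KactNaturality.
Variable F : fieldType.

Lemma kact_kmap (L L' : FinSet) (p : dsmor L L') (A : Cinf F -> Cinf F)
    (Al : linear A) (u : kpow F L) : (forall v, tform (A v) = tform v) ->
  kact p (kmap Al u) = kmap Al (kact p u).
Proof.
move=> At; move: u; apply: kpow_ext => [||x].
- exact: lin_comp (kact_lin p) (kmap_lin Al).
- exact: lin_comp (kmap_lin Al) (kact_lin p).
rewrite kmapE !kactE /kphi (lin_Z _ _ (kmap_lin Al)) kmapE; congr (_ *: _).
by apply: eq_bigr => l _; exact: At.
Qed.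

Lemma kact_kpart (I I' J : FinSet) (p : dsmor I I') (k : J -> nat) u :
  kact p (kpart (F := F) k u) = kpart k (kact (ds_sum p (ds_id J)) u).
Proof.
move: u; apply: kpow_sum_ext => [||a b].
- exact: lin_comp (kact_lin p) (@kpart_lin F I J k).
- exact: lin_comp (@kpart_lin F I' J k) (kact_lin _).
rewrite kact_sum kact_id kpartE (lin_Z _ _ (kact_lin p)).
have e (w : kpow F I') : kpart k (kjoin w (mpure b)) = (kcoord k (mpure b) : F) *: w.
  move: w; apply: kpow_ext => [||a'].
  - exact: lin_comp (@kpart_lin F I' J k) (kjoin_linl _).
  - by move=> c u u'; rewrite scalerDr !scalerA mulrC.
  - exact: kpartE.
by rewrite e.
Qed.
End KactNaturality.

Section PhiSurjective.
Variable F : fieldType.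
Variables M N : dsmod F.

(* For a generator n_j of N, the coordinates of h (-, n_j) along the second
   factor are finitely many elements of Phi M.  If w is a basis of their span,
   then h (u, v) = sum_i w_i (u) (x) g_i (v) for unique g_i in Phi N. *)
Lemma phi_mon_surj : fgen M -> fgen N ->
  forall h : dshom (cmod M N) (Kds F), exists x, phi_mon M N x = h.
Proof.
move=> [k [Ls [m hm]]] [k' [Ls' [n hn]]] h.
pose H x y (u : M x) (v : N y) : kpow F (fs_sum x y) :=
  h _ (cpure (ds_id (fs_sum x y)) u v).
have Hl x y v : linear (fun u => @H x y u v).
  exact: lin_comp (@dh_lin _ _ _ h _) (cpure_linl _ v).
have Hr x y u : linear (@H x y u).
  exact: lin_comp (@dh_lin _ _ _ h _) (cpure_linr _ u).
have Hact x x' y y' (p : dsmor x x') (q : dsmor y y') u v :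
    H x' y' (dsact M p u) (dsact N q v) = kact (ds_sum p q) (H x y u v).
  rewrite /H -cpure_d ds_1comp cpure_norm dh_nat.
  by [].
have /choice[b hb] (ab : 'I_k * 'I_k') :=
  kpow_supp (I := fs_sum (Ls ab.1) (Ls' ab.2)) (H _ _ (m ab.1) (n ab.2)).
pose d := (\max_ab b ab)%N.
(* A truncation bound independent of u: it holds at the generators of M, and truncation commutes
   with the action because [d.+1] is positive, so that t is preserved. *)
have Hgen x (u : M x) j :
    kmap (I := fs_sum x (Ls' j)) (@trl_lin F d.+1) (H _ _ u (n j)) = H _ _ u (n j).
  have [c ->] := hm x u.
  rewrite (lin_sum _ _ _ (Hl _ _ _)) (lin_sum _ _ _ (kmap_lin _)).
  apply: eq_bigr => t _; rewrite (lin_Z _ _ (Hl _ _ _)) (lin_Z _ _ (kmap_lin _)).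
  congr (_ *: _); rewrite -{1 2}(dsact_id (n j)) Hact -kact_kmap; last first.
    by move=> v; exact: tform_trl.
  rewrite (hb (tag t, j)) // ltnW // ltnS.
  exact: (leq_bigmax (tag t, j)).
(* The coordinates of h(-, n_j) along the second factor. Contraction and truncation commute with the
   action on the first factor, so each is a morphism M -> K. *)
pose fb_fun j (ka : {ffun Ls' j -> 'I_d.+1}) x (u : M x) : kpow F x :=
  kmap (@trl_lin F d.+1) (kpart (fun l => ka l) (H _ _ u (n j))).
have fb_lin j ka x : linear (@fb_fun j ka x).
  exact: lin_comp (kmap_lin _) (lin_comp (@kpart_lin F x (Ls' j) _) (Hl _ _ _)).
have fb_nat j ka L L' (p : dsmor L L') (u : M L) :
    @fb_fun j ka L' (dsact M p u) = dsact (Kds F) p (@fb_fun j ka L u).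
  rewrite /fb_fun -{1}(dsact_id (n j)) Hact -kact_kpart -kact_kmap //.
pose fb j ka := @MkDsHom F M (Kds F) _ (fb_lin j ka) (@fb_nat j ka).
have Hfb x (u : M x) j : H _ _ u (n j) =
    \sum_ka kjoin (fb j ka x u) (kbas F (fun l => ka l)).
  by rewrite -Hgen kpart_sum.
pose s := [seq fb (tag t) (tagged t) |
  t <- enum {: {j : 'I_k' & {ffun Ls' j -> 'I_d.+1}}}].
have [r [w [wi ws]]] := independent_spanning s.
(* This relation is linear, compatible with the action, total because it is so at the generators of
   N, and single-valued; it is therefore the graph of the morphisms g_i. *)
pose R y (v : N y) (z : 'I_r -> kpow F y) :=
  forall x (u : M x), H x y u v = \sum_i kjoin (w i x u) (z i).
have Rgen j : exists z, R _ (n j) z.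
  have /choice[a ha] (ka : {ffun Ls' j -> 'I_d.+1}) :
      exists c : 'I_r -> F, fb j ka = \sum_i c i *: w i.
    apply: ws; apply/mapP; exists (existT (fun j => {ffun Ls' j -> 'I_d.+1}) j ka) => //.
    by rewrite mem_enum.
  exists (fun i => \sum_ka a ka i *: kbas F (fun l => ka l)) => x u.
  rewrite Hfb (eq_bigr (fun ka => \sum_i a ka i *:
    kjoin (w i x u) (kbas F (fun l => (ka : {ffun Ls' j -> 'I_d.+1}) l)))) => [|ka _].
    rewrite exchange_big; apply: eq_bigr => i _.
    rewrite (lin_sum _ _ _ (kjoin_linr _)); apply: eq_bigr => ka _.
    by rewrite (lin_Z _ _ (kjoin_linr _)).
  rewrite ha (lin_sum _ _ _ (@dh_eval_lin _ _ _ _ _)) (lin_sum _ _ _ (kjoin_linl _)).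
  apply: eq_bigr => i _.
  by rewrite (lin_Z _ _ (@dh_eval_lin _ _ _ _ _)) (lin_Z _ _ (kjoin_linl _)).
have RP y a v v' z z' : R y v z -> R y v' z' -> R y (a *: v + v') (fun i => a *: z i + z' i).
  move=> h1 h2 x u; rewrite Hr h1 h2 scaler_sumr -big_split /=; apply: eq_bigr => i _.
  by rewrite kjoin_linr.
have R0 y : R y 0 (fun _ => 0).
  move=> x u; rewrite (lin0 (Hr _ _ _)) big1 // => i _.
  by rewrite (lin0 (kjoin_linr _)).
have Ract y y' (q : dsmor y y') v z : R y v z -> R y' (dsact N q v) (fun i => kact q (z i)).
  move=> h1 x u; rewrite -{1}(dsact_id u) Hact h1 (lin_sum _ _ _ (kact_lin _)).
  by apply: eq_bigr => i _; rewrite kact_sum kact_id.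
have Rex y (v : N y) : exists z, R y v z.
  have [c ->] := hn y v.
  apply: (big_ind (fun v => exists z, R y v z)).
  - by exists (fun _ => 0); exact: R0.
  - move=> v1 v2 [z1 h1] [z2 h2]; exists (fun i => 1 *: z1 i + z2 i).
    by rewrite -[v1]scale1r; exact: RP.
  - move=> t _; have [z hz] := Rgen (tag t).
    exists (fun i => c t *: kact (ds_of_inj (tagged t)) (z i) + 0).
    by rewrite -[_ *: _]addr0; apply: RP (R0 y); exact: Ract.
(* A coordinate of the z_i along the second factor gives a linear relation among the w_i, which are
   independent. *)
have Run y z : R y 0 z -> forall i, z i = 0.
  move=> hz; suff main ka : forall i, kcoord ka (z i) = 0.
    by move=> i; apply: kcoord_inj => ka; rewrite main (lin0 (kcoord_lin ka)).
  apply: wi; apply: dshom_ext => x u; apply: kcoord_inj => i.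
  rewrite (lin_sum _ _ _ (@dh_eval_lin _ _ _ _ _)) (lin_sum _ _ _ (kcoord_lin i)).
  pose ij (t : fs_sum x y) : nat := match t with inl a => i a | inr b => ka b end.
  have := congr1 (kcoord ij) (hz x u).
  rewrite (lin0 (Hr _ _ _)) (lin0 (kcoord_lin ij)) (lin0 (kcoord_lin i)) => e0.
  rewrite [RHS]e0 (lin_sum _ _ _ (kcoord_lin ij)); apply: eq_bigr => t _.
  rewrite kcoord_kjoin (lin_Z _ _ (@dh_eval_lin _ _ _ _ _)) (lin_Z _ _ (kcoord_lin i)).
  by rewrite mulrC.
have Run2 y v z z' : R y v z -> R y v z' -> forall i, z i = z' i.
  move=> h1 h2 i; apply/eqP; rewrite -subr_eq0; apply/eqP.
  rewrite addrC -scaleN1r; have := RP _ (-1) _ _ _ _ h2 h1.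
  by rewrite (_ : -1 *: v + v = 0) ?scaleN1r ?addNr // => /Run/(_ i).
pose G i y (v : N y) : kpow F y := projT1 (cid (Rex y v)) i.
have GR y (v : N y) : R y v (fun i => G i y v) := projT2 (cid (Rex y v)).
have Gl i y : linear (@G i y).
  by move=> a v v'; apply: (Run2 _ _ _ _ (GR _ _) (RP _ _ _ _ _ _ (GR _ _) (GR _ _))).
have Gn i L L' (p : dsmor L L') (v : N L) : @G i L' (dsact N p v) = dsact (Kds F) p (@G i L v).
  exact: (Run2 _ _ _ _ (GR _ _) (Ract _ _ _ _ _ (GR _ _))).
pose g i := @MkDsHom F N (Kds F) _ (Gl i) (Gn i).
exists (\sum_i tpure (w i) (g i)); apply: dshom_cext => x y u v.
rewrite (lin_sum _ _ _ (rh_lin (phi_mon M N))).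
rewrite (lin_sum _ _ _ (@dh_eval_lin _ _ _ _ _)) -[RHS]/(H _ _ u v) GR.
by apply: eq_bigr => i _; rewrite phi_monE phi_pairE kact_id.
Qed.
End PhiSurjective.

(** * Double duality *)

Section BijectiveMorphisms.
Variable F : fieldType.

Section RepIso.
Variables (G : groupType) (N N' : rep F G) (f : rephom N N').
Hypotheses (fi : injective f) (fs : forall y, exists x, f x = y).
Let g y := projT1 (cid (fs y)).
Let gK y : f (g y) = y := projT2 (cid (fs y)).
Lemma rep_inv_lin : linear g.
Proof. by move=> a u v; apply: fi; rewrite gK (rh_lin f) !gK. Qed.
Lemma rep_inv_eq h y : g (rho N' h y) = rho N h (g y).
Proof. by apply: fi; rewrite gK rh_eq gK. Qed.
Definition rep_inv : rephom N' N := MkRepHom rep_inv_lin rep_inv_eq.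
Lemma rep_invK : rhcomp rep_inv f = rhid N.
Proof. by apply: rephom_ext => x; apply: fi; exact: gK. Qed.
Lemma rep_invVK : rhcomp f rep_inv = rhid N'.
Proof. by apply: rephom_ext => y; exact: gK. Qed.
Definition rep_iso : @iso F (Rep F G) N N' :=
  @Iso F (Rep F G) N N' f rep_inv rep_invK rep_invVK.
End RepIso.

Section DsIso.
Variables (M M' : dsmod F) (f : dshom M M').
Hypotheses (fi : forall L, injective (f L)) (fs : forall L y, exists x, f L x = y).
Let g L y := projT1 (cid (fs (L := L) y)).
Let gK L y : f L (g y) = y := projT2 (cid (fs (L := L) y)).
Lemma ds_inv_lin L : linear (@g L).
Proof. by move=> a u v; apply: (@fi L); rewrite gK (dh_lin f) !gK. Qed.
Lemma ds_inv_nat L L' (p : dsmor L L') (y : M' L) : g (dsact M' p y) = dsact M p (g y).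
Proof. by apply: (@fi L'); rewrite gK dh_nat gK. Qed.
Definition ds_inv : dshom M' M := MkDsHom ds_inv_lin ds_inv_nat.
Lemma ds_invK : dhcomp ds_inv f = dhid M.
Proof. by apply: dshom_ext => L x; apply: (@fi L); exact: gK. Qed.
Lemma ds_invVK : dhcomp f ds_inv = dhid M'.
Proof. by apply: dshom_ext => L y; exact: gK. Qed.
Definition ds_iso : @iso F (Mod_ds F) M M' :=
  @Iso F (Mod_ds F) M M' f ds_inv ds_invK ds_invVK.
End DsIso.

Section Descend.
Variables (G : groupType) (S N K : rep F G) (q : rephom S N) (g : rephom S K).
Hypotheses (qs : forall y, exists x, q x = y) (h : forall s, q s = 0 -> g s = 0).
Lemma rephom_descend : exists f : rephom N K, forall s, f (q s) = g s.
Proof.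
pose r y := projT1 (cid (qs y)); have rK y : q (r y) = y := projT2 (cid (qs y)).
have ker s t : q s = q t -> g s = g t.
  move=> e; apply/eqP; rewrite -subr_eq0 -(linB _ _ (rh_lin g)); apply/eqP/h.
  by rewrite (linB _ _ (rh_lin q)) e subrr.
have fl : linear (fun y => g (r y)).
  by move=> a u v; rewrite -(rh_lin g); apply: ker; rewrite rK (rh_lin q) !rK.
have fe x y : g (r (rho N x y)) = rho K x (g (r y)).
  by rewrite -rh_eq; apply: ker; rewrite rK rh_eq rK.
by exists (MkRepHom fl fe) => s; apply: ker; rewrite rK.
Qed.
End Descend.
End BijectiveMorphisms.

Section Polynomial.
Variable F : fieldType.
Local Notation G := (GAinf F).

Section DsumMap.
Variables (k : nat) (W W' : 'I_k -> rep F G) (f : forall j, rephom (W j) (W' j)).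
Definition dsum_map_fun (x : dsum W) : dsum W' := fun j => f j ((x : forall j, W j) j).
Lemma dsum_map_lin : linear dsum_map_fun.
Proof. by move=> a x y; apply: functional_extensionality_dep => j; exact: (rh_lin (f j)). Qed.
Lemma dsum_map_eq g x : dsum_map_fun (rho (dsum W) g x) = rho (dsum W') g (dsum_map_fun x).
Proof. by apply: functional_extensionality_dep => j; exact: (rh_eq (f j)). Qed.
Definition dsum_map : rephom (dsum W) (dsum W') := MkRepHom dsum_map_lin dsum_map_eq.
Lemma dsum_map_inj : (forall j, injective (f j)) -> injective dsum_map.
Proof.
move=> fi x y e; apply: functional_extensionality_dep => j; apply: (fi j).
exact: (congr1 (fun z : dsum W' => (z : forall j, W' j) j) e).
Qed.
End DsumMap.

Lemma krl_injective (I J : finType) (f : J -> I) (fb : bijective f) :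
  injective (krl_hom F fb).
Proof.
have [g fK gK] := fb; have gb : bijective g by exists f.
exact: (can_inj (krlK fb gb gK)).
Qed.

Lemma polynomial_of_ksum (N : rep F G) k (Ls : 'I_k -> FinSet) (io : rephom N (ksum F Ls)) :
  injective io -> polynomial_rep N.
Proof.
move=> ioi; pose n j := #|{: Ls j}|.
pose f (j : 'I_k) : rephom (krep F (Ls j)) (krep F 'I_(n j)) :=
  krl_hom F (@enum_val_bij (Ls j)).
exists k, n, N, (rhcomp (dsum_map f) io), (rhid N); split; last by move=> y; exists y.
apply: inj_comp ioi; apply: dsum_map_inj => j; exact: krl_injective.
Qed.

Lemma polynomial_presentation (N : rep F G) : polynomial_rep N ->
  exists k (Ls : 'I_k -> FinSet) (S : rep F G) (io : rephom S (ksum F Ls)) (q : rephom S N),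
    injective io /\ (forall y, exists x, q x = y).
Proof.
move=> [k [n [S [i [q [ii qs]]]]]].
have ord_b m : bijective (fun x : ord_fs m => Ordinal (proj2_sig x)).
  exists (@ord_fs_of m) => [[x hx]|x]; last exact: val_inj.
  by rewrite /ord_fs_of; congr exist; exact: bool_irrelevance.
pose f (j : 'I_k) : rephom (krep F 'I_(n j)) (krep F (ord_fs (n j))) := krl_hom F (ord_b (n j)).
exists k, (fun j => ord_fs (n j)), S, (rhcomp (dsum_map f) i), q; split=> //.
apply: inj_comp ii; apply: dsum_map_inj => j; exact: krl_injective.
Qed.
End Polynomial.

(** * The two evaluation maps are bijective *)

Section Evaluation.
Variable F : fieldType.
Hypothesis char0 : forall m, m.+1%:R != 0 :> F.
Local Notation G := (GAinf F).

Section EvalRep.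
Variable N : rep F G.
Definition eval_rep_fun (x : N) : dshom (Psi_ob N) (Kds F) :=
  @MkDsHom F (Psi_ob N) (Kds F) (fun L (f : rephom N (krep F L)) => f x)
    (fun L a f g => rh_PE a f g x) (fun L L' p f => erefl).
Lemma eval_rep_lin : linear eval_rep_fun.
Proof.
move=> a x y; apply: dshom_ext => L f; rewrite dh_PE.
exact: (rh_lin (f : rephom N (krep F L))).
Qed.
Lemma eval_rep_eq g x : eval_rep_fun (rho N g x) = rho (Phi_ob (Psi_ob N)) g (eval_rep_fun x).
Proof. apply: dshom_ext => L f; exact: (rh_eq (f : rephom N (krep F L))). Qed.
Definition eval_rep : rephom N (Phi_ob (Psi_ob N)) :=
  @MkRepHom F G N (Phi_ob (Psi_ob N)) _ eval_rep_lin eval_rep_eq.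
End EvalRep.

Section EvalDs.
Variable M : dsmod F.
Definition eval_ds_fun L (m : M L) : rephom (Phi_ob M) (krep F L) :=
  @MkRepHom F G (Phi_ob M) (krep F L) (fun f : dshom M (Kds F) => f L m)
    (@dh_eval_lin F M (Kds F) L m) (fun g f => erefl).
Lemma eval_ds_lin L : linear (@eval_ds_fun L).
Proof. by move=> a m m'; apply: rephom_ext => f; rewrite rh_PE; exact: (@dh_lin F M (Kds F) f L). Qed.
Lemma eval_ds_nat L L' (p : dsmor L L') (m : M L) :
  eval_ds_fun (dsact M p m) = dsact (Psi_ob (Phi_ob M)) p (eval_ds_fun m).
Proof. by apply: rephom_ext => f; exact: (dh_nat (f : dshom M (Kds F))). Qed.
Definition eval_ds : dshom M (Psi_ob (Phi_ob M)) :=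
  @MkDsHom F M (Psi_ob (Phi_ob M)) eval_ds_fun eval_ds_lin eval_ds_nat.
End EvalDs.

Section EvalGenerators.
Variables (M : dsmod F) (k : nat) (Ls : 'I_k -> FinSet) (m : forall j, M (Ls j)).
Definition at_gens_fun (f : dshom M (Kds F)) : ksum F Ls := fun j => f (Ls j) (m j).
Lemma at_gens_lin : linear at_gens_fun.
Proof. by move=> a f g; apply: functional_extensionality_dep => j; rewrite /at_gens_fun dh_PE. Qed.
Definition at_gens : rephom (Phi_ob M) (ksum F Ls) :=
  @MkRepHom F G (Phi_ob M) (ksum F Ls) at_gens_fun at_gens_lin (fun g f => erefl).
(** By naturality, a combination of the K_psi applied to the values at generators is the value of f
    at the same combination in M. This lets [comb] represent evaluation at an element. *)
Lemma comb_at_gens L (c : dsidx Ls L -> F) (f : dshom M (Kds F)) :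
  comb c (at_gens f) = f L (\sum_h c h *: dsact M (ds_of_inj (tagged h)) (m (tag h))).
Proof.
rewrite combE (lin_sum _ _ _ (dh_lin f (L := L))); apply: eq_bigr => h _.
rewrite (lin_Z _ _ (dh_lin f (L := L))); congr (_ *: _).
by rewrite (dh_nat f).
Qed.
Hypothesis hm : forall L (x : M L), exists c : dsidx Ls L -> F,
  x = \sum_h c h *: dsact M (ds_of_inj (tagged h)) (m (tag h)).
Lemma at_gens_inj : injective at_gens.
Proof.
move=> f g e; apply: dshom_ext => L x; have [c ->] := hm x.
by rewrite -!comb_at_gens e.
Qed.
End EvalGenerators.

Lemma Phi_polynomial (M : dsmod F) : fgen M -> polynomial_rep (Phi_ob M).
Proof.
move=> [k [Ls [m hm]]]; exact: polynomial_of_ksum (at_gens_inj hm).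
Qed.

(** Evaluation at generators embeds Phi M in a sum of tensor powers, so by [rephom_extension] h is a
    combination of the K_psi, that is, evaluation at an element of M L. *)
Lemma eval_ds_surj (M : dsmod F) : fgen M ->
  forall L (h : Psi_ob (Phi_ob M) L), exists x, eval_ds M L x = h.
Proof.
move=> [k [Ls [m hm]]] L h.
have [|c hc] := @rephom_extension F char0 k Ls L (Phi_ob M) (at_gens m) h.
  move=> f; rewrite -[RHS](lin0 (rh_lin (at_gens m))) => /(at_gens_inj hm) ->.
  exact: (lin0 (rh_lin (h : rephom _ _))).
exists (\sum_h c h *: dsact M (ds_of_inj (tagged h)) (m (tag h))).
by apply: rephom_ext => f; rewrite hc comb_at_gens.
Qed.

(** Coefficient vectors map onto V; a form on F^T that vanishes on the relations among the v_t but
    not on coefficients of x descends to V. *)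
Lemma spanned_separation (V : lmodType F) (T : finType) (v : T -> V) (x : V) :
  (forall y, exists c : T -> F, y = \sum_t c t *: v t) -> x <> 0 ->
  exists l : V -> F^o, linear l /\ l x <> 0.
Proof.
move=> hv nx; have [cx ex] := hv x.
pose P (c : T -> F) := \sum_t c t *: v t = 0.
have sP (c c' : T -> F) a : \sum_t (a * c t + c' t) *: v t =
    a *: (\sum_t c t *: v t) + \sum_t c' t *: v t.
  rewrite scaler_sumr -big_split /=; apply: eq_bigr => t _.
  by rewrite scalerDl scalerA.
have [|||e eP /eqP ex0] := @Prop_subspace_sep F T P cx.
- by rewrite /P big1 // => t _; rewrite scale0r.
- by move=> a u w hu hw; rewrite /P sP hu hw scaler0 addr0.
- by rewrite /P -ex.
pose C y := projT1 (cid (hv y)); have CK y : y = \sum_t C y t *: v t := projT2 (cid (hv y)).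
have wd y (c : T -> F) : y = \sum_t c t *: v t -> \sum_t e t * C y t = \sum_t e t * c t.
  move=> ec; apply/eqP; rewrite -subr_eq0 -sumrB.
  have := eP (fun t => -1 * c t + C y t); rewrite /P sP -CK -ec scaleN1r addNr.
  move=> /(_ erefl) h; apply/eqP; rewrite -[RHS]h; apply: eq_bigr => t _.
  by rewrite mulrDr mulN1r mulrN addrC.
exists (fun y => \sum_t e t * C y t); split; last by rewrite (wd _ _ ex).
move=> a y z; rewrite (wd _ (fun t => a * C y t + C z t)); last by rewrite sP -!CK.
rewrite /GRing.scale /= mulr_sumr -big_split /=; apply: eq_bigr => t _.
by rewrite mulrDr mulrCA.
Qed.

Section Coinduced.
Variables (L L' L'' : FinSet) (d : dsmor L' L'').
Local Notation w := (@std_index L).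

Lemma precomp_injectiveb (p : dsinj L'' L) :
  injectiveb [ffun l => val (ds_finv d (val p l))].
Proof.
apply/injectiveP => l l'; rewrite !ffunE => /val_inj /(can_inj (ds_finvVK d)).
exact: dsinj_inj.
Qed.
Definition precomp_dsinj p : dsinj L' L := mk_dsinj (precomp_injectiveb p).
Lemma ds_of_inj_precomp p : ds_of_inj (precomp_dsinj p) = ds_comp (ds_of_inj p) d.
Proof.
apply: ds_ext => x; rewrite ds_pm_comp ds_of_injE.
case e: (ds_pm d x) => [y|] /=; last first.
  apply/inj_pm_none/imsetP => -[l _]; rewrite ffunE => h.
  by have := ds_pm_finv d (val p l); rewrite -h e.
rewrite ds_of_injE; case e': (inj_pm p y) => [l|].
  by apply/inj_pmP; rewrite ffunE (proj1 (inj_pmP _ _ _) e') (ds_finv_pm e).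
apply/inj_pm_none/imsetP => -[l _]; rewrite ffunE => h.
have := ds_pm_finv d (val p l); rewrite -h e => -[] ye.
by move/inj_pm_none/imsetP: e'; apply; exists l.
Qed.
Lemma precomp_dsinj_inj : injective precomp_dsinj.
Proof.
move=> p p' /(congr1 val)/ffunP h; apply: val_inj; apply/ffunP => l.
by have := h l; rewrite !ffunE => /val_inj /(can_inj (ds_finvVK d)).
Qed.

Lemma kact_kstd_precomp p : kact d (kstd F w (precomp_dsinj p)) = kstd F w p.
Proof.
have pmE x : inj_pm (precomp_dsinj p) x = obind (inj_pm p) (ds_pm d x).
  rewrite -ds_of_injE ds_of_inj_precomp ds_pm_comp.
  by case: (ds_pm d x) => //= y; rewrite ds_of_injE.
rewrite kactE kphi_pm big1 => [|x _].
  rewrite scale1r; congr mpure; apply/funext => y.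
  by rewrite pmE ds_pm_finv.
by case e: (ds_pm d x) => [//|] /=; rewrite pmE e.
Qed.

(** If q does not factor through d, then d contracts a factor carrying a fresh basis vector, on
    which t vanishes. *)
Lemma kact_kstd_out (q : dsinj L' L) :
  (forall p, q <> precomp_dsinj p) -> kact d (kstd F w q) = 0.
Proof.
move=> nq; have [l hl] : exists l, ds_pm d (val q l) = None.
  apply: contrapT => h.
  have /choice[f hf] l : exists y, ds_pm d (val q l) = Some y.
    by case e: (ds_pm d (val q l)) => [y|]; [exists y | case: h; exists l].
  have fi : injectiveb [ffun l => f l].
    apply/injectiveP => l l'; rewrite !ffunE => e; apply: (dsinj_inj (p := q)).
    by apply: (ds_pm_inj (hf l)); rewrite e hf.
  apply: (nq (mk_dsinj fi)); apply: val_inj; apply/ffunP => l.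
  by rewrite /= !ffunE (ds_finv_pm (hf l)).
rewrite kactE kphi_pm (bigD1 (val q l)) //= hl /= inj_pmK.
by rewrite mul0r scale0r.
Qed.

Lemma kact_sum_kstd (g : dsinj L' L -> F) :
  kact d (\sum_q g q *: kstd F w q) = \sum_p g (precomp_dsinj p) *: kstd F w p.
Proof.
rewrite (lin_sum _ _ _ (kact_lin d)) (bigID (mem (precomp_dsinj @: [set: dsinj L'' L]))) /=.
rewrite [X in _ + X]big1 ?addr0 => [|q hq]; last first.
  rewrite (lin_Z _ _ (kact_lin d)) kact_kstd_out ?scaler0 // => p e.
  by move/negP: hq; apply; rewrite e imset_f ?inE.
rewrite big_imset /=; last by move=> p p' _ _; exact: precomp_dsinj_inj.
apply: eq_big => [p|p _]; first by rewrite inE.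
by rewrite (lin_Z _ _ (kact_lin d)) kact_kstd_precomp.
Qed.
End Coinduced.

(* A linear form l on M L extends to the morphism u |-> sum_p l (p u) e_p from M
   to K, a map into the coinduced submodule spanned by the e_p. *)
Lemma eval_ds_inj (M : dsmod F) : fgen M -> forall L, injective (eval_ds M L).
Proof.
move=> [k [Ls [m hm]]] L x y exy.
apply/eqP; rewrite -subr_eq0; apply/eqP; apply: contrapT => nz.
have [l [ll lx]] := spanned_separation (hm L) nz.
pose f L' (u : M L') : kpow F L' :=
  \sum_(p : dsinj L' L) (l (dsact M (ds_of_inj p) u) : F) *: kstd F (@std_index L) p.
have fl L' : linear (@f L').
  move=> a u v; rewrite /f scaler_sumr -big_split /=; apply: eq_bigr => p _.
  by rewrite dsact_lin ll scalerDl scalerA.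
have fn L1 L2 (d : dsmor L1 L2) (u : M L1) : f L2 (dsact M d u) = dsact (Kds F) d (f L1 u).
  rewrite [RHS]kact_sum_kstd; apply: eq_bigr => p _.
  by rewrite ds_of_inj_precomp dsact_comp.
pose ff := @MkDsHom F M (Kds F) f fl fn.
have e : f L (x - y) = 0.
  rewrite (linB _ _ (fl L)); apply/eqP; rewrite subr_eq0; apply/eqP.
  exact: (congr1 (fun h : rephom (Phi_ob M) (krep F L) => h ff) exy).
apply: lx; have := congr1 (kcoord (@std_index L)) e.
by rewrite kcoord_sum_kstd ds_of_inj_id dsact_id (lin0 (kcoord_lin _)).
Qed.

(** Present N as S modulo ker q and apply [ksum_separation] to the image of ker q: the combination
    found descends to a map N -> K_L that is nonzero at x. *)
Lemma eval_rep_inj (N : rep F G) : polynomial_rep N -> injective (eval_rep N).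
Proof.
move=> /polynomial_presentation [k [Ls [S [io [q [ioi qs]]]]]].
suff h x : eval_rep N x = 0 -> x = 0.
  move=> x y e; apply/eqP; rewrite -subr_eq0; apply/eqP/h.
  by rewrite (linB _ _ (rh_lin (eval_rep N))) e subrr.
move=> ex; have [s es] := qs x; apply: contrapT => nx.
pose Y (u : ksum F Ls) := exists2 t, io t = u & q t = 0.
have nY : ~ Y (io s).
  by move=> [t /ioi -> qs0]; apply: nx; rewrite -es.
have [|||L [c [cY cx]]] := @ksum_separation F char0 k Ls Y (io s) _ _ _ nY.
- by exists 0; [exact: (lin0 (rh_lin io)) | exact: (lin0 (rh_lin q))].
- move=> a u v [t1 <- h1] [t2 <- h2]; exists (a *: t1 + t2); first exact: rh_lin.
  by rewrite (rh_lin q) h1 h2 scaler0 addr0.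
- move=> g u [t <- ht]; exists (rho S g t); first by rewrite rh_eq.
  by rewrite rh_eq ht (lin0 (@rho_lin _ _ N g)).
have [|f hf] := @rephom_descend F _ S N _ q (rhcomp (comb c) io) qs.
  by move=> t ht; apply: cY; exists t.
apply: cx; rewrite -[LHS]/(rhcomp (comb c) io s) -hf es.
exact: (congr1 (fun h : dshom (Psi_ob N) (Kds F) => h L f) ex).
Qed.

(** By [rephom_extension] a map N -> K_L, composed with q, is some [comb c], so Psi N at L is a
    subquotient of F^dsidx; there are no indices when L is large. *)
Lemma Psi_finite_length (N : rep F G) : polynomial_rep N -> finite_length (Psi_ob N).
Proof.
move=> /polynomial_presentation [k [Ls [S [io [q [ioi qs]]]]]].
have ext (L : FinSet) (f : rephom N (krep F L)) :
    exists c : dsidx Ls L -> F, forall s, f (q s) = comb c (io s).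
  apply: (@rephom_extension F char0 k Ls L S io (rhcomp f q)) => s.
  rewrite -[X in _ = X -> _](lin0 (rh_lin io)) => /ioi ->.
  exact: (lin0 (rh_lin (rhcomp f q))).
pose rel d (c : dsidx Ls (ord_fs d) -> F) (f : Psi_ob N (ord_fs d)) :=
  forall s, (f : rephom N (krep F _)) (q s) = comb c (io s).
apply: (@bounded_finite_length F (Psi_ob N) (ksum_bound Ls) _ rel) => [L hL f|d].
  have [c hc] := ext L f; apply: rephom_ext => x; have [s <-] := qs x.
  rewrite hc combE big1 // => -[j p] _.
  have := leq_card _ (dsinj_inj (p := p)) => /leq_trans/(_ (ksum_boundP Ls j)).
  by rewrite leqNgt hL.
split.
- by move=> s; rewrite combE big1 // => h _; rewrite scale0r.
- move=> a c c' f f' h h' s; rewrite rh_PE h h' !combE scaler_sumr -big_split /=.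
  by apply: eq_bigr => t _; rewrite scalerDl scalerA.
- by move=> f; exact: ext.
- move=> c f f' h h'; apply: rephom_ext => x; have [s <-] := qs x.
  by rewrite (h s) (h' s).
Qed.

(** Finitely many maps N -> K_(L_j) generate Psi N, and they are jointly injective because all of
    Psi N separates points of N. The passage to a quotient thus disappears. *)
Lemma polynomial_embedding (N : rep F G) : polynomial_rep N ->
  exists k (Ls : 'I_k -> FinSet) (io : rephom N (ksum F Ls)), injective io.
Proof.
move=> pN; have [k [Ls [m hm]]] := finite_length_fgen (Psi_finite_length pN).
exists k, Ls, (rhcomp (at_gens m) (eval_rep N)).
apply: inj_comp; first exact: at_gens_inj hm.
exact: eval_rep_inj.
Qed.

(** By [rephom_extension] the components of an embedding io generate Psi N, so h is determined by
    its values D on them. If D were outside the image of io, some combination would kill that image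
    but not D, although by [HD] its value at D is h at the zero map. *)
Lemma eval_rep_surj (N : rep F G) : polynomial_rep N ->
  forall h : Phi_ob (Psi_ob N), exists x, eval_rep N x = h.
Proof.
move=> pN h; have [k [Ls [io ioi]]] := polynomial_embedding pN.
pose H : dshom (Psi_ob N) (Kds F) := h.
pose pr j : Psi_ob N (Ls j) := rhcomp (kproj F Ls j) io.
pose D : ksum F Ls := fun j => H (Ls j) (pr j).
have HD L (c : dsidx Ls L -> F) : H L (rhcomp (comb c) io) = comb c D.
  rewrite combE -[RHS](_ : \sum_h c h *:
    H L (dsact (Psi_ob N) (ds_of_inj (tagged h)) (pr (tag h))) = _); last first.
    by apply: eq_bigr => t _; rewrite (dh_nat H).
  under eq_bigr => t _ do rewrite -(lin_Z _ _ (dh_lin H (L := L))).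
  rewrite -(lin_sum _ _ _ (dh_lin H (L := L))); congr (H L _).
  apply: rephom_ext => x.
  have ev : linear (fun f : rephom N (krep F L) => f x) by move=> a f g; exact: rh_PE.
  rewrite (lin_sum _ _ _ ev) -[LHS]/(comb c (io x)) combE; apply: eq_bigr => t _.
  by rewrite (lin_Z _ _ ev).
have [x xD] : exists x, io x = D.
  apply: contrapT => nD.
  have [||||L [c [cY cx]]] := @ksum_separation F char0 k Ls (fun u => exists x, io x = u) D.
  - by exists 0; exact: (lin0 (rh_lin io)).
  - by move=> a u v [x <-] [y <-]; exists (a *: x + y); exact: rh_lin.
  - by move=> g u [x <-]; exists (rho N g x); exact: rh_eq.
  - exact: nD.
  apply: cx; rewrite -HD (_ : rhcomp _ _ = 0) ?(lin0 (dh_lin H (L := L))) //.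
  by apply: rephom_ext => x; apply: cY; exists x.
exists x; apply: dshom_ext => L f.
have [|c hc] := @rephom_extension F char0 k Ls L N io f.
  move=> s; rewrite -[X in _ = X -> _](lin0 (rh_lin io)) => /ioi ->.
  exact: (lin0 (rh_lin (f : rephom _ _))).
have -> : f = rhcomp (comb c) io by apply: rephom_ext.
by rewrite -[RHS]/(H L _) HD -xD.
Qed.

End Evaluation.

(** * Monoidal structures *)

Section TensorGeneration.
Variable F : fieldType.

Definition in_span (M : dsmod F) k (Ls : 'I_k -> FinSet) (m : forall j, M (Ls j)) L (x : M L) :=
  exists c : dsidx Ls L -> F, x = \sum_h c h *: dsact M (ds_of_inj (tagged h)) (m (tag h)).

Lemma in_span0 (M : dsmod F) k (Ls : 'I_k -> FinSet) (m : forall j, M (Ls j)) L :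
  in_span m (0 : M L).
Proof. by exists (fun _ => 0); rewrite big1 // => h _; rewrite scale0r. Qed.
Lemma in_spanP (M : dsmod F) k (Ls : 'I_k -> FinSet) (m : forall j, M (Ls j)) L a (x y : M L) :
  in_span m x -> in_span m y -> in_span m (a *: x + y).
Proof.
move=> [c ->] [c' ->]; exists (fun h => a * c h + c' h).
rewrite scaler_sumr -big_split /=; apply: eq_bigr => h _.
by rewrite scalerDl scalerA.
Qed.
Lemma in_span_sum (M : dsmod F) k (Ls : 'I_k -> FinSet) (m : forall j, M (Ls j)) L
    (I : Type) (r : seq I) (c : I -> F) (x : I -> M L) :
  (forall i, in_span m (x i)) -> in_span m (\sum_(i <- r) c i *: x i).
Proof.
move=> h; elim: r => [|i r IH]; first by rewrite big_nil; exact: in_span0.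
by rewrite big_cons; exact: in_spanP.
Qed.
Lemma in_span_gen (M : dsmod F) k (Ls : 'I_k -> FinSet) (m : forall j, M (Ls j)) L j
    (d : dsmor (Ls j) L) : in_span m (dsact M d (m j)).
Proof.
have [p ->] := ds_of_inj_surj d.
exists (fun h => (h == existT (fun j => dsinj (Ls j) L) j p)%:R).
rewrite (bigD1 (existT (fun j => dsinj (Ls j) L) j p)) //= eqxx scale1r big1 ?addr0 //.
by move=> h /negbTE ->; rewrite scale0r.
Qed.

Lemma uds_fgen : fgen (uds F).
Proof.
exists 1%N, (fun _ => fs_empty), (fun _ => udelta (ds_id _)) => L x.
rewrite -/(in_span (M := uds F) (fun _ : 'I_1 => udelta (ds_id _)) x) (univ_sum x).
apply: in_span_sum => p; rewrite -/(udelta p.2) [udelta p.2]udelta_norm.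
exact: (@in_span_gen (uds F) 1 (fun _ => fs_empty) (fun _ => udelta (ds_id _)) L ord0 p.2).
Qed.

(** The tensors m_a (x) n_b generate: acting on the two factors separately is a special case of
    acting on the disjoint union. *)
Lemma cmod_fgen (M N : dsmod F) : fgen M -> fgen N -> fgen (cmod M N).
Proof.
move=> [k [Ls [m hm]]] [k' [Ls' [n hn]]].
pose e (i : 'I_#|{: 'I_k * 'I_k'}|) : 'I_k * 'I_k' := enum_val i.
pose LL i := fs_sum (Ls (e i).1) (Ls' (e i).2).
pose mn i : cmod M N (LL i) := cpure (ds_id _) (m (e i).1) (n (e i).2).
exists _, LL, mn => L x; rewrite -/(in_span mn x) (univ_sum x).
apply: in_span_sum => -[a [x1 y1 al u v]]; rewrite -/(cpure al u v).
have [c ->] := hm _ u; have [c' ->] := hn _ v.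
rewrite (lin_sum _ _ _ (cpure_linl al _)).
rewrite (eq_bigr (fun t => c t *: cpure al (dsact M (ds_of_inj (tagged t)) (m (tag t)))
    (\sum_h c' h *: dsact N (ds_of_inj (tagged h)) (n (tag h))))); last first.
  by move=> t _; rewrite (lin_Z _ _ (cpure_linl al _)).
apply: in_span_sum => t; rewrite (lin_sum _ _ _ (cpure_linr al _)).
rewrite (eq_bigr (fun h => c' h *: cpure al (dsact M (ds_of_inj (tagged t)) (m (tag t)))
    (dsact N (ds_of_inj (tagged h)) (n (tag h))))); last first.
  by move=> h _; rewrite (lin_Z _ _ (cpure_linr al _)).
apply: in_span_sum => h; rewrite cpure_d1.
have := in_span_gen mn (j := enum_rank (tag t, tag h)) (L := L).
rewrite /mn /LL /e; move: (in_span _) => sp; rewrite enum_rankK; exact.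
Qed.
End TensorGeneration.

Section PhiMonoidal.
Variable F : fieldType.
Local Notation G := (GAinf F).
Local Notation Ob := (@Phi_ob F).

Section UnitMap.
Variable a : F^o.
Lemma unit_map_adm z : uadm (F := F) (fun p : dsmor fs_empty z => (a : F) *: kact p (kone F)).
Proof. by []. Qed.
Definition unit_map_in z : uds F z -> Kds F z := Defs.lift (unit_map_adm z).
Lemma unit_map_in_lin z : linear (@unit_map_in z). Proof. exact: linearP. Qed.
Lemma unit_map_inE z (p : dsmor fs_empty z) :
  unit_map_in (udelta p) = (a : F) *: kact p (kone F).
Proof. exact: lift_gen. Qed.
Lemma unit_map_nat L L' (p : dsmor L L') (x : uds F L) :
  unit_map_in (dsact (uds F) p x) = dsact (Kds F) p (unit_map_in x).
Proof.
move: x; apply: uds_ext => [||q].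
- exact: lin_comp (@unit_map_in_lin L') (@dsact_lin _ (uds F) _ _ p).
- exact: lin_comp (@dsact_lin _ (Kds F) _ _ p) (@unit_map_in_lin L).
- by rewrite udelta_act !unit_map_inE kact_comp [RHS](lin_Z _ _ (kact_lin p)).
Qed.
Definition unit_map_fun : dshom (uds F) (Kds F) := MkDsHom unit_map_in_lin unit_map_nat.
End UnitMap.
Lemma unit_map_funE a z (p : dsmor fs_empty z) :
  unit_map_fun a z (udelta p) = (a : F) *: kact p (kone F).
Proof. exact: unit_map_inE. Qed.
Lemma dshom_uds_ext (M : dsmod F) (f g : dshom (uds F) M) :
  f _ (udelta (ds_id _)) = g _ (udelta (ds_id _)) -> f = g.
Proof.
move=> h; apply: dshom_ext => L; apply: uds_ext => [||p].
- exact: (@dh_lin _ _ _ f L).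
- exact: (@dh_lin _ _ _ g L).
- by rewrite udelta_norm !dh_nat h.
Qed.
Lemma unit_map_lin : linear unit_map_fun.
Proof.
move=> a b c; apply: dshom_uds_ext; rewrite dh_PE !unit_map_funE !kact_id.
by rewrite scalerDl scalerA.
Qed.
Lemma unit_map_eq g (x : runit_rep F G) :
  unit_map_fun (rho _ g x) = rho (Ob (uds F)) g (unit_map_fun x).
Proof.
apply: dshom_uds_ext; rewrite unit_map_funE.
rewrite -[RHS]/(kg g (unit_map_fun x _ (udelta (ds_id fs_empty)))) unit_map_funE kact_id.
by rewrite (lin_Z _ _ (@kg_lin F fs_empty g)) kg_kone.
Qed.
Definition phi_unit : rephom (runit_rep F G) (Ob (uds F)) :=
  @MkRepHom F G (runit_rep F G) (Ob (uds F)) unit_map_fun unit_map_lin unit_map_eq.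
Lemma phi_unitE a z (p : dsmor fs_empty z) :
  (phi_unit a : dshom (uds F) (Kds F)) z (udelta p) = (a : F) *: kact p (kone F).
Proof. exact: unit_map_funE. Qed.
Lemma phi_unit_inj : injective phi_unit.
Proof.
move=> a b /(congr1 (fun f : dshom (uds F) (Kds F) =>
  kcoord (fun _ => 0%N) (f _ (udelta (ds_id fs_empty))))).
rewrite !phi_unitE !kact_id !(lin_Z _ _ (kcoord_lin _)) !kcoord_kone.
by rewrite /GRing.scale /= !mulr1.
Qed.
(** By Yoneda, a morphism out of the unit is its value at the identity, here an element of the line
    spanned by [kone]. *)
Lemma phi_unit_surj (h : Ob (uds F)) : exists a, phi_unit a = h.
Proof.
pose H : dshom (uds F) (Kds F) := h.
exists (kcoord (fun _ => 0%N) (H _ (udelta (ds_id fs_empty)))).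
by apply: dshom_uds_ext; rewrite phi_unitE kact_id -kone_span.
Qed.

Lemma phi_mon_nat (A A' B B' : dsmod F) (f : dshom A A') (g : dshom B B') :
  rhcomp (phi_mon A B) (rtmor (Phi_mor f) (Phi_mor g)) =
  rhcomp (Phi_mor (cmor_hom f g)) (phi_mon A' B').
Proof.
apply: rh_text => u v; rewrite /= /rtmor_fun tmapE !phi_mon_funE.
apply: dshom_cext => x y m n.
by rewrite phi_pairE [RHS]/= cmor_funE phi_pair_funE.
Qed.

Lemma phi_mon_assoc (A B E : dsmod F) :
  rhcomp (rhcomp (Phi_mor (ascV_hom A B E)) (phi_mon (cmod A B) E))
    (rtmor (phi_mon A B) (rhid (Ob E))) =
  rhcomp (rhcomp (phi_mon A (cmod B E)) (rtmor (rhid (Ob A)) (phi_mon B E)))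
    (ra_hom (Ob A) (Ob B) (Ob E)).
Proof.
apply: rh_text3 => f g h; rewrite /= ta_funE /rtmor_fun !tmapE /= !phi_mon_funE.
apply: dshom_ext => L; apply: conv3r_ext => [||x1 x2 y al a b e].
- exact: (dh_lin (dhcomp (phi_pair (phi_pair f g) h) (ascV_hom A B E)) (L := L)).
- exact: (dh_lin (phi_pair f (phi_pair g h)) (L := L)).
rewrite [LHS]/= ascV_funE phi_pair_funE phi_pairE !phi_pairE !kact_id.
by rewrite kact_comp kjoin_assoc.
Qed.

Lemma phi_mon_lunit (A : dsmod F) :
  rhcomp (rhcomp (Phi_mor (luV_hom A)) (phi_mon (uds F) A))
    (rtmor phi_unit (rhid (Ob A))) = rl_hom (Ob A).
Proof.
apply: rh_text => a f; rewrite /= /rtmor_fun tmapE /= tl_funE phi_mon_funE.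
apply: dshom_ext => L m; rewrite dh_scaleE /= /luV_fun phi_pair_funE.
rewrite unit_map_funE kact_id (lin_Z _ _ (kjoin_linl _)) (lin_Z _ _ (kact_lin _)).
by rewrite kjoin_kone -kact_comp ds_luVK kact_id.
Qed.

Lemma phi_mon_braid (A B : dsmod F) :
  rhcomp (Phi_mor (br_hom B A)) (phi_mon A B) =
  rhcomp (phi_mon B A) (rb_hom (Ob A) (Ob B)).
Proof.
apply: rh_text => f g; rewrite /= tb_funE !phi_mon_funE.
apply: dshom_cext => x y m n; rewrite phi_pairE [LHS]/= br_funE phi_pair_funE.
by rewrite kact_comp kact_id kact_id kjoin_swap.
Qed.

(** The right unit is the left unit composed with the braiding on both sides, so the left unit law
    and compatibility with braidings suffice. *)
Lemma phi_mon_runit (A : dsmod F) :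
  rhcomp (rhcomp (Phi_mor (dhcomp (br_hom (uds F) A) (luV_hom A))) (phi_mon A (uds F)))
    (rtmor (rhid (Ob A)) phi_unit) =
  rhcomp (rl_hom (Ob A)) (rb_hom (Ob A) (runit_rep F G)).
Proof.
rewrite Phi_comp -[rhcomp (rhcomp (Phi_mor _) _) (phi_mon _ _)]rhcompA phi_mon_braid.
rewrite -phi_mon_lunit -!rhcompA; congr rhcomp; congr rhcomp.
exact: rb_nat.
Qed.

End PhiMonoidal.

Section PsiMonoidal.
Variable F : fieldType.
Local Notation G := (GAinf F).
Local Notation Ob := (@Psi_ob F).

Section Pair.
Variables N N' : rep F G.
Definition psi_pair (x y z : FinSet) (al : dsmor (fs_sum x y) z) (f : rephom N (krep F x))
    (g : rephom N' (krep F y)) : rephom (rtens N N') (krep F z) :=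
  rhcomp (kmor F al) (rhcomp (kjoin_hom F x y) (rtmor f g)).
Lemma psi_pairE x y z (al : dsmor (fs_sum x y) z) f g a b :
  psi_pair al f g (tpure a b) = kact al (kjoin (f a) (g b)).
Proof. by rewrite /= /rtmor_fun tmapE kjoin_mapE. Qed.
Lemma psi_mon_adm z : cadm (M := Ob N) (N := Ob N')
  (fun h : cgen (Ob N) (Ob N') z => psi_pair (ca h) (cm h) (cn h)).
Proof.
split=> [x y al g|x y al f|x x' y y' p q al f g] /=.
- move=> a f f'; apply: rh_text => u v.
  by rewrite rh_PE !psi_pairE rh_PE kjoin_linl kact_lin.
- move=> a g g'; apply: rh_text => u v.
  by rewrite rh_PE !psi_pairE rh_PE kjoin_linr kact_lin.
- by apply: rh_text => u v; rewrite !psi_pairE kact_comp kact_sum.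
Qed.
Definition psi_mon_fun z : cmod (Ob N) (Ob N') z -> Ob (rtens N N') z :=
  Defs.lift (psi_mon_adm z).
Lemma psi_mon_lin z : linear (@psi_mon_fun z). Proof. exact: linearP. Qed.
Lemma psi_mon_funE z x y (al : dsmor (fs_sum x y) z) (f : Ob N x) (g : Ob N' y) :
  psi_mon_fun (cpure al f g) = psi_pair al f g.
Proof. exact: lift_gen. Qed.
Lemma psi_mon_nat_act L L' (p : dsmor L L') (u : cmod (Ob N) (Ob N') L) :
  psi_mon_fun (dsact (cmod (Ob N) (Ob N')) p u) = dsact (Ob (rtens N N')) p (psi_mon_fun u).
Proof.
move: u; apply: conv_ext => [||x y al f g].
- exact: lin_comp (psi_mon_lin (z := L')) (cact_lin p).
- exact: lin_comp (@dsact_lin _ (Ob (rtens N N')) _ _ p) (psi_mon_lin (z := L)).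
rewrite cpure_act !psi_mon_funE.
by apply: rh_text => u v; rewrite psi_pairE kact_comp [in RHS]/= -psi_pairE.
Qed.
Definition psi_mon : dshom (cmod (Ob N) (Ob N')) (Ob (rtens N N')) :=
  MkDsHom psi_mon_lin psi_mon_nat_act.
Lemma psi_monE z x y (al : dsmor (fs_sum x y) z) (f : Ob N x) (g : Ob N' y) u v :
  (psi_mon z (cpure al f g) : rephom _ _) (tpure u v) =
  kact al (kjoin ((f : rephom _ _) u) ((g : rephom _ _) v)).
Proof. by rewrite -psi_pairE -psi_mon_funE. Qed.
End Pair.

Lemma psi_mon_nat (A A' B B' : rep F G) (f : rephom A A') (g : rephom B B') :
  dhcomp (psi_mon A B) (cmor_hom (Psi_mor f) (Psi_mor g)) =
  dhcomp (Psi_mor (rtmor f g)) (psi_mon A' B').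
Proof.
apply: dshom_cext => x y h h'; apply: rh_text => u v.
rewrite -[LHS]/((psi_mon A B _ (cmor_hom (Psi_mor f) (Psi_mor g) _ (cpure _ h h')) : rephom _ _) _).
rewrite cmor_homE psi_monE.
rewrite -[RHS]/((psi_mon A' B' _ (cpure _ h h') : rephom _ _) (rtmor f g (tpure u v))).
by rewrite rtmorE psi_monE.
Qed.

Lemma psi_mon_assoc (A B E : rep F G) :
  dhcomp (dhcomp (Psi_mor (rav_hom A B E)) (psi_mon (rtens A B) E))
    (cmor_hom (psi_mon A B) (dhid (Ob E))) =
  dhcomp (dhcomp (psi_mon A (rtens B E)) (cmor_hom (dhid (Ob A)) (psi_mon B E)))
    (asc_hom (Ob A) (Ob B) (Ob E)).
Proof.
apply: dshom_ext3l => x1 x2 y f g h; apply: rh_text3r => a b e.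
rewrite -[LHS]/((psi_mon (rtens A B) E _ (cmor_hom (psi_mon A B) (dhid (Ob E)) _
  (cpure (M := cmod (Ob A) (Ob B)) _ _ h)) : rephom _ _) (rav_hom A B E (tpure a (tpure b e)))).
rewrite (cmor_homE (psi_mon A B) (dhid (Ob E))) [rav_hom _ _ _ _]tav_funE psi_monE psi_monE.
rewrite -[RHS]/((psi_mon A (rtens B E) _ (cmor_hom (dhid (Ob A)) (psi_mon B E) _
  (asc_fun (cpure (M := cmod (Ob A) (Ob B)) _ _ h))) : rephom _ _) (tpure a (tpure b e))).
rewrite asc_funE (cmor_homE (dhid (Ob A)) (psi_mon B E)) psi_monE psi_monE.
by rewrite ds_1comp !kact_id kjoin_assocV.
Qed.
End PsiMonoidal.

Section PsiUnit.
Variable F : fieldType.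
Local Notation G := (GAinf F).
Local Notation Ob := (@Psi_ob F).

Section UnitVector.
Variables (z : FinSet) (p : dsmor fs_empty z).
Definition psi_unit_vec_fun (a : runit_rep F G) : krep F z := (a : F) *: kact p (kone F).
Lemma psi_unit_vec_lin : linear psi_unit_vec_fun.
Proof. by move=> a b c; rewrite /psi_unit_vec_fun scalerDl scalerA. Qed.
Lemma psi_unit_vec_eq g a :
  psi_unit_vec_fun (rho _ g a) = rho (krep F z) g (psi_unit_vec_fun a).
Proof.
rewrite [RHS](lin_Z _ _ (@kg_lin F z g)); congr (_ *: _).
by rewrite -[in LHS](kg_kone g); exact: (kact_eq p g (kone F)).
Qed.
Definition psi_unit_vec : rephom (runit_rep F G) (krep F z) :=
  MkRepHom psi_unit_vec_lin psi_unit_vec_eq.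
End UnitVector.

Lemma psi_unit_adm z : uadm (F := F) (@psi_unit_vec z). Proof. by []. Qed.
Definition psi_unit_fun z : uds F z -> Ob (runit_rep F G) z := Defs.lift (@psi_unit_adm z).
Lemma psi_unit_lin z : linear (@psi_unit_fun z). Proof. exact: linearP. Qed.
Lemma psi_unit_funE z (p : dsmor fs_empty z) : psi_unit_fun (udelta p) = psi_unit_vec p.
Proof. exact: lift_gen. Qed.
Lemma psi_unit_nat L L' (p : dsmor L L') (x : uds F L) :
  psi_unit_fun (dsact (uds F) p x) = dsact (Ob (runit_rep F G)) p (psi_unit_fun x).
Proof.
move: x; apply: uds_ext => [||q].
- exact: lin_comp (@psi_unit_lin L') (@dsact_lin _ (uds F) _ _ p).
- exact: lin_comp (@dsact_lin _ (Ob (runit_rep F G)) _ _ p) (@psi_unit_lin L).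
rewrite udelta_act !psi_unit_funE; apply: rephom_ext => a.
by rewrite /= /psi_unit_vec_fun kact_comp (lin_Z _ _ (kact_lin p)).
Qed.
Definition psi_unit : dshom (uds F) (Ob (runit_rep F G)) :=
  MkDsHom psi_unit_lin psi_unit_nat.
Lemma psi_unitE z (p : dsmor fs_empty z) a :
  (psi_unit z (udelta p) : rephom _ _) a = (a : F) *: kact p (kone F).
Proof. by rewrite [psi_unit z _]psi_unit_funE. Qed.

Lemma psi_mon_lunit (A : rep F G) :
  dhcomp (dhcomp (Psi_mor (rlv_hom A)) (psi_mon (runit_rep F G) A))
    (cmor_hom psi_unit (dhid (Ob A))) = lu_hom (Ob A).
Proof.
apply: dshom_ext => L; apply: convu_ext => [||y al f].
- exact: (dh_lin (dhcomp (dhcomp (Psi_mor (rlv_hom A)) (psi_mon (runit_rep F G) A))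
    (cmor_hom psi_unit (dhid (Ob A)))) (L := L)).
- exact: (dh_lin (lu_hom (Ob A)) (L := L)).
rewrite [RHS]lu_funE; apply: rephom_ext => x.
rewrite -[LHS]/((psi_mon (runit_rep F G) A _ (cmor_hom psi_unit (dhid (Ob A)) _
  (cpure (M := uds F) al _ f)) : rephom _ _) (tpure (1 : F^o) x)).
rewrite (cmor_homE psi_unit) psi_monE psi_unitE scale1r kact_id kjoin_kone.
by rewrite -kact_comp.
Qed.

Lemma psi_mon_braid (A B : rep F G) :
  dhcomp (Psi_mor (rb_hom B A)) (psi_mon A B) =
  dhcomp (psi_mon B A) (br_hom (Ob A) (Ob B)).
Proof.
apply: dshom_cext => x y f g; apply: rh_text => u v.
rewrite -[LHS]/((psi_mon A B _ (cpure _ f g) : rephom _ _) (rb_hom B A (tpure u v))).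
rewrite [rb_hom _ _ _]tb_funE psi_monE.
rewrite -[RHS]/((psi_mon B A _ (br_fun (cpure _ f g)) : rephom _ _) (tpure u v)).
by rewrite br_funE psi_monE ds_1comp kact_id kjoin_swap.
Qed.

Lemma psi_mon_runit (A : rep F G) :
  dhcomp (dhcomp (Psi_mor (rhcomp (rb_hom (runit_rep F G) A) (rlv_hom A)))
      (psi_mon A (runit_rep F G)))
    (cmor_hom (dhid (Ob A)) psi_unit) =
  dhcomp (lu_hom (Ob A)) (br_hom (Ob A) (uds F)).
Proof.
rewrite Psi_comp -[dhcomp (dhcomp (Psi_mor _) _) (psi_mon _ _)]dhcompA psi_mon_braid.
rewrite -psi_mon_lunit -!dhcompA; congr dhcomp; congr dhcomp.
exact: br_hom_nat.
Qed.

Lemma Psi_mor_inj (N N' : rep F G) (f : rephom N N') L :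
  (forall y, exists x, f x = y) -> injective (Psi_mor f L).
Proof.
move=> fs h h' e; apply: rephom_ext => y; have [x <-] := fs y.
exact: (congr1 (fun k : rephom N (krep F L) => k x) e).
Qed.
Lemma Psi_mor_surj (N N' : rep F G) (f : rephom N N') L :
  injective f -> (forall y, exists x, f x = y) ->
  forall h, exists h', Psi_mor f L h' = h.
Proof.
move=> fi fs h; exists (rhcomp h (rep_inv fi fs)).
apply: rephom_ext => x; congr (rh (h : rephom _ _) _).
exact: (congr1 (fun k : rephom N N => k x) (rep_invK fi fs)).
Qed.

Hypothesis char0 : forall m, m.+1%:R != 0 :> F.

Lemma rtmor_bij (A A' B B' : rep F G) (f : rephom A A') (g : rephom B B') :
  injective f -> (forall y, exists x, f x = y) ->
  injective g -> (forall y, exists x, g x = y) ->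
  injective (rtmor f g) /\ (forall y, exists x, rtmor f g x = y).
Proof.
move=> fi fs gi gs; pose h := rtmor (rep_inv fi fs) (rep_inv gi gs).
have hK : cancel (rtmor f g) h.
  move=> x; rewrite -[LHS]/(rhcomp h (rtmor f g) x) -rtmorM !rep_invK.
  by rewrite rtmor1.
have Kh : cancel h (rtmor f g).
  move=> x; rewrite -[LHS]/(rhcomp (rtmor f g) h x) -rtmorM !rep_invVK.
  by rewrite rtmor1.
by split; [exact: can_inj hK | move=> y; exists (h y)].
Qed.

(** The comparison map of Psi is that of Phi transported along the evaluation maps. On polynomial
    representations all three factors are bijective, whence [psi_mon_bij]. *)
Lemma psi_mon_via_phi (N N' : rep F G) :
  psi_mon N N' = dhcomp (Psi_mor (rtmor (eval_rep N) (eval_rep N')))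
    (dhcomp (Psi_mor (phi_mon (Ob N) (Ob N'))) (eval_ds (cmod (Ob N) (Ob N')))).
Proof.
apply: dshom_cext => x y f g; apply: rh_text => u v; rewrite psi_monE.
rewrite -[RHS]/((phi_mon (Ob N) (Ob N') (rtmor (eval_rep N) (eval_rep N') (tpure u v))
  : dshom _ _) _ (cpure (ds_id _) f g)).
by rewrite rtmorE phi_monE phi_pairE.
Qed.

Lemma psi_unit_via_phi :
  psi_unit = dhcomp (Psi_mor (phi_unit F)) (eval_ds (uds F)).
Proof.
apply: dshom_uds_ext; apply: rephom_ext => a; rewrite psi_unitE.
by rewrite -[RHS]/((phi_unit F a : dshom _ _) _ (udelta (ds_id _))) phi_unitE.
Qed.

Lemma psi_mon_bij (N N' : rep F G) : polynomial_rep N -> polynomial_rep N' ->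
  (forall L, injective (psi_mon N N' L)) /\
  (forall L y, exists x, psi_mon N N' L x = y).
Proof.
move=> pN pN'.
have gN := finite_length_fgen (Psi_finite_length char0 pN).
have gN' := finite_length_fgen (Psi_finite_length char0 pN').
have gNN := cmod_fgen gN gN'.
have [ti ts] := rtmor_bij (eval_rep_inj char0 pN) (eval_rep_surj char0 pN)
  (eval_rep_inj char0 pN') (eval_rep_surj char0 pN').
have mi := @phi_mon_inj F (Ob N) (Ob N'); have ms := phi_mon_surj gN gN'.
rewrite psi_mon_via_phi; split=> L.
  apply: inj_comp; first exact: Psi_mor_inj.
  apply: inj_comp; first exact: Psi_mor_inj.
  exact: (eval_ds_inj gNN).
move=> y; have [y1 <-] := Psi_mor_surj ti ts y.
have [y2 <-] := Psi_mor_surj mi ms y1.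
by have [y3 <-] := eval_ds_surj char0 gNN y2; exists y3.
Qed.

Lemma psi_unit_bij :
  (forall L, injective (psi_unit L)) /\ (forall L y, exists x, psi_unit L x = y).
Proof.
have gu := uds_fgen F; have ui := @phi_unit_inj F; have us := @phi_unit_surj F.
rewrite psi_unit_via_phi; split=> L.
  apply: inj_comp; first exact: Psi_mor_inj.
  exact: (eval_ds_inj gu).
move=> y; have [y1 <-] := Psi_mor_surj ui us y.
by have [y2 <-] := eval_ds_surj char0 gu y1; exists y2.
Qed.

(** A polynomial representation embeds in a sum of tensor powers, and such an embedding can be
    composed with f. *)
Lemma polynomial_injective (N N' : rep F G) (f : rephom N N') :
  injective f -> polynomial_rep N' -> polynomial_rep N.
Proof.
move=> fi /(polynomial_embedding char0)[k [Ls [io ioi]]].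
by apply: (@polynomial_of_ksum F N k Ls (rhcomp io f)); exact: inj_comp.
Qed.

Lemma Mod_ds_tensor_closed : @tensor_closed F (Mod_ds_ten F) (@finite_length F).
Proof.
split=> [|A B hA hB]; apply: fgen_finite_length; first exact: uds_fgen.
by apply: cmod_fgen; exact: finite_length_fgen.
Qed.

(** The tensor product of A and B embeds in Phi of the convolution of Psi A and Psi B, through the
    evaluation maps and [phi_mon]; this avoids tensoring subquotients of direct sums. *)
Lemma Rep_GA_tensor_closed : @tensor_closed F (Rep_GA F) (@polynomial_rep F).
Proof.
split=> [|A B pA pB].
  apply: (polynomial_injective (@phi_unit_inj F)); exact: Phi_polynomial (uds_fgen F).
have gA := finite_length_fgen (Psi_finite_length char0 pA).
have gB := finite_length_fgen (Psi_finite_length char0 pB).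
have [ti _] := rtmor_bij (eval_rep_inj char0 pA) (eval_rep_surj char0 pA)
  (eval_rep_inj char0 pB) (eval_rep_surj char0 pB).
apply: (polynomial_injective (f := rhcomp (phi_mon (Ob A) (Ob B))
  (rtmor (eval_rep A) (eval_rep B)))).
  by apply: inj_comp ti; exact: phi_mon_inj.
exact: Phi_polynomial (cmod_fgen gA gB).
Qed.

End PsiUnit.

(** * Assembling the equivalence and its two monoidal structures *)

Section Equivalence.
Variable F : fieldType.
Hypothesis char0 : forall m, m.+1%:R != 0 :> F.

Lemma Phi_finite_polynomial (M : Mod_ds F) : finite_length M -> polynomial_rep (Phi F M).
Proof. by move=> fM; apply: Phi_polynomial; exact: finite_length_fgen. Qed.

Lemma Psi_polynomial_finite (N : Rep F (GAinf F)) :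
  polynomial_rep N -> finite_length (Psi F N).
Proof. exact: Psi_finite_length. Qed.

Local Notation Mod_f := (full_tencat (Mod_ds_tensor_closed F)).
Local Notation Rep_pol := (full_tencat (Rep_GA_tensor_closed char0)).
Local Notation PhiF := (cfunctor_full (C := Mod_ds F) (D := Rep F (GAinf F))
  Phi_finite_polynomial : cfunctor Mod_f Rep_pol).
Local Notation PsiF := (cfunctor_full (C := Rep F (GAinf F)) (D := Mod_ds F)
  Psi_polynomial_finite : cfunctor Rep_pol Mod_f).

Lemma eval_ds_hom_nat (M N : dsmod F) (f : dshom M N) :
  dhcomp (Psi_mor (Phi_mor f)) (eval_ds M) = dhcomp (eval_ds N) f.
Proof. by apply: dshom_ext => L x; exact: rephom_ext. Qed.
Lemma eval_rep_hom_nat (M N : rep F (GAinf F)) (f : rephom M N) :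
  rhcomp (Phi_mor (Psi_mor f)) (eval_rep M) = rhcomp (eval_rep N) f.
Proof. by apply: rephom_ext => x; exact: dshom_ext. Qed.

Lemma Phi_Psi_quasi_inverse : quasi_inverse PhiF PsiF.
Proof.
split.
  exists (fun A : Mod_f => @full_iso F (Mod_ds F) (@finite_length F) A (PsiF (PhiF A))
    (ds_iso (eval_ds_inj (finite_length_fgen (svalP A)))
            (eval_ds_surj char0 (finite_length_fgen (svalP A))))) => A B f.
  exact: eval_ds_hom_nat.
exists (fun N : Rep_pol => @full_iso F (Rep F _) (@polynomial_rep F) N (PhiF (PsiF N))
  (rep_iso (eval_rep_inj char0 (svalP N)) (eval_rep_surj char0 (svalP N)))) => A B f.
exact: eval_rep_hom_nat.
Qed.

Definition Phi_monoidal : sym_monoidal PhiF.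
Proof.
refine (@SymMonoidal F Mod_f Rep_pol PhiF
  (fun A B => @full_iso F (Rep F _) (@polynomial_rep F) (@tens F Rep_pol (PhiF A) (PhiF B)) (PhiF (@tens F Mod_f A B))
     (rep_iso (@phi_mon_inj F (sval A) (sval B))
        (phi_mon_surj (finite_length_fgen (svalP A)) (finite_length_fgen (svalP B)))))
  (@full_iso F (Rep F _) (@polynomial_rep F) (@tunit F Rep_pol) (PhiF (@tunit F Mod_f))
     (rep_iso (@phi_unit_inj F) (@phi_unit_surj F))) _ _ _ _ _).
- by move=> A A' B B' f g; exact: phi_mon_nat.
- by move=> A B E; exact: phi_mon_assoc.
- by move=> A; exact: phi_mon_lunit.
- by move=> A; exact: phi_mon_runit.
- by move=> A B; exact: phi_mon_braid.
Defined.

Definition Psi_monoidal : sym_monoidal PsiF.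
Proof.
refine (@SymMonoidal F Rep_pol Mod_f PsiF
  (fun A B => @full_iso F (Mod_ds F) (@finite_length F) (@tens F Mod_f (PsiF A) (PsiF B)) (PsiF (@tens F Rep_pol A B))
     (ds_iso (psi_mon_bij char0 (svalP A) (svalP B)).1
             (psi_mon_bij char0 (svalP A) (svalP B)).2))
  (@full_iso F (Mod_ds F) (@finite_length F) (@tunit F Mod_f) (PsiF (@tunit F Rep_pol))
     (ds_iso (psi_unit_bij char0).1 (psi_unit_bij char0).2)) _ _ _ _ _).
- by move=> A A' B B' f g; exact: psi_mon_nat.
- by move=> A B E; exact: psi_mon_assoc.
- by move=> A; exact: psi_mon_lunit.
- by move=> A; exact: psi_mon_runit.
- by move=> A B; exact: psi_mon_braid.
Defined.
End Equivalence.

Theorem mainTheorem13 (R : realType) :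
  exists (cM : @tensor_closed _ (Mod_ds_ten R[i]) (@finite_length R[i]))
         (cN : @tensor_closed _ (Rep_GA R[i]) (@polynomial_rep R[i]))
         (hPhi : forall M : Mod_ds R[i], finite_length M -> polynomial_rep (Phi R[i] M))
         (hPsi : forall N : Rep R[i] (GAinf R[i]),
                   polynomial_rep N -> finite_length (Psi R[i] N)),
    let Mod_f : tencat R[i] := full_tencat cM in
    let Rep_pol : tencat R[i] := full_tencat cN in
    let PhiF : cfunctor Mod_f Rep_pol := cfunctor_full hPhi in
    let PsiF : cfunctor Rep_pol Mod_f := cfunctor_full hPsi in
    [/\ quasi_inverse PhiF PsiF,
        inhabited (sym_monoidal PhiF) &
        inhabited (sym_monoidal PsiF)].
Proof.
have char0 m : m.+1%:R != 0 :> R[i] by rewrite Num.Theory.pnatr_eq0.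
exists (Mod_ds_tensor_closed R[i]), (Rep_GA_tensor_closed char0),
  (@Phi_finite_polynomial R[i]), (Psi_polynomial_finite char0).
split; first exact: Phi_Psi_quasi_inverse.
  by apply: inhabits; exact: Phi_monoidal.
by apply: inhabits; exact: Psi_monoidal.
Qed.
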